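(* Let $(Y,d_Y,\mu_Y)$ be a metric measure space (in the sense of the context) such that $(Y,d_Y)$ is a length space, and let $\alpha,\beta$ be two fixed positive real numbers. Suppose also that $Y$ is an $\infty$-weak local $(p,p)$-Poincaré space for some $p$ with $1\le p<\infty$. (a) If $p\le\beta/\alpha$, then the metric measure space $\mathbb{H}^\circ_{\alpha,\beta}(Y)$ is a $(p,p)$-Sobolev--Poincaré space with a constant $C=C(\beta,p)$ depending only on $\beta$ and $p$, and consequently $$D^{1,p}(\mathbb{H}^\circ_{\alpha,\beta}(Y))=N^{1,p}(\mathbb{H}^\circ_{\alpha,\beta}(Y))+\mathbb{R}.\qquad(\ast)$$ (b) If $p\le\beta/\alpha$ and $\mu_Y(Y)<\infty$, then $\mathbb{H}_{\alpha,\beta}(Y)$ is a $(p,p)$-Sobolev--Poincaré space with a constant $C=C(\beta,p)$ depending only on $\beta$ and $p$, and therefore $$D^{1,p}(\mathbb{H}_{\alpha,\beta}(Y))=N^{1,p}(\mathbb{H}_{\alpha,\beta}(Y))+\mathbb{R}.\qquad(\ast\ast)$$ (c) If $p>\beta/\alpha$ and $Y$ has at least two points, then $(\ast)$ fails to hold, and if $p>\beta/\alpha$, $Y$ has at least two points and $\mu_Y(Y)<\infty$, then $(\ast\ast)$ fails to hold.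
   Context: **Metric measure spaces.** A metric measure space is a triple $(Z,d_Z,\mu_Z)$ where $(Z,d_Z)$ is a non-empty separable metric space, $\mu_Z$ is a Borel regular outer measure on $Z$ (defined on all subsets; measurable sets are those satisfying Carathéodory's criterion; Borel sets are measurable; $\mu_Z(A)=\inf\{\mu_Z(F): F\supset A \text{ Borel}\}$ for all $A\subset Z$), and $0<\mu_Z(B)<\infty$ for all (open) balls $B\subset Z$. Write $u_B$ for the $\mu_Z$-average of $u$ over $B$. **Paths.** A path in a (pseudo)metric space $(Z,d_Z)$ is a continuous map $\gamma:[a,b]\to Z$; $\operatorname{len}_{d_Z}(\gamma)$ is the supremum of $\sum_i d_Z(\gamma(t_{i-1}),\gamma(t_i))$ over partitions; $\gamma$ is rectifiable if this is finite, and a rectifiable $\gamma$ is absolutely continuous if $t\mapsto \operatorname{len}_{d_Z}(\gamma|_{[a,t]})$ is absolutely continuous. The metric speed is $|\gamma'(t)|=\lim_{u\to t} d_Z(\gamma(u),\gamma(t))/|u-t|$, which exists for a.e. $t$ if $\gamma$ is absolutely continuous. For Borel $\rho\ge 0$, $\int_\gamma\rho\,ds=\int\rho(\tilde\gamma(t))|\tilde\gamma'(t)|\,dt$ for any absolutely continuous reparametrization $\tilde\gamma$ of $\gamma$. $(Z,d_Z)$ is a length space if any two points are joined by a rectifiable path and $d_Z(x,y)$ is the infimum of lengths of rectifiable paths from $x$ to $y$. **Function spaces.** For measurable $u:Z\to[-\infty,\infty]$, a Borel function $g:Z\to[0,\infty]$ is an upper gradient of $u$ if $|u(\gamma(b))-u(\gamma(a))|\le\int_\gamma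 g\,ds$ for each non-constant absolutely continuous curve $\gamma:[a,b]\to Z$. A function is integrable over balls if it is in $L^1(B,\mu_Z)$ for every ball $B$. $D^{1,p}(Z)$ is the set of measurable $u:Z\to[-\infty,\infty]$ that are integrable over balls and have an upper gradient $g\in L^p(Z,\mu_Z)$. $N^{1,p}(Z)$ is the set of $u\in D^{1,p}(Z)$ with $\int_Z|u|^p\,d\mu_Z<\infty$. $N^{1,p}(Z)+\mathbb{R}$ is the set of functions $v+c$ with $v\in N^{1,p}(Z)$, $c\in\mathbb{R}$ constant. **Poincaré conditions.** $Z$ is a $(p,q)$-Sobolev--Poincaré space with constant $C>0$ if for all $u\in D^{1,q}(Z)$ and all upper gradients $g\in L^q(Z)$ of $u$ there is $c_u\in\mathbb{R}$ with $\|u-c_u\|_{L^p(Z,\mu_Z)}\le C\|g\|_{L^q(Z,\mu_Z)}$. $Z$ is an $\infty$-weak local $(p,q)$-Poincaré space if for every $x\in Z$ there are $C_x,r_x>0$ such that for every $u$ that is integrable over balls and every upper gradient $g$ of $u$ on $Z$, $\|u-u_{B_Z(x,r_x)}\|_{L^p(B_Z(x,r_x),\mu_Z)}\le C_x\|g\|_{L^q(Z,\mu_Z)}$. **Warped products.** Fix a norm $\|\cdot\|$ on $\mathbb{R}^2$ that is unitary ($\|(1,0)\|=\|(0,1)\|=1$) and coordinate-increasing ($\|(a,c)\|\le\|(b,d)\|$ whenever $0\le a\le b$, $0\le c\le d$); the choice is arbitrary. For length spaces $X,Y$ and continuous $\varphi:X\to[0,\infty)$, and for a path $\gamma=(\gamma_X,\gamma_Y):[a,b]\to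 X\times Y$ absolutely continuous with respect to the $\ell^1$-product metric, set $\ell_\varphi(\gamma)=\int_a^b\|(|\gamma_X'(t)|,\varphi(\gamma_X(t))|\gamma_Y'(t)|)\|\,dt$. Let $d_\varphi((x,y),(x',y'))=\inf_\gamma\ell_\varphi(\gamma)$ over absolutely continuous paths from $(x,y)$ to $(x',y')$ (a pseudometric). $X\times_\varphi Y$ is the quotient of $X\times Y$ identifying points at $d_\varphi$-distance $0$, with the induced metric $d_\varphi$, and $P_\varphi:X\times Y\to X\times_\varphi Y$ is the projection. If $\mu_X,\mu_Y$ are measures on $X,Y$, then $X\times_\varphi Y$ carries $\mu_\varphi(A)=(\mu_X\times\mu_Y)(P_\varphi^{-1}(A))$, where $\mu_X\times\mu_Y$ is the product outer measure. **Solid hyperbolic fillings.** $\mathbb{H}^\circ_{\alpha,\beta}(Y)=([0,\infty),d_{\mathrm{Eucl}},e^{\beta t}\,dt)\times_{\varphi_\alpha}(Y,d_Y,\mu_Y)$ with $\varphi_\alpha(t)=e^{\alpha t}$, and (when $\mu_Y(Y)<\infty$) $\mathbb{H}_{\alpha,\beta}(Y)=([0,\infty),d_{\mathrm{Eucl}},\sinh^\beta(t)\,dt)\times_{\psi_\alpha}(Y,d_Y,\mu_Y)$ with $\psi_\alpha(t)=\sinh^\alpha(t)$. *)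

(* Defs.v *)
From HB Require Import structures.
From mathcomp Require Import all_boot all_order all_algebra.
From mathcomp Require Import interval_inference.
From mathcomp Require Import all_classical all_reals all_analysis.
From mathcomp Require Import measurable_realfun.

Set Implicit Arguments.
Unset Strict Implicit.
Unset Printing Implicit Defensive.
Import Order.TTheory GRing.Theory Num.Theory.
Import numFieldNormedType.Exports.

Local Open Scope classical_set_scope.
Local Open Scope ring_scope.

(* One carrier is considered with several (pseudo)distances below (the
   l^1-product distance and the warped distance on X * Y), so the distance is an
   explicit argument rather than a metricType structure on the carrier. *)
Section metric_notions.
Context {R : realType} {T : Type}.
Implicit Types (d : T -> T -> R) (x y : T) (gamma : R -> T) (a b : R).

Definition is_metric d : Prop :=
  [/\ forall x y, (d x y = 0) <-> (x = y),
      forall x y, d x y = d y x &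
      forall x y z, d x z <= d x y + d y z].

Definition oball d x (r : R) : set T := [set y | d x y < r].

Definition dopen d : set (set T) :=
  [set U | forall x, U x -> exists2 r : R, 0 < r & oball d x r `<=` U].

Definition dborel d : set (set T) := <<s dopen d >>.

Definition dseparable d : Prop :=
  exists2 D : set T, countable D &
    forall x (e : R), 0 < e -> exists2 y, D y & d x y < e.

(* A path [a, b] -> T is a function R -> T whose values outside [a, b] are
   irrelevant. *)
Definition is_path d a b gamma : Prop :=
  a <= b /\
  forall t, a <= t <= b ->
    d (gamma u) (gamma t) @[u --> within `[a, b] (nbhs t)] --> 0.

Definition path_len d a b gamma : \bar R :=
  ereal_sup
    [set (\sum_(i < size s)
            d (gamma (nth b (a :: s) i)) (gamma (nth b (a :: s) i.+1)))%:E
    | s in itv_partition a b].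

Definition rectifiable d a b gamma : Prop :=
  is_path d a b gamma /\ (path_len d a b gamma < +oo)%E.

Definition abs_cont a b (f : R -> R) : Prop :=
  forall e : R, 0 < e -> exists2 delta : R, 0 < delta &
    forall (n : nat) (s t : 'I_n -> R),
      (forall i, [/\ a <= s i, s i <= t i & t i <= b]) ->
      (forall i j, i != j -> t i <= s j \/ t j <= s i) ->
      \sum_(i < n) (t i - s i) < delta ->
      \sum_(i < n) `|f (t i) - f (s i)| < e.

Definition ac_path d a b gamma : Prop :=
  rectifiable d a b gamma /\
  abs_cont a b (fun t => fine (path_len d a t gamma)).

(* Junk value where the limit does not exist; for an absolutely continuous path
   this happens only on a null set. *)
Definition speed d a b gamma (t : R) : R :=
  lim ((d (gamma u) (gamma t) / `|u - t|) @[u --> within `[a, b] (dnbhs t)]).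

(* Only used for absolutely continuous gamma, which is then its own absolutely
   continuous reparametrization. *)
Definition line_integral d a b gamma (rho : T -> \bar R) : \bar R :=
  (\int[lebesgue_measure]_(t in `[a, b])
     (rho (gamma t) * (speed d a b gamma t)%:E))%E.

Definition length_space d : Prop :=
  forall x y,
    let lens := [set l : \bar R | exists a b gamma,
      [/\ rectifiable d a b gamma, gamma a = x, gamma b = y &
          l = path_len d a b gamma]] in
    lens !=set0 /\ (d x y)%:E = ereal_inf lens.

End metric_notions.

(* The data (Z, d_Z, mu_Z); non-emptiness is part of pointedType. *)
Record mmdata (R : realType) := MMData {
  carrier :> pointedType ;
  dist : carrier -> carrier -> R ;
  mass : {outer_measure set carrier -> \bar R} }.
Arguments dist {R} _ _ _.
Arguments mass {R} _.

Section function_spaces.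
Context {R : realType} (Z : mmdata R).
Local Open Scope ereal_scope.

Definition borel_regular : Prop :=
  dborel (dist Z) `<=` (mass Z).-caratheodory /\
  forall A : set Z,
    mass Z A =
    ereal_inf [set mass Z F | F in [set F | dborel (dist Z) F /\ A `<=` F]].

Definition metric_measure_space : Prop :=
  [/\ is_metric (dist Z), dseparable (dist Z), borel_regular &
      forall (x : Z) (r : R), (0 < r)%R -> 0 < mass Z (oball (dist Z) x r) < +oo].

Definition cara := caratheodory_type (mass Z).
HB.instance Definition _ := Measurable.on cara.
Definition borelT := g_sigma_algebraType (dopen (dist Z)).
HB.instance Definition _ := Measurable.on borelT.

Definition mmeas : {measure set cara -> \bar R} := mass Z.

Implicit Types (u v : Z -> \bar R) (g : Z -> \bar R) (p q : R).

Definition mmeasurable u : Prop := measurable_fun [set: cara] (u : cara -> \bar R).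

(* In \bar R both +oo - +oo and -oo - -oo equal -oo, so the left-hand side of the
   inequality is +oo as soon as u is infinite at one of the two end points. *)
Definition upper_gradient u g : Prop :=
  [/\ forall x, 0 <= g x,
      measurable_fun [set: borelT] (g : borelT -> \bar R) &
      forall (a b : R) (gamma : R -> Z),
        ac_path (dist Z) a b gamma ->
        (exists s t, [/\ (a <= s <= b)%R, (a <= t <= b)%R & gamma s <> gamma t]) ->
        `| u (gamma b) - u (gamma a) | <= line_integral (dist Z) a b gamma g].

Definition integrable_over_balls u : Prop :=
  forall (x : Z) (r : R), (0 < r)%R ->
    mmeas.-integrable (oball (dist Z) x r) (u : cara -> \bar R).

Definition in_Lp p g : Prop := 'N[mmeas]_(p%:E)[(g : cara -> \bar R)] < +oo.

Definition D1 p : set (Z -> \bar R) :=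
  [set u | [/\ mmeasurable u, integrable_over_balls u &
               exists2 g, upper_gradient u g & in_Lp p g]].

Definition N1 p : set (Z -> \bar R) :=
  [set u | D1 p u /\ \int[mmeas]_(x in [set: cara]) (`|u x| `^ p) < +oo].

Definition N1_plus_cst p : set (Z -> \bar R) :=
  [set u | exists2 v, N1 p v & exists c : R, u = (fun x => v x + c%:E)].

Definition sobolev_poincare p q (C : R) : Prop :=
  (0 < C)%R /\
  forall u g, D1 q u -> upper_gradient u g -> in_Lp q g ->
    exists c : R,
      'N[mmeas]_(p%:E)[(fun x : cara => u x - c%:E)] <=
      C%:E * 'N[mmeas]_(q%:E)[(g : cara -> \bar R)].

Definition average u (B : set Z) : R :=
  (fine (\int[mmeas]_(x in (B : set cara)) u x) / fine (mmeas B))%R.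

(* f \_ B is f on B and 0 off B, so its norm over Z is the norm of f over B. *)
Definition weak_local_poincare p q : Prop :=
  forall x : Z, exists C r : R, [/\ (0 < C)%R, (0 < r)%R &
    forall u g, mmeasurable u -> integrable_over_balls u -> upper_gradient u g ->
      let B := oball (dist Z) x r in
      'N[mmeas]_(p%:E)[((fun y : cara => u y - (average u B)%:E) \_ B)] <=
      C%:E * 'N[mmeas]_(q%:E)[(g : cara -> \bar R)]].

End function_spaces.
Arguments borel_regular {R} Z.
Arguments metric_measure_space {R} Z.
Arguments mmeasurable {R} Z u.
Arguments upper_gradient {R} Z u g.
Arguments integrable_over_balls {R} Z u.
Arguments in_Lp {R} Z p g.
Arguments D1 {R} Z p.
Arguments N1 {R} Z p.
Arguments N1_plus_cst {R} Z p.
Arguments sobolev_poincare {R} Z p q C.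
Arguments weak_local_poincare {R} Z p q.

Section product_outer_measure.
Context {R : realType} (X Y : mmdata R).
Local Open Scope ereal_scope.

Definition rect_cover (A : set (X * Y)) : set ((nat -> set X) * (nat -> set Y)) :=
  [set FG | (forall k, (mass X).-caratheodory (FG.1 k) /\
                       (mass Y).-caratheodory (FG.2 k)) /\
            A `<=` \bigcup_k (FG.1 k `*` FG.2 k)].

(* The product outer measure as in Federer, Geometric measure theory, 2.6 *)
Definition prod_outer (A : set (X * Y)) : \bar R :=
  ereal_inf [set \sum_(k <oo) mass X (FG.1 k) * mass Y (FG.2 k)
            | FG in rect_cover A].

Let w_ge0 (F : nat -> set X) (G : nat -> set Y) k :
  0 <= mass X (F k) * mass Y (G k).
Proof. by apply: mule_ge0; exact: outer_measure_ge0. Qed.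

Fact prod_outer_ge0 A : 0 <= prod_outer A.
Proof. by apply: le_ereal_inf_tmp => _ [FG _ <-]; exact: nneseries_ge0. Qed.

Fact prod_outer0 : prod_outer set0 = 0.
Proof.
apply/eqP; rewrite eq_le prod_outer_ge0 andbT.
apply: ereal_inf_lbound; exists (fun=> set0, fun=> set0).
  by split => // k; split; exact: caratheodory_measurable_set0.
by apply: eseries0 => k _ _; rewrite /= outer_measure0 mul0e.
Qed.

Fact le_prod_outer : {homo prod_outer : A B / A `<=` B >-> A <= B}.
Proof.
move=> A B AB; apply: ereal_inf_le_tmp => _ [FG [mFG BFG] <-].
by exists FG => //; split => //; exact: subset_trans BFG.
Qed.

Fact prod_outer_sigma_subadditive : sigma_subadditive prod_outer.
Proof.
move=> A; have [[i ioo]|] := pselect (exists i, prod_outer (A i) = +oo).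
  rewrite (eseries_pinfty _ _ ioo) ?leey// => n _.
  by rewrite -ltNye (lt_le_trans _ (prod_outer_ge0 _)).
rewrite -forallNE => Aoo.
suff add2e (e : {posnum R}) :
    prod_outer (\bigcup_n A n) <= \sum_(i <oo) prod_outer (A i) + e%:num%:E.
  by apply/lee_addgt0Pr => _/posnumP[].
rewrite (le_trans _ (epsilon_trick _ _ _))//; last first.
  by move=> n; exact: prod_outer_ge0.
pose w (FG : (nat -> set X) * (nat -> set Y)) k :=
  mass X (FG.1 k) * mass Y (FG.2 k).
pose P n FG := rect_cover (A n) FG /\
  \sum_(k <oo) w FG k <= prod_outer (A n) + (e%:num / (2 ^ n.+1)%:R)%:E.
have [H PH] : {H : nat -> (nat -> set X) * (nat -> set Y) & forall n, P n (H n)}.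
  apply: (@choice _ _ P) => n; rewrite /P /prod_outer.
  set S := (X in ereal_inf X); move infS : (ereal_inf S) => iS.
  case: iS infS => [r Sr|Soo|Soo].
  - have en1 : (0 < e%:num / (2 ^ n.+1)%:R)%R by [].
    have /(lb_ereal_inf_adherent en1) : ereal_inf S \is a fin_num by rewrite Sr.
    move=> [x [FG cFG wx] xS].
    by exists FG; split => //; rewrite /w wx -Sr; exact/ltW.
  - by have := Aoo n; rewrite /prod_outer Soo.
  - suff : lbound S 0 by move/le_ereal_inf_tmp; rewrite Soo.
    by move=> /= _ [FG _ <-]; exact: nneseries_ge0.
pose W (ij : nat * nat) := w (H ij.1) ij.2.
have W_ge0 ij : 0 <= W ij by exact: w_ge0.
apply: (@le_trans _ _ (\esum_(i in setT) W i)).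
  apply: ereal_inf_lbound => /=.
  have /card_esym/ppcard_eqP[f] := card_nat2.
  exists (fun k => (H (f k).1).1 (f k).2, fun k => (H (f k).1).2 (f k).2).
    split => [i|]; first exact: (PH _).1.1.
    move=> t [i _ Ait]; have [j _ Bijt] := (PH i).1.2 _ Ait.
    by exists (f^-1%FUN (i, j)) => //=; rewrite invK ?inE.
  transitivity (\sum_(k <oo) W (f k)); first by [].
  rewrite -(esum_pred_image W f xpredT) ?[fun=> _]set_true//.
  by rewrite image_eq.
rewrite (_ : esum _ _ = \sum_(i <oo) \sum_(j <oo ) W (i, j)); last first.
  pose J : nat -> set (nat * nat) := fun i => [set (i, j) | j in setT].
  rewrite (_ : setT = \bigcup_k J k); last first.
    by rewrite predeqE => -[a b]; split => // _; exists a => //; exists b.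
  rewrite esum_bigcupT /=; last 2 first.
    - apply/trivIsetP => i j _ _ ij.
      rewrite predeqE => -[n m] /=; split => //= -[] [_] _ [<-{n} _].
      by move=> [m' _] [] /esym/eqP; rewrite (negbTE ij).
    - by [].
  rewrite -(image_id [set: nat]) -fun_true esum_pred_image//; last first.
    by move=> n _; exact: esum_ge0.
  apply: eq_eseriesr => /= j _.
  rewrite -(esum_pred_image W (pair j) predT)//=; last first.
    by move=> ? ? _ _; exact: (@can_inj _ _ _ snd).
  by congr esum; rewrite predeqE => -[a b]; split; move=> [i _ <-]; exists i.
apply: lee_lim.
- by apply: is_cvg_nneseries => n *; exact: nneseries_ge0.
- by apply: is_cvg_nneseries => n *; apply: adde_ge0 => //; exact: prod_outer_ge0.
- by near=> n; apply: lee_sum => i _; exact: (PH i).2.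
Unshelve. all: by end_near. Qed.

HB.instance Definition _ := isOuterMeasure.Build R (X * Y)%type prod_outer
  prod_outer0 prod_outer_ge0 le_prod_outer prod_outer_sigma_subadditive.

End product_outer_measure.

Section pushforward_outer_measure.
Context {R : realType} {S T : Type}.
Variables (nu : {outer_measure set S -> \bar R}) (f : S -> T).
Local Open Scope ereal_scope.

Definition push_outer (A : set T) : \bar R := nu (f @^-1` A).

Fact push_outer0 : push_outer set0 = 0.
Proof. by rewrite /push_outer preimage_set0 outer_measure0. Qed.

Fact push_outer_ge0 A : 0 <= push_outer A.
Proof. exact: outer_measure_ge0. Qed.

Fact le_push_outer : {homo push_outer : A B / A `<=` B >-> A <= B}.
Proof. by move=> A B AB; apply: le_outer_measure; exact: preimage_subset. Qed.

Fact push_outer_sigma_subadditive : sigma_subadditive push_outer.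
Proof.
move=> F; rewrite /push_outer preimage_bigcup.
exact: outer_measure_sigma_subadditive.
Qed.

HB.instance Definition _ := isOuterMeasure.Build R T push_outer
  push_outer0 push_outer_ge0 le_push_outer push_outer_sigma_subadditive.

End pushforward_outer_measure.

Section warped_product.
Context {R : realType} (N : R * R -> R) (X Y : mmdata R) (phi : X -> {nonneg R}).

Definition dist_l1 (z z' : X * Y) : R := dist X z.1 z'.1 + dist Y z.2 z'.2.

Definition warped_len (a b : R) (gamma : R -> X * Y) : \bar R :=
  (\int[lebesgue_measure]_(t in `[a, b])
    (N (speed (dist X) a b (fst \o gamma) t,
        (phi (gamma t).1)%:num * speed (dist Y) a b (snd \o gamma) t))%:E)%E.

Definition warped_pdist (z z' : X * Y) : R :=
  fine (ereal_inf [set l | exists a b gamma,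
    [/\ ac_path dist_l1 a b gamma, gamma a = z, gamma b = z' &
        l = warped_len a b gamma]]).

(* The quotient is the set of its classes, which avoids an equiv_rel proof here.
   For length spaces X, Y the infimum above is finite and warped_pdist is a
   pseudometric, so warped_dist does not depend on the representatives. *)
Definition warped_class (z : X * Y) : set (X * Y) :=
  [set z' | warped_pdist z z' = 0].

Definition warped_carrier : Type := set_type (range warped_class).
HB.instance Definition _ := Choice.on warped_carrier.

Definition warped_proj (z : X * Y) : warped_carrier :=
  exist _ (warped_class z) (mem_set (imageT warped_class z)).

HB.instance Definition _ := isPointed.Build warped_carrier (warped_proj point).

Definition warped_repr (P : warped_carrier) : X * Y :=
  sval (cid2 (set_mem (svalP P))).

Definition warped_dist (P Q : warped_carrier) : R :=
  warped_pdist (warped_repr P) (warped_repr Q).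

Definition warped : mmdata R :=
  MMData warped_dist (push_outer (@prod_outer R X Y) warped_proj).

End warped_product.

Definition warping_norm {R : realType} (N : R * R -> R) : Prop :=
  [/\ [/\ forall v, N v = 0 -> v = 0,
          forall v w, N (v + w) <= N v + N w &
          forall (c : R) v, N (c * v.1, c * v.2) = `|c| * N v],
      N (1, 0) = 1, N (0, 1) = 1 &
      forall a b c d, 0 <= a <= b -> 0 <= c <= d -> N (a, c) <= N (b, d)].

Section fillings.
Context {R : realType}.
Implicit Types (alpha beta : R).

Definition halfline : Type := {nonneg R}.
HB.instance Definition _ := Choice.on halfline.
HB.instance Definition _ := isPointed.Build halfline (0%:nng : {nonneg R}).
Definition hval (t : halfline) : R := (t : {nonneg R})%:num.

Section weighted.
Variable w : R -> {nonneg R}.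
Local Open Scope ereal_scope.

Definition weight_set (F : set (measurableTypeR R)) : \bar R :=
  \int[lebesgue_measure]_(t in F `&` `[0%R, +oo[) ((w t)%:num)%:E.

Fact weight_set0 : weight_set set0 = 0.
Proof. by rewrite /weight_set set0I integral_set0. Qed.

Fact weight_set_ge0 F : 0 <= weight_set F.
Proof. by apply: integral_ge0 => t _; rewrite lee_fin. Qed.

(* The Borel regular outer measure on [0, +oo) extending w(t) dt *)
Definition weight_outer (A : set halfline) : \bar R :=
  mu_ext weight_set (hval @` A).

Fact weight_outer0 : weight_outer set0 = 0.
Proof.
by rewrite /weight_outer image_set0; exact: mu_ext0 weight_set0 weight_set_ge0.
Qed.

Fact weight_outer_ge0 A : 0 <= weight_outer A.
Proof. exact: mu_ext_ge0 weight_set_ge0 _. Qed.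

Fact le_weight_outer : {homo weight_outer : A B / A `<=` B >-> A <= B}.
Proof. by move=> A B AB; apply: le_mu_ext; exact: image_subset. Qed.

Fact weight_outer_sigma_subadditive : sigma_subadditive weight_outer.
Proof.
move=> F; rewrite /weight_outer image_bigcup.
exact: mu_ext_sigma_subadditive weight_set_ge0 _.
Qed.

HB.instance Definition _ := isOuterMeasure.Build R halfline weight_outer
  weight_outer0 weight_outer_ge0 le_weight_outer weight_outer_sigma_subadditive.

Definition whalfline : mmdata R :=
  MMData (fun s t : halfline => `|hval s - hval t|%R) weight_outer.

End weighted.

Definition sinh (t : R) : R := (expR t - expR (- t)) / 2.

Definition exp_filling (N : R * R -> R) alpha beta (Y : mmdata R) : mmdata R :=
  @warped R N (whalfline (fun t => NngNum (expR_ge0 (beta * t)))) Y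
    (fun t => NngNum (expR_ge0 (alpha * hval t))).

Definition sinh_filling (N : R * R -> R) alpha beta (Y : mmdata R) : mmdata R :=
  @warped R N (whalfline (fun t => NngNum (powR_ge0 (sinh t) beta))) Y
    (fun t => NngNum (powR_ge0 (sinh (hval t)) alpha)).

End fillings.

(* Main.v *)
From HB Require Import structures.
From mathcomp Require Import all_boot all_order all_algebra.
From mathcomp Require Import interval_inference.
From mathcomp Require Import all_classical all_reals all_analysis.
From mathcomp Require Import measurable_realfun ring lra.
Require Import Defs.
Set Implicit Arguments.
Unset Strict Implicit.
Unset Printing Implicit Defensive.
Import Order.TTheory GRing.Theory Num.Theory.
Import numFieldNormedType.Exports.
Local Open Scope classical_set_scope.
Local Open Scope ring_scope.

(** Both fillings are products of a half-line, with a weight w, and of Y, whose distances at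
    height t are multiplied by Phi t. The weight satisfies w (t + s) >= w t * exp (beta s),
    and Phi t ^ p <= w t for large t exactly when p <= beta / alpha.

    Suppose that p <= beta / alpha, and let g be an upper gradient of u in L^p. On the
    vertical line over y, which has speed 1, u changes by at most the integral of g; the
    growth of the weight gives a Hardy inequality (hardy) for the tails of this integral, so
    u has a limit k(y) on almost every vertical line, and
    ||u - k||_p <= (p / beta) ||g||_p. It remains to see that k is constant. The slice
    of u at height t has the upper gradient Phi t * g on Y, and the condition on p bounds
    its energy by w t times that of g, which is an integrable function of t. So there are
    heights tending to infinity along which the energies of the slices tend to 0, and the
    Poincare inequality on a ball of Y shows that k is almost everywhere constant on this
    ball (limit_locally_constant). Since Y is connected and separable, k is constant
    (glue_constants).

    If p > beta / alpha, let u be a bump function on Y, cut off near height 0. The expansion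
    of the fibres makes its slope decay like exp (- alpha t), so that u has an upper gradient
    in L^p; but no u - c is in L^p, because the filling has infinite mass above every ball
    of Y (plateau_not_N1_plus_cst).

    The technical part relates these computations to the definitions. Absolutely continuous
    curves have a speed almost everywhere (ac_path_speed), and a curve dominated by an
    integrable density is absolutely continuous (ac_path_of_bound); this gives enough control
    of the warped distance: it restricts to the height difference on vertical lines, is at
    most Phi t times the distance of Y at height t, and satisfies a converse bound locally
    (dist_vertical, dist_horizontal, dist_fib). The outer measure of the filling is shown to
    come from a product measure in the coordinates (carried_warped), which gives access to
    the theorems of Fubini and Tonelli. *)

(** * Absolutely continuous monotone functions *)

(** A case analysis on a comparison also replaces the comparison in the goal by its
    truth value. *)
Ltac clra := solve [done | lra | exfalso; lra].

(** The empty interval gets both end points at a given point a, so that clamping to a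
    range containing a makes it degenerate there. *)
Lemma open_bounded_itv {R : realType} (a l r : R) (I : set R) :
  open I -> is_interval I -> I `<=` `]l, r[ ->
  exists st : R * R, [/\ I = `]st.1, st.2[%classic, st.1 <= st.2 &
    I = set0 -> st = (a, a)].
Proof.
move=> oI iI Ilr; have [I0|/[dup] /eqP IN0 /set0P In0] := eqVneq I set0.
  by exists (a, a); split => //=; rewrite I0 set_itvoo0.
have hl : has_lbound I by exists l => x /Ilr; rewrite /= in_itv/= => /andP[/ltW].
have hr : has_ubound I by exists r => x /Ilr; rewrite /= in_itv/= => /andP[_ /ltW].
have Isub : I `<=` `]inf I, sup I[.
  move=> x Ix; have /nbhs_ballP[e /= e0 H] := open_nbhs_nbhs (conj oI Ix).
  rewrite /= in_itv/=; apply/andP; split.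
    apply: (@le_lt_trans _ _ (x - e / 2)); last by rewrite ltrBlDl ltrDr divr_gt0.
    apply: ge_inf => //; apply: H; rewrite /ball/= opprB addrC subrK gtr0_norm ?divr_gt0//.
    by rewrite ltr_pdivrMr// ltr_pMr// ltrDl.
  apply: (@lt_le_trans _ _ (x + e / 2)); first by rewrite ltrDl divr_gt0.
  apply: ub_le_sup => //; apply: H; rewrite /ball/= opprD addNKr normrN gtr0_norm ?divr_gt0//.
  by rewrite ltr_pdivrMr// ltr_pMr// ltrDl.
exists (inf I, sup I); split => //=.
  apply/seteqP; split => // x /=; rewrite in_itv/= => /andP[xi xs].
  have [y Iy yx] := inf_lt In0 xi; have [z Iz xz] := sup_gt In0 xs.
  by apply: (iI _ _ Iy Iz); rewrite !ltW.
by case: In0 => x /Isub /=; rewrite in_itv/= => /andP[? ?]; lra.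
Qed.

Section monotone_ac.
Context {R : realType} (a b : R) (F : R -> R).
Hypothesis ab : a < b.
Hypothesis ndF : forall s t, a <= s -> s <= t -> t <= b -> F s <= F t.
Hypothesis acF : abs_cont a b F.
Local Notation mu := (@lebesgue_measure R).

Let cl (t : R) : R := if t <= a then a else if b <= t then b else t.

Let cl_itv t : a <= cl t /\ cl t <= b.
Proof. have ab' := ab; by rewrite /cl; case: (leP t a) => ?; case: (leP b t) => ?; split; clra. Qed.

Let cl_id t : a <= t -> t <= b -> cl t = t.
Proof. have ab' := ab; rewrite /cl => ? ?; case: (leP t a) => ?; case: (leP b t) => ?; clra. Qed.

Let cl_le s t : s <= t -> cl s <= cl t.
Proof.
have ab' := ab; rewrite /cl => st; case: (leP s a) => ?; case: (leP b s) => ?;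
by case: (leP t a) => ?; case: (leP b t) => ?; clra.
Qed.

Let cl_lip s t : s <= t -> cl t - cl s <= t - s.
Proof.
have ab' := ab; rewrite /cl => st; case: (leP s a) => ?; case: (leP b s) => ?;
by case: (leP t a) => ?; case: (leP b t) => ?; clra.
Qed.

Let cla : cl a = a. Proof. by apply: cl_id => //; exact: ltW. Qed.

(** Constant outside [a, b], hence the distribution function of a measure on the line. *)
Definition clampF (t : R) : R := F (cl t).

Let clampF_nd : nondecreasing clampF.
Proof.
move=> s t st; have [? ?] := cl_itv s; have [? ?] := cl_itv t.
by apply: ndF => //; exact: cl_le.
Qed.

Lemma abs_cont1 (e : R) : 0 < e -> exists2 dl : R, 0 < dl &
  forall s t, a <= s -> s <= t -> t <= b -> t - s < dl -> `|F t - F s| < e.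
Proof.
move=> e0; have [dl d0 H] := acF e0; exists dl => // s t as_ st tb tsd.
have := H 1%N (fun=> s) (fun=> t); rewrite !big_ord1; apply => //.
by move=> i j; rewrite (ord1 i) (ord1 j) eqxx.
Qed.

Let clampF_rc : right_continuous clampF.
Proof.
move=> x; apply/cvgrPdist_lt => e e0; have [dl d0 H] := abs_cont1 e0.
near=> y.
have xy : x < y by near: y; exact: nbhs_right_gt.
have yd : y < x + dl by near: y; apply: nbhs_right_lt; rewrite ltrDl.
have [? ?] := cl_itv x; have [? ?] := cl_itv y.
rewrite distrC; apply: H => //; first exact/cl_le/ltW.
by apply: le_lt_trans (cl_lip (ltW xy)) _; rewrite ltrBlDl.
Unshelve. all: by end_near. Qed.

HB.instance Definition _ := isCumulative.Build R _ R clampF clampF_nd clampF_rc.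

Let nu : {measure set (measurableTypeR R) -> \bar R} :=
  lebesgue_stieltjes_measure clampF.

Let nu_oc x y : x <= y -> nu `]x, y]%classic = (clampF y - clampF x)%:E.
Proof.
move=> xy; rewrite /nu/= /lebesgue_stieltjes_measure /measure_extension.
rewrite [LHS]measurable_mu_extE/=; last exact: is_ocitv.
exact: wlength_itv_bnd.
Qed.

Let D : set (measurableTypeR R) := `]a - 1, b + 1[%classic.
Let mD : measurable D. Proof. exact: measurable_itv. Qed.
Let nuD : (nu D < +oo)%E.
Proof.
apply: (@le_lt_trans _ _ (nu `]a - 1, b + 1]%classic)).
  apply: le_measure; rewrite ?inE; [exact: measurable_itv..|].
  by apply: subset_itvl; rewrite bnd_simp.
by rewrite nu_oc ?ltry//; have := ab; lra.
Qed.

Let nur : {finite_measure set (measurableTypeR R) -> \bar R} := mfrestr mD nuD.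

(** An open set is a disjoint union of intervals. Finitely many of them are a test family
    for the absolute continuity of F, because clamping the end points to [a, b] only
    shortens the intervals. *)
Let nu_open_le (U : set R) (e dl : R) : open U -> U `<=` D -> 0 < dl ->
  (forall (n : nat) (s t : 'I_n -> R),
      (forall i, [/\ a <= s i, s i <= t i & t i <= b]) ->
      (forall i j, i != j -> t i <= s j \/ t j <= s i) ->
      \sum_(i < n) (t i - s i) < dl ->
      \sum_(i < n) `|F (t i) - F (s i)| < e) ->
  (mu U < dl%:E)%E -> (nu U <= e%:E)%E.
Proof.
move=> oU UD dl0 H mUd.
pose I := open_disjoint_itv oU.
have oI i : open (I i) by exact: open_disjoint_itv_open.
have mI i : measurable (I i : set R) by exact: open_measurable.
have tI : trivIset setT I := @open_disjoint_itv_trivIset _ _ oU.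
have UI : U = \bigcup_i I i := @open_disjoint_itv_bigcup _ _ oU.
have ID i : I i `<=` D by apply: subset_trans UD; rewrite UI; exact: bigcup_sup.
have ends i : exists st : R * R, [/\ I i = `]st.1, st.2[%classic, st.1 <= st.2 &
    I i = set0 -> st = (a, a)].
  exact: (open_bounded_itv a (oI i) (@open_disjoint_itv_is_interval _ _ oU i) (ID i)).
have {ends} [st stP] := choice ends.
have fin n : (\sum_(i < n) nu (I i) <= e%:E)%E.
  apply: (@le_trans _ _ (\sum_(i < n) (F (cl (st i).2) - F (cl (st i).1))%:E)%E).
    apply: lee_sum => i _; have [-> le12 _] := stP i.
    rewrite -[leRHS](nu_oc le12); apply: le_measure; rewrite ?inE;
      [exact: measurable_itv..|].
    by apply: subset_itvl; rewrite bnd_simp.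
  rewrite sumEFin lee_fin; apply: le_trans (ltW (H n (fun i => cl (st i).1) (fun i => cl (st i).2) _ _ _)).
  - by apply: ler_sum => i _; exact: ler_norm.
  - move=> i; have [_ le12 _] := stP i; have [? ?] := cl_itv (st i).1.
    by have [? ?] := cl_itv (st i).2; split => //; exact: cl_le.
  - move=> i j ij; have [Ii le12 Ii0] := stP i; have [Ij le12' Ij0] := stP j.
    have [I0|/set0P In0] := eqVneq (I i) set0.
      by left; rewrite (Ii0 I0) /= cla; have [] := cl_itv (st j).1.
    have [J0|/set0P Jn0] := eqVneq (I j) set0.
      by right; rewrite (Ij0 J0) /= cla; have [] := cl_itv (st i).1.
    have IJ : I i `&` I j = set0.
      apply/eqP/negPn/negP => /set0P [x IJx].
      by move: ij; rewrite (ord_inj (tI _ _ Logic.I Logic.I (ex_intro _ x IJx))) eqxx.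
    move: In0 Jn0; rewrite Ii Ij => -[x /=]; rewrite in_itv/= => /andP[x1 x2].
    move=> [y /=]; rewrite in_itv/= => /andP[y1 y2].
    have [h|h] := leP (st i).2 (st j).1; first by left; exact: cl_le.
    have [h'|h'] := leP (st j).2 (st i).1; first by right; exact: cl_le.
    exfalso; suff : (I i `&` I j) !=set0 by rewrite IJ => -[].
    set lo := Num.max (st i).1 (st j).1; set hi := Num.min (st i).2 (st j).2.
    have lohi : lo < hi by rewrite /lo /hi gt_max !lt_min; apply/andP; split; apply/andP; split; lra.
    have [? ?] : lo < (lo + hi) / 2 /\ (lo + hi) / 2 < hi by split; lra.
    exists ((lo + hi) / 2); rewrite Ii Ij; split => /=; rewrite in_itv/=.
      apply/andP; split; first by apply: (@le_lt_trans _ _ lo) => //; rewrite /lo le_max lexx.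
      by apply: (@lt_le_trans _ _ hi) => //; rewrite /hi ge_min lexx.
    apply/andP; split; first by apply: (@le_lt_trans _ _ lo) => //; rewrite /lo le_max lexx orbT.
    by apply: (@lt_le_trans _ _ hi) => //; rewrite /hi ge_min lexx orbT.
  - rewrite -lte_fin; apply: le_lt_trans mUd; rewrite UI.
    rewrite measure_bigcup//; last by move=> i _; exact: mI.
    apply: le_trans (nneseries_lim_ge n _); last by move=> *; exact: measure_ge0.
    rewrite [leRHS](eq_bigl xpredT); last by move=> i; rewrite in_setT.
    rewrite big_mkord -sumEFin; apply: lee_sum => i _.
    have [-> le12 _] := stP i.
    rewrite [leRHS]lebesgue_measure_itv/= lte_fin; case: ltP => h.
      by rewrite -EFinB lee_fin; exact: cl_lip.
    have e12 : (st i).1 = (st i).2 by apply/eqP; rewrite eq_le le12 h.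
    by rewrite e12 subrr lexx.
rewrite UI measure_bigcup//; last by move=> i _; exact: mI.
apply: lime_le; first by apply: is_cvg_nneseries => *; exact: measure_ge0.
apply: nearW => n; rewrite (eq_bigl xpredT); last by move=> i; rewrite in_setT.
by rewrite big_mkord; exact: fin.
Qed.

(** A null set has open neighbourhoods of arbitrarily small measure. *)
Let nur_dom : nur `<< mu.
Proof.
move=> N N0 A mA /N0 mA0; have {}mA0 : mu A = 0%E := mA0 mA.
rewrite /nur/= /mfrestr /mrestr; apply/eqP; rewrite eq_le measure_ge0 andbT.
apply/lee_addgt0Pr => e e0; rewrite add0e.
have [dl d0 H] := acF e0.
have mAy : (mu A < +oo)%E by rewrite mA0.
have [U [oU AU mUA]] := lebesgue_regularity_outer mA mAy d0.
have oUD : open (U `&` D) by apply: openI => //; exact: interval_open.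
apply: (@le_trans _ _ (nu (U `&` D))).
  apply: le_measure; rewrite ?inE; [exact: measurableI|exact: open_measurable|].
  exact: setSI.
apply: (nu_open_le oUD _ d0 H); first exact: subIsetr.
apply: (@le_lt_trans _ _ (mu U)).
  apply: le_measure; rewrite ?inE; [exact: open_measurable|exact: open_measurable|].
  exact: subIsetl.
suff -> : mu U = mu (U `\` A) by [].
rewrite -{1}(setDKU AU) measureU ?setDKI//; last exact: measurableD (open_measurable oU) mA.
by rewrite -[RHS]adde0; congr (_ + _)%E; exact: mA0.
Qed.

(** Radon-Nikodym for the Stieltjes measure of F, then Lebesgue differentiation. *)
Theorem monotone_ac_density : exists k : R -> R,
  [/\ measurable_fun [set: R] k, forall x, 0 <= k x,
      mu.-integrable [set: R] (EFin \o k),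
      forall s t, a <= s -> s <= t -> t <= b ->
        (\int[mu]_(x in `[s, t]) (k x)%:E = (F t - F s)%:E)%E &
      {ae mu, forall t, a < t < b -> forall e : R, 0 < e -> exists2 dl : R, 0 < dl &
        forall u, a <= u <= b -> `|u - t| < dl ->
          `|F u - F t - k t * (u - t)| <= e * `|u - t|}].
Proof.
have [f [f0 ff fi fE]] := radon_nikodym_sigma_finite nur_dom.
pose k x := fine (f x); have fk : f = EFin \o k.
  by apply/funext => x /=; rewrite /k fineK.
have ki : mu.-integrable [set: R] (EFin \o k) by rewrite -fk.
have mk : measurable_fun [set: R] k by apply/measurable_EFinP; exact: measurable_int ki.
have kE s t : a <= s -> s <= t -> t <= b ->
    (\int[mu]_(x in `]s, t]) (k x)%:E = (F t - F s)%:E)%E.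
  move=> as_ st tb; transitivity (\int[mu]_(x in `]s, t]) f x)%E; first by rewrite fk.
  rewrite -fE; last exact: measurable_itv.
  rewrite /nur/= /mfrestr /mrestr setIidl; last first.
    by move=> x; rewrite /D /= !in_itv/= => /andP[? ?]; apply/andP; split; lra.
  by rewrite -/nu nu_oc// /clampF !cl_id//; lra.
exists k; split => //.
- by move=> x; rewrite /k fine_ge0.
- move=> s t as_ st tb; rewrite -integral_itv_obnd_cbnd; first exact: kE.
  by apply/measurable_EFinP; exact: measurable_funTS.
have := @FTC1Ny R k => FTC.
pose G x := (\int[mu]_(t in `]-oo, x]) (k t))%R.
have ki' y : mu.-integrable `]-oo, y] (EFin \o k).
  by apply: integrableS ki => //; exact: measurable_itv.
have {FTC} := FTC ki' (open_integrable_locally openT ki).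
apply: filterS; first exact: (ae_filter_ringOfSetsType mu).
rewrite -/G => t [dG Gk] /andP[at_ tb] e e0.
have GE u v : a <= u -> u <= v -> v <= b -> G v - G u = F v - F u.
  move=> au uv vb; rewrite /G.
  have -> : `]-oo, v]%classic = `]-oo, u] `|` `]u, v].
    by rewrite -itv_bndbnd_setU// bnd_simp.
  rewrite Rintegral_setU//; last 2 first.
  - by apply: integrableS ki => //; apply: measurableU; exact: measurable_itv.
  - by apply/disj_setPS => x [] /=; rewrite !in_itv/= => xu /andP[ux _]; rewrite ltNge xu in ux.
  by rewrite addrAC subrr add0r /Rintegral kE.
have GE' u : a <= u <= b -> F u - F t = G u - G t.
  move=> /andP[au ub]; have [ut|tu] := leP u t.
    by apply/eqP; rewrite -eqr_opp !opprB GE// ltW.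
  by rewrite GE ?(ltW at_)?(ltW tu).
move: dG => /cvg_ex [l lc]; have lk : l = k t.
  by rewrite -Gk derive1E; apply/esym/cvg_lim.
move/cvgrPdist_le : lc => /(_ _ e0); rewrite lk.
rewrite near_withinE => /nbhs_ballP [dl /= dl0 H]; exists dl => // u aub utd.
have [->|ut] := eqVneq u t; first by rewrite !subrr mulr0 subr0 normr0 mulr0.
have ut0 : u - t != 0 by rewrite subr_eq0.
have := H (u - t); rewrite /ball/= sub0r normrN => /(_ utd ut0).
rewrite GE'// [_%:A]mulr1 subrK distrC => K.
rewrite -[X in X - _](mulfK ut0) mulrAC -mulrBl normrM ler_wpM2r//.
by rewrite mulrC.
Qed.

End monotone_ac.

(** * Comparison and transformation of integrals *)

Section integral_without_measurability.
Local Open Scope ereal_scope.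
Context {d} {T : measurableType d} {R : realType} (mu : {measure set T -> \bar R}).

Import HBNNSimple.

(** The integral of a nonnegative function is a supremum over simple functions whether or
    not the function is measurable, and a simple function may be set to 0 on a null set.
    This is what line integrals need, as the speed of a curve is an unspecified value
    where the defining limit does not exist. *)
Lemma ge0_ae_le_integral_nomeas (D N : set T) (f g : T -> \bar R) :
  measurable N -> mu N = 0 ->
  (forall x, D x -> 0 <= f x) -> (forall x, D x -> 0 <= g x) ->
  (forall x, D x -> ~ N x -> f x <= g x) ->
  \int[mu]_(x in D) f x <= \int[mu]_(x in D) g x.
Proof.
move=> mN N0 f0 g0 fg; rewrite !ge0_integralE//.
apply: ge_ereal_sup => _ [h /= hf <-].
pose h' := proj_nnsfun h (measurableC mN).
have -> : sintegral mu h = sintegral mu h'.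
  rewrite -!integralT_nnsfun; apply: ge0_ae_eq_integral => //.
  - by apply/measurable_EFinP.
  - by apply/measurable_EFinP.
  - by move=> x _; rewrite lee_fin.
  - by move=> x _; rewrite lee_fin.
  exists N; split => // x /= /not_implyP[_]; apply: contra_notP => Nx.
  by rewrite /= mindicE mem_set// mulr1.
apply: ereal_sup_ubound; exists h' => //= x.
have [Nx|Nx] := pselect (N x).
  rewrite /= mindicE memNset ?mulr0; last by move/(_ Nx).
  by rewrite patchE; case: ifPn => // /[!inE] /g0.
rewrite /= mindicE mem_set ?mulr1//; apply: (le_trans (hf x)).
by rewrite !patchE; case: ifPn => // /[!inE] Dx; exact: fg.
Qed.

Lemma ae_eq_integral_nomeas (D N : set T) (f g : T -> \bar R) :
  measurable N -> mu N = 0 ->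
  (forall x, D x -> 0 <= g x) ->
  (forall x, D x -> ~ N x -> f x = g x) ->
  \int[mu]_(x in D) f x = \int[mu]_(x in D) g x.
Proof.
move=> mN N0 g0 fg.
have neg : \int[mu]_(x in D) f^\- x = 0.
  apply/eqP; rewrite eq_le integral_ge0// andbT.
  rewrite -(integral0 mu D); apply: (@ge0_ae_le_integral_nomeas D N) => // x Dx Nx.
  by rewrite funenegE fg// max_r// leeNl oppe0 g0.
rewrite integralE neg sube0.
have fgp x : D x -> ~ N x -> f^\+ x = g x.
  by move=> Dx Nx; rewrite funeposE fg// max_l// g0.
apply/eqP; rewrite eq_le; apply/andP; split;
  by apply: (@ge0_ae_le_integral_nomeas D N) => // x Dx Nx; rewrite fgp.
Qed.

End integral_without_measurability.

Section integral_density.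
Import HBNNSimple.

(** Approximation by simple functions and monotone convergence. The measure m may be
    infinite, the density being real valued. *)
Lemma ge0_integral_density {d} {T : measurableType d} {R : realType}
    (mu m : {measure set T -> \bar R}) (w : T -> R) :
  measurable_fun [set: T] w -> (forall x, 0 <= w x) ->
  (forall A, measurable A -> m A = \int[mu]_(x in A) (w x)%:E)%E ->
  forall f : T -> \bar R, measurable_fun [set: T] f -> (forall x, 0 <= f x)%E ->
  (\int[m]_x f x = \int[mu]_x (f x * (w x)%:E))%E.
Proof.
move=> mw w0 mE f mf f0.
have mwE : measurable_fun [set: T] (EFin \o w) by apply/measurable_EFinP.
pose h := nnsfun_approx measurableT mf.
have hx x : (EFin \o h n) x @[n --> \oo] --> f x by exact: cvg_nnsfun_approx.
have hnd x : {homo (fun n => (h n x)%:E) : a b / (a <= b)%N >-> (a <= b)%E}.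
  by move=> a b ab; rewrite lee_fin; exact/lefP/nd_nnsfun_approx.
transitivity (limn (fun n => \int[m]_x (EFin \o h n) x)%E).
  rewrite -monotone_convergence//.
  - by apply: eq_integral => x _; apply/esym/cvg_lim => //; exact: hx.
  - by move=> n; apply/measurable_EFinP.
  - by move=> n x _; rewrite lee_fin.
  - by move=> x _ a b; exact: hnd.
transitivity (limn (fun n => \int[mu]_x ((EFin \o h n) x * (w x)%:E))%E); last first.
  rewrite -monotone_convergence//.
  - by apply: eq_integral => x _; apply/cvg_lim => //; apply: cvgeZr => //; exact: hx.
  - by move=> n; apply: emeasurable_funM => //; apply/measurable_EFinP.
  - by move=> n x _; rewrite mule_ge0 ?lee_fin.
  - by move=> x _ a b ab /=; rewrite lee_wpmul2r ?lee_fin//; exact/lefP/nd_nnsfun_approx.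
congr (limn _); apply/funext => n.
have mterm y : measurable_fun [set: T] (fun x => (y * \1_(h n @^-1` [set y]) x)%:E).
  by apply: (measurable_comp measurableT) => //; exact: measurable_funM.
transitivity (\int[m]_x (\sum_(y \in range (h n)) (y * \1_(h n @^-1` [set y]) x)%:E))%E.
  by apply: eq_integral => t _; rewrite /= fimfunE -fsumEFin.
rewrite ge0_integral_fsum//; last by move=> y x _; exact: nnfun_muleindic_ge0.
transitivity (\int[mu]_x (\sum_(y \in range (h n))
    (y * \1_(h n @^-1` [set y]) x)%:E * (w x)%:E))%E; last first.
  apply: eq_integral => x _; rewrite -ge0_mule_fsuml => [|y]; last exact: nnfun_muleindic_ge0.
  by rewrite fsumEFin // -(fimfunE _ x).
rewrite ge0_integral_fsum//; last 2 first.
  - by move=> y; apply: emeasurable_funM.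
  - by move=> y x _; rewrite mule_ge0 ?lee_fin// -lee_fin nnfun_muleindic_ge0.
apply: eq_fsbigr => r /[!inE] -[t _ <-]; under eq_integral do rewrite EFinM.
rewrite integralZl_indic_nnsfun// integral_indic// setIT mE//.
under [RHS]eq_integral do rewrite EFinM -muleA.
rewrite ge0_integralZl//; last 3 first.
- by apply: emeasurable_funM => //; apply/measurable_EFinP.
- by move=> x _; rewrite mule_ge0// lee_fin.
- by rewrite lee_fin.
congr (_ * _)%E; rewrite integral_mkcond.
apply: eq_integral => x _; rewrite patchE indicE; case: ifPn => _.
- by rewrite mul1e.
- by rewrite mul0e.
Qed.

End integral_density.

Lemma ge0_integral_transfer {d1 d2} {X : measurableType d1} {Y : measurableType d2}
    {R : realType} (phi : X -> Y) (mu : {measure set X -> \bar R})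
    (m : {measure set Y -> \bar R}) (D : set Y) (f : Y -> \bar R) :
  measurable_fun [set: X] phi -> (forall A, measurable A -> m A = mu (phi @^-1` A)) ->
  measurable D -> measurable_fun D f -> (forall y, D y -> 0 <= f y)%E ->
  (\int[m]_(y in D) f y = \int[mu]_(x in phi @^-1` D) f (phi x))%E.
Proof.
move=> mphi mE mD mf f0.
pose m' := measure_function_pushforward__canonical__measure_function_Measure mu mphi.
rewrite (@eq_measure_integral _ _ _ _ m')/=; last by move=> A mA _; exact: mE.
by rewrite ge0_integral_pushforward// => y /[!inE]; exact: f0.
Qed.

Section lebesgue_isometry.
Context {R : realType}.
Local Notation mu := (@lebesgue_measure R).

(** The isometries of the line: translations if s is true, reflections otherwise. *)
Definition isom (s : bool) (e t : R) : R := (if s then t else - t) + e.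

Lemma isom_dist s e t u : `|isom s e t - isom s e u| = `|t - u|.
Proof.
rewrite /isom; case: s; first by congr `|_|; lra.
by rewrite distrC; congr `|_|; lra.
Qed.

Lemma measurable_isom s e :
  measurable_fun [set: measurableTypeR R] (isom s e : R -> measurableTypeR R).
Proof. by apply: measurable_funD => //; case: s => //=; exact: oppr_measurable. Qed.

Lemma isom_itvcc s e a b : isom s e @^-1` `[a, b] =
  if s then `[a - e, b - e]%classic else `[e - b, e - a]%classic.
Proof.
apply/seteqP; split => t; rewrite /isom; case: s => /=;
  rewrite !in_itv/= => /andP[? ?]; apply/andP; split; lra.
Qed.

Let isom_itvoc s e x y : isom s e @^-1` `]x, y] =
    [set` if s then `]x - e, y - e] else `[e - y, e - x[].
Proof.
apply/seteqP; split => t; rewrite /isom; case: s => /=;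
  rewrite !in_itv/= => /andP[? ?]; apply/andP; split; lra.
Qed.

Lemma lebesgue_isom s e (A : set (measurableTypeR R)) : measurable A ->
  mu (isom s e @^-1` A) = mu A.
Proof.
move=> mA; pose m := measure_function_pushforward__canonical__measure_function_Measure
  mu (measurable_isom s e).
apply/esym; apply: (@lebesgue_measure_unique R m) => // _ [[x y] /= _ <-].
rewrite /m/= /pushforward.
rewrite isom_itvoc lebesgue_measure_itv/= [RHS]lebesgue_measure_itv/=.
case: s @m => m /=; rewrite !lte_fin.
  by rewrite ltrD2r; case: ifP => // _; rewrite -!EFinD; congr (_%:E); lra.
rewrite ltrD2l ltrN2; case: ifP => // _; rewrite -!EFinD; congr (_%:E); lra.
Qed.

Lemma ge0_integral_isom s e (D : set (measurableTypeR R)) (f : measurableTypeR R -> \bar R) :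
  measurable D -> measurable_fun D f -> (forall t, D t -> 0 <= f t)%E ->
  (\int[mu]_(t in D) f t = \int[mu]_(t in isom s e @^-1` D) f (isom s e t))%E.
Proof.
move=> mD mf f0; apply: (ge0_integral_transfer (measurable_isom s e)) => //.
by move=> A mA; exact/esym/lebesgue_isom.
Qed.

End lebesgue_isometry.

Section null_sets_of_the_line.
Context {R : realType} (a b : R).
Local Notation mu := (@lebesgue_measure R).

Lemma null_with_ends (M : set (measurableTypeR R)) : measurable M -> mu M = 0%E ->
  measurable (M `|` [set a; b] : set (measurableTypeR R)) /\ mu (M `|` [set a; b]) = 0%E.
Proof.
move=> mM M0; have m2 : measurable ([set a; b] : set (measurableTypeR R)).
  by apply: measurableU; exact: measurable_set1.
split; first exact: measurableU.
apply/eqP; rewrite eq_le measure_ge0 andbT.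
apply: le_trans (measureU2 _ mM m2) _.
rewrite [X in (X + _)%E](_ : _ = 0%E) ?add0e; last exact: M0.
rewrite [leLHS](_ : _ = 0%E)//; apply: countable_lebesgue_measure0.
by apply: finite_set_countable; exact: finite_set2.
Qed.

Lemma ae_open_itv (P : R -> Prop) : {ae mu, forall t, a < t < b -> P t} ->
  exists M : set (measurableTypeR R), [/\ measurable M, mu M = 0%E &
    forall t, a <= t <= b -> ~ M t -> P t].
Proof.
move=> [M [mM M0 PM]]; have [mN N0] := null_with_ends mM M0.
exists (M `|` [set a; b]); split => // t /andP[at_ tb] /not_orP[Mt /not_orP[ta tb']].
apply: contrapT => nP; apply: Mt; apply: PM => /= K; apply: nP; apply: K.
by rewrite !lt_neqAle at_ tb !andbT; apply/andP; split; apply/eqP => // /esym.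
Qed.

End null_sets_of_the_line.

(** * Integrals of nonnegative functions over subintervals *)

Section interval_integrals.
Context {R : realType}.
Local Notation mu := (@lebesgue_measure R).
Local Open Scope ereal_scope.
Implicit Types (f : R -> \bar R).

Lemma integral_itv_split f (a s b : R) : (a <= s)%R -> (s <= b)%R ->
  measurable_fun [set: R] f -> (forall t, 0 <= f t) ->
  \int[mu]_(t in `[a, b]) f t =
    \int[mu]_(t in `[a, s]) f t + \int[mu]_(t in `[s, b]) f t.
Proof.
move=> as_ sb mf f0.
have mf' (D : set R) : measurable_fun D f by exact: measurable_funTS.
rewrite -(@integral_itv_obnd_cbnd _ s)//.
have -> : `[a, b]%classic = `[a, s] `|` `]s, b].
  by rewrite -itv_bndbnd_setU// bnd_simp.
apply: ge0_integral_setU => //; [exact: mf'|].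
apply/disj_setPS => x [] /=; rewrite !in_itv/= => /andP[_ xs] /andP[sx _].
by rewrite ltNge xs in sx.
Qed.

Lemma le_integral_itv f (a b c e : R) : (c <= a)%R -> (b <= e)%R ->
  measurable_fun [set: R] f -> (forall t, 0 <= f t) ->
  \int[mu]_(t in `[a, b]) f t <= \int[mu]_(t in `[c, e]) f t.
Proof.
move=> ca be mf f0; apply: ge0_subset_integral => //.
- exact: measurable_funTS.
- by apply: subset_itv; rewrite bnd_simp.
Qed.

Lemma integral_itv_point f (a : R) : \int[mu]_(t in `[a, a]) f t = 0.
Proof. by rewrite set_itv1 integral_set1. Qed.

End interval_integrals.

(** * Curves in pseudometric spaces *)

(** The warped distance on X * Y does not separate points. *)
Definition pseudo {R : realType} {T : Type} (d : T -> T -> R) : Prop :=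
  [/\ forall x, d x x = 0, forall x y, d x y = d y x &
      forall x y z, d x z <= d x y + d y z].

Section curves.
Context {R : realType} {T : Type}.
Implicit Types (d : T -> T -> R) (g : R -> T) (a b s t : R).
Local Notation mu := (@lebesgue_measure R).

Lemma pseudo_ge0 d x y : pseudo d -> 0 <= d x y.
Proof.
by move=> [d0 ds dt]; have := dt x y x; rewrite d0 [d y x]ds; lra.
Qed.

Lemma pseudo_lip d x y z : pseudo d -> `|d x z - d y z| <= d x y.
Proof.
move=> [d0 ds dt]; have := dt x y z; have := dt y x z; rewrite [d y x]ds => ? ?.
by rewrite ler_norml; apply/andP; split; lra.
Qed.

(** The sums in path_len, by recursion on the partition instead of by index. *)
Fixpoint polylen d g (x : R) (l : seq R) : R :=
  if l is y :: l' then d (g x) (g y) + polylen d g y l' else 0.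

Lemma polylenE d g x0 x l :
  \sum_(i < size l) d (g (nth x0 (x :: l) i)) (g (nth x0 (x :: l) i.+1)) =
  polylen d g x l.
Proof.
elim: l x => [|y l IH] x; first by rewrite big_ord0.
by rewrite /= big_ord_recl/= -IH.
Qed.

Lemma polylen_rcons d g x l z :
  polylen d g x (rcons l z) = polylen d g x l + d (g (last x l)) (g z).
Proof. by elim: l x => [|y l IH] x /=; rewrite ?addr0 ?add0r// IH addrA. Qed.

Lemma path_lenE d g a b : path_len d a b g =
  ereal_sup [set (polylen d g a l)%:E | l in itv_partition a b].
Proof.
rewrite /path_len; congr ereal_sup.
by apply/seteqP; split => _ [l lp <-]; exists l => //; rewrite -(polylenE d g b).
Qed.

Lemma path_len_ge d g a b l : itv_partition a b l ->
  ((polylen d g a l)%:E <= path_len d a b g)%E.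
Proof. by move=> lp; rewrite path_lenE; apply: ereal_sup_ubound; exists l. Qed.

Lemma path_len_ge0 d g a b : pseudo d -> a <= b -> (0 <= path_len d a b g)%E.
Proof.
move=> pd; rewrite le_eqVlt => /orP[/eqP->|ab].
  by apply: (le_trans _ (@path_len_ge d g b b [::] _)) => //; split.
apply: (le_trans _ (@path_len_ge d g a b [:: b] _)); last by split; rewrite //= ?ab ?eqxx.
by rewrite lee_fin /= addr0 pseudo_ge0.
Qed.

Lemma path_len_rstep d g a s t : pseudo d -> a <= s -> s <= t ->
  (path_len d a s g + (d (g s) (g t))%:E <= path_len d a t g)%E.
Proof.
move=> pd as_; rewrite le_eqVlt => /orP[/eqP<-|st].
  by case: pd => -> _ _; rewrite adde0.
rewrite -leeBrDr//; rewrite [leLHS]path_lenE; apply: ge_ereal_sup => _ [l [lp /eqP ll] <-].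
rewrite leeBrDr// -EFinD.
have -> : polylen d g a l + d (g s) (g t) = polylen d g a (rcons l t).
  by rewrite polylen_rcons ll.
by apply: path_len_ge; split; rewrite ?last_rcons// rcons_path lp ll.
Qed.

Lemma path_len_lstep d g x y s : pseudo d -> x < y -> y <= s ->
  ((d (g x) (g y))%:E + path_len d y s g <= path_len d x s g)%E.
Proof.
move=> pd xy ys; rewrite addeC -leeBrDr//; rewrite [leLHS]path_lenE.
apply: ge_ereal_sup => _ [l [lp ll] <-].
rewrite leeBrDr// -EFinD addrC.
by apply: (@path_len_ge d g x s (y :: l)); split; rewrite //= xy lp.
Qed.

Lemma path_len_dist d g x s : pseudo d -> x <= s ->
  ((d (g x) (g s))%:E <= path_len d x s g)%E.
Proof.
move=> pd xs; apply: le_trans (path_len_rstep g pd (lexx x) xs).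
by rewrite leeDr// path_len_ge0.
Qed.

Lemma path_le_last (x : R) l : path <%R x l -> x <= last x l.
Proof. by elim: l x => //= y l IH x /andP[xy /IH]; apply: le_trans; exact: ltW. Qed.

Lemma polylen_le_integral d g x l (f : R -> \bar R) :
  measurable_fun [set: R] f -> (forall t, 0 <= f t)%E -> path <%R x l ->
  (forall s t, x <= s -> s <= t -> t <= last x l ->
    ((d (g s) (g t))%:E <= \int[mu]_(t in `[s, t]) f t)%E) ->
  ((polylen d g x l)%:E <= \int[mu]_(t in `[x, last x l]) f t)%E.
Proof.
move=> mf f0; elim: l x => [|y l IH] x /=; first by rewrite integral_itv_point.
move=> /andP[xy yl] H; have yle : y <= last y l.
  exact: path_le_last.
rewrite (integral_itv_split (ltW xy) yle)// EFinD leeD//; first exact: H (ltW xy) yle.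
by apply: IH => // s t ys; apply: H; rewrite (le_trans (ltW xy)).
Qed.

(** The time s is inserted into the partition; the polygon is compared with the path
    before s and with the integral of f after s. *)
Lemma polylen_le_add d g (f : R -> \bar R) x l s : pseudo d ->
  measurable_fun [set: R] f -> (forall t, 0 <= f t)%E -> path <%R x l ->
  x <= s -> s <= last x l ->
  (forall u v, x <= u -> u <= v -> v <= last x l ->
    ((d (g u) (g v))%:E <= \int[mu]_(t in `[u, v]) f t)%E) ->
  ((polylen d g x l)%:E <=
    path_len d x s g + \int[mu]_(t in `[s, last x l]) f t)%E.
Proof.
move=> pd mf f0; elim: l x => [|y l IH] x /=.
  move=> _ xs sx _; rewrite adde_ge0 ?path_len_ge0//.
  by apply: integral_ge0 => t _; exact: f0.
move=> /andP[xy yl] xs sl H; have yle := path_le_last yl.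
have [ys|sy] := leP y s.
  apply: (@le_trans _ _ ((d (g x) (g y))%:E + (path_len d y s g + \int[mu]_(t in `[s, last y l]) f t))%E).
    rewrite EFinD leeD2l// IH// => u v yu; apply: H; exact: le_trans (ltW xy) yu.
  by rewrite addeA leeD2r// path_len_lstep.
have sl' : s <= last y l := le_trans (ltW sy) yle.
rewrite (integral_itv_split (ltW sy) yle)// addeA EFinD leeD//.
  have [_ _ dt] := pd.
  apply: (@le_trans _ _ ((d (g x) (g s))%:E + (d (g s) (g y))%:E)%E).
    by rewrite -EFinD lee_fin.
  by rewrite leeD ?path_len_dist// H// ltW.
apply: polylen_le_integral => // u v yu; apply: H; exact: le_trans (ltW xy) yu.
Qed.

Lemma path_len_le_add d g (f : R -> \bar R) a s t : pseudo d ->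
  measurable_fun [set: R] f -> (forall t, 0 <= f t)%E -> a <= s -> s <= t ->
  (forall u v, a <= u -> u <= v -> v <= t ->
    ((d (g u) (g v))%:E <= \int[mu]_(x in `[u, v]) f x)%E) ->
  (path_len d a t g <= path_len d a s g + \int[mu]_(x in `[s, t]) f x)%E.
Proof.
move=> pd mf f0 as_ st H; rewrite [leLHS]path_lenE; apply: ge_ereal_sup => _ [l [lp /eqP ll] <-].
by rewrite -ll; apply: polylen_le_add => //; rewrite ll.
Qed.

Lemma path_len_xx d g a : pseudo d -> path_len d a a g = 0%E.
Proof.
move=> pd; apply/eqP; rewrite eq_le path_len_ge0// andbT path_lenE.
apply: ge_ereal_sup => _ [l [lp /eqP ll] <-].
case: l lp ll => //= y l /andP[ay yl] ll; have := path_le_last yl.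
by rewrite ll leNgt ay.
Qed.

(** The form in which absolute continuity is used: distances along the curve are
    dominated by the integral of one density. *)
Definition speed_bound d a b g (h : R -> R) : Prop :=
  [/\ measurable_fun [set: R] h, forall t, 0 <= h t,
      (\int[mu]_(t in `[a, b]) (h t)%:E < +oo)%E &
      forall s t, a <= s -> s <= t -> t <= b ->
        ((d (g s) (g t))%:E <= \int[mu]_(x in `[s, t]) (h x)%:E)%E].

(** Uniform absolute continuity of the indefinite integral. *)
Lemma integral_itv_small (h : R -> R) a b e : measurable_fun [set: R] h ->
  (forall t, 0 <= h t) -> (\int[mu]_(t in `[a, b]) (h t)%:E < +oo)%E -> 0 < e ->
  exists2 dl, 0 < dl & forall A : set R, measurable A -> A `<=` `[a, b] ->
    (mu A < dl%:E -> \int[mu]_(t in A) (h t)%:E < e%:E)%E.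
Proof.
move=> mh h0 hfin e0.
have hi : mu.-integrable `[a, b] (EFin \o h).
  apply/integrableP; split; first by apply/measurable_EFinP; exact: measurable_funTS.
  by under eq_integral => t _ do rewrite /= ger0_norm//.
have hi' : mu.-integrable [set: R] (EFin \o (h \_ `[a, b])).
  by rewrite -restrict_EFin; apply: (integrable_mkcond _ _).1.
have [dl [dl0 H]] := integral_normr_continuous hi' e0.
exists dl => // A mA AI mAd; have := H A mA mAd.
rewrite /Rintegral.
have -> : (\int[mu]_(x in A) `|(h \_ `[a, b]) x|%:E = \int[mu]_(x in A) (h x)%:E)%E.
  apply: eq_integral => t /[!inE] At; rewrite patchE mem_set; last exact: AI.
  by rewrite ger0_norm.
rewrite -lte_fin fineK// ge0_fin_numE; last by apply: integral_ge0 => t _; rewrite lee_fin.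
apply: le_lt_trans hfin; apply: ge0_subset_integral => //.
- by apply/measurable_EFinP; exact: measurable_funTS.
- by move=> t _; rewrite lee_fin.
Qed.

(** The length over an interval is at most the integral of h over it, and integrals of h
    over sets of small measure are small. *)
Theorem ac_path_of_bound d a b g h : pseudo d -> a <= b -> speed_bound d a b g h ->
  ac_path d a b g.
Proof.
move=> pd ab [mh h0 hfin H].
have mhE : measurable_fun [set: R] (EFin \o h) by apply/measurable_EFinP.
have hE0 t : (0 <= (h t)%:E)%E by rewrite lee_fin.
have lenab : (path_len d a b g < +oo)%E.
  apply: le_lt_trans (path_len_le_add pd mhE hE0 (lexx a) ab H) _.
  by rewrite path_len_xx// add0e.
split; [split=> //; split=> // t /andP[at_ tb]|].
  apply/cvgrPdist_lt => e e0.
  have [dl dl0 Hdl] := integral_itv_small mh h0 hfin e0.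
  rewrite near_withinE; near=> u => /=; rewrite in_itv/= => /andP[au ub].
  have utd : `|t - u| < dl by near: u; apply: (@cvgr_dist_lt _ R^o) => //; exact: cvg_id.
  rewrite sub0r normrN ger0_norm ?pseudo_ge0//.
  have small x y : a <= x -> x <= y -> y <= b -> y - x < dl -> d (g x) (g y) < e.
    move=> ax xy yb yx; rewrite -lte_fin; apply: le_lt_trans (H _ _ ax xy yb) _.
    apply: Hdl; [exact: measurable_itv|by apply: subset_itv; rewrite bnd_simp|].
    rewrite [X in (X < _)%E]lebesgue_measure_itv/= lte_fin; case: ifP => // _.
  have [tu|ut] := leP t u.
    have [_ -> _] := pd; apply: small => //; move: utd; rewrite distrC ger0_norm//.
    by rewrite subr_ge0.
  by apply: small => //; [exact: ltW|move: utd; rewrite gtr0_norm// subr_gt0].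
have lenfin t : a <= t -> t <= b -> path_len d a t g \is a fin_num.
  move=> at_ tb; rewrite ge0_fin_numE ?path_len_ge0//; apply: le_lt_trans lenab.
  apply: le_trans (path_len_rstep g pd at_ tb).
  by rewrite leeDl// lee_fin pseudo_ge0.
move=> e e0; have [dl dl0 Hdl] := integral_itv_small mh h0 hfin e0.
exists dl => // n s t st disj sumd.
pose I i : set R := `]s i, t i[%classic.
have tI : trivIset [set: 'I_n] I.
  apply/trivIsetP => i j _ _ ij; apply/eqP/negPn/negP => /set0P[x []].
  rewrite /I /= !in_itv/= => /andP[x1 x2] /andP[x3 x4].
  by case: (disj i j ij) => ?; lra.
rewrite -lte_fin -sumEFin.
apply: (@le_lt_trans _ _ (\sum_(i < n) \int[mu]_(x in I i) (h x)%:E)%E).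
  apply: lee_sum => i _; have [asi sti tib] := st i.
  have sib := le_trans sti tib; have ati := le_trans asi sti.
  have mono : (path_len d a (s i) g <= path_len d a (t i) g)%E.
    apply: le_trans (path_len_rstep g pd asi sti).
    by rewrite leeDl// lee_fin pseudo_ge0.
  rewrite ger0_norm ?subr_ge0 ?fine_le ?lenfin//.
  rewrite EFinB !fineK ?lenfin// leeBlDl ?lenfin//.
  rewrite -(@integral_itv_bndoo _ _ _ _ true false); last exact: measurable_funTS.
  by apply: path_len_le_add => // u v au uv vt; apply: H => //; exact: le_trans tib.
have mI i : measurable (I i : set (measurableTypeR R)) by exact: measurable_itv.
have mU : measurable (\big[setU/set0]_(i < n) I i : set (measurableTypeR R)).
  by apply: bigsetU_measurable => i _.
have tI' : trivIset [set` index_enum 'I_n] I by apply: sub_trivIset tI.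
have <- : (\int[mu]_(x in \big[setU/set0]_(i < n) I i) (h x)%:E =
    \sum_(i < n) \int[mu]_(x in I i) (h x)%:E)%E.
  apply: ge0_integral_bigsetU => //; first exact: index_enum_uniq.
  exact: measurable_funTS.
apply: Hdl => //.
  move=> x; rewrite -bigcup_seq => -[i _]; rewrite /I /= !in_itv/= => /andP[sx xt].
  by have [as_ _ tb] := st i; apply/andP; split; lra.
have -> : mu (\big[setU/set0]_(i < n) I i) = (\sum_(i < n) mu (I i))%E.
  rewrite -[LHS]mul1e -integral_cst//.
  transitivity (\sum_(i < n) \int[mu]_(x in I i) cst 1 x)%E.
    by apply: ge0_integral_bigsetU => //; exact: index_enum_uniq.
  by apply: eq_bigr => i _; rewrite integral_cst// mul1e.
rewrite -lte_fin in sumd; apply: le_lt_trans sumd; rewrite -sumEFin.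
apply: lee_sum => i _; have [_ sti _] := st i.
rewrite [leLHS]lebesgue_measure_itv/= lte_fin; case: ifP => // _.
by rewrite lee_fin subr_ge0.
Unshelve. all: by end_near. Qed.

(** The metric speed as a first order expansion, which avoids both the quotient and the
    filter of speed and behaves well under comparison. *)
Definition has_speed d a b g t v : Prop :=
  forall e : R, 0 < e -> exists2 dl : R, 0 < dl & forall u, a <= u <= b -> `|u - t| < dl ->
    `|d (g u) (g t) - v * `|u - t| | <= e * `|u - t|.

Lemma has_speed_speed d a b g t v : a < t < b -> has_speed d a b g t v ->
  speed d a b g t = v.
Proof.
move=> /andP[at_ tb] H; rewrite /speed.
have PF : ProperFilter (within `[a, b] (dnbhs t)).
  apply: Build_ProperFilter_ex => P /nbhs_ballP[e /= e0 He].
  pose m := Num.min (e / 2) ((b - t) / 2).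
  have m0 : 0 < m by rewrite lt_min !divr_gt0// subr_gt0.
  have m1 : m <= e / 2 by rewrite /m ge_min lexx.
  have m2 : m <= (b - t) / 2 by rewrite /m ge_min lexx orbT.
  exists (t + m); apply: He.
  - by rewrite /ball/= opprD addNKr normrN gtr0_norm//; lra.
  - by rewrite gt_eqF// ltrDl.
  - by rewrite /= in_itv/=; apply/andP; split; lra.
apply/cvg_lim => //; apply/cvgrPdist_le => e e0; have [dl dl0 Hdl] := H e e0.
apply/nbhs_ballP; exists dl => //= u.
rewrite /ball/= distrC => utd ut; rewrite /= in_itv/= => uab.
have ut0 : 0 < `|u - t| by rewrite normr_gt0 subr_eq0.
rewrite -(ler_pM2r ut0); apply: le_trans (Hdl u uab utd).
rewrite -{2}(gtr0_norm ut0) -normrM mulrBl divfK ?gt_eqF//.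
by rewrite distrC.
Qed.

Lemma rectifiable_len d a b g : pseudo d -> rectifiable d a b g ->
  exists L : R -> R,
  [/\ a <= b, L a = 0, forall s t, a <= s -> s <= t -> t <= b -> d (g s) (g t) <= L t - L s,
      path_len d a b g = (L b)%:E & L = fun t => fine (path_len d a t g)].
Proof.
move=> pd [[ab _] lenab]; pose L t := fine (path_len d a t g).
have lenfin t : a <= t -> t <= b -> path_len d a t g \is a fin_num.
  move=> at_ tb; rewrite ge0_fin_numE ?path_len_ge0//; apply: le_lt_trans lenab.
  apply: le_trans (path_len_rstep g pd at_ tb).
  by rewrite leeDl// lee_fin pseudo_ge0.
exists L; split => //; first by rewrite /L path_len_xx.
- move=> s t as_ st tb; have := path_len_rstep g pd as_ st.
  rewrite -(fineK (lenfin s as_ (le_trans st tb))) -(fineK (lenfin t (le_trans as_ st) tb)).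
  by rewrite -EFinD lee_fin -/(L s) -/(L t); lra.
- by rewrite fineK// lenfin.
Qed.

Let split_error (A B K H D e n : R) : 0 <= e * n ->
  `|A + B - K * D| <= e / 2 * n -> `|B - H * D| <= e / 2 * n ->
  `|A - (K - H) * D| <= e * n /\ `|B - H * D| <= e * n.
Proof.
move=> en; rewrite !ler_norml => /andP[? ?] /andP[? ?].
by split; apply/andP; split; lra.
Qed.

Let speed_error (D P B h c e x : R) : 0 <= h ->
  `|P - c * x| <= e / 2 * `|x| -> `|B - h * x| <= e * `|x| ->
  `|P| <= D -> D <= `|B| -> h - e / 2 < `|c| -> `|D - h * `|x| | <= e * `|x|.
Proof.
move=> h0 Pc Bh PD DB hc.
have upper : `|B| <= h * `|x| + e * `|x|.
  rewrite -[B](subrK (h * x)); apply: le_trans (ler_normD _ _) _.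
  by rewrite normrM (ger0_norm h0) addrC lerD2l.
have lower : (h - e / 2) * `|x| <= `|P| + e / 2 * `|x|.
  apply: (@le_trans _ _ `|c * x|).
    by rewrite normrM; apply: ler_wpM2r => //; exact: ltW.
  rewrite -[c * x](subKr P); apply: le_trans (ler_normB _ _) _.
  by rewrite lerD2l.
by rewrite ler_norml; apply/andP; split; lra.
Qed.

(** Let L be the arc length and h its derivative. For the points x of a countable dense
    subset of the curve, the functions t |-> d (g t) x have derivatives c n almost
    everywhere, with |c n| <= h, and M = sup |c n| dominates the distances along g. So
    the length is at most the integral of M, which forces M = h almost everywhere. At
    such a time some |c n| is close to h, and the difference quotients of d (g u) (g t)
    lie between those of t |-> d (g t) x and those of L. *)
Theorem ac_path_speed d a b g : pseudo d -> ac_path d a b g ->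
  exists2 h, speed_bound d a b g h &
    {ae mu, forall t, a < t < b -> has_speed d a b g t (h t)}.
Proof.
move=> pd acg; have [L [ab La Ld lenE LE]] := rectifiable_len pd acg.1.
have Lac : abs_cont a b L by rewrite LE; exact: acg.2.
move: ab; rewrite le_eqVlt => /orP[/eqP ab|ab].
  exists (fun=> 0); first split => //.
  - by rewrite integral0.
  - move=> s t as_ st tb; have -> : s = t by lra.
    by have [-> _ _] := pd; rewrite integral0.
  by apply: aeW => t /andP[]; rewrite ab => /lt_trans /[apply]; rewrite ltxx.
have Lnd s t : a <= s -> s <= t -> t <= b -> L s <= L t.
  move=> as_ st tb; have := Ld s t as_ st tb.
  by have := pseudo_ge0 (g s) (g t) pd; lra.
have [h [mh h0 hi hL hae]] := monotone_ac_density ab Lnd Lac.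
have sb : speed_bound d a b g h.
  split => //; first by rewrite hL ?ltry// ltW.
  by move=> s t as_ st tb; rewrite hL// lee_fin; exact: Ld.
exists h => //.
(* adding the arc length makes the distance to a point of the curve nondecreasing *)
pose F n t := d (g t) (g (ratr (odflt 0 (unpickle n : option rat)))) + L t.
have FL n s t : a <= s -> s <= t -> t <= b -> `|F n t - F n s| <= 2 * (L t - L s).
  move=> as_ st tb; have := Ld s t as_ st tb; rewrite /F.
  have := pseudo_lip (g t) (g s) (g (ratr (odflt 0 (unpickle n)))) pd.
  have -> : d (g t) (g s) = d (g s) (g t) by case: pd.
  rewrite !ler_norml => /andP[? ?] ?.
  by apply/andP; split; lra.
have Fnd n s t : a <= s -> s <= t -> t <= b -> F n s <= F n t.
  move=> as_ st tb; have := Ld s t as_ st tb; rewrite /F.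
  have := pseudo_lip (g t) (g s) (g (ratr (odflt 0 (unpickle n)))) pd.
  have -> : d (g t) (g s) = d (g s) (g t) by case: pd.
  by rewrite !ler_norml => /andP[? ?] ?; lra.
have Fac n : abs_cont a b (F n).
  move=> e e0; have e20 : 0 < e / 2 by rewrite divr_gt0.
  have [dl dl0 H] := Lac _ e20; exists dl => // k s t st disj sumd.
  have {}H := H k s t st disj sumd.
  apply: (@le_lt_trans _ _ (\sum_(i < k) 2 * `|L (t i) - L (s i)|)).
    apply: ler_sum => i _; have [? ? ?] := st i; apply: le_trans (FL n _ _ _ _ _) _ => //.
    by rewrite ler_wpM2l// ler_norm.
  by rewrite -mulr_sumr; lra.
have [k kP] := choice (fun n => monotone_ac_density ab (Fnd n) (Fac n)).
pose c n t := k n t - h t.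
have mc n : measurable_fun [set: R] (c n).
  by have [mk _ _ _ _] := kP n; exact: measurable_funB.
pose phi n t := d (g t) (g (ratr (odflt 0 (unpickle n : option rat)))).
(* at almost every time, all the functions phi n have derivative c n, bounded by h *)
have good : {ae mu, forall t, a < t < b -> (forall n, `|c n t| <= h t) /\
    (forall n (e : R), 0 < e -> exists2 dl : R, 0 < dl & forall u, a <= u <= b -> `|u - t| < dl ->
      `|phi n u - phi n t - c n t * (u - t)| <= e * `|u - t|) /\
    (forall e : R, 0 < e -> exists2 dl : R, 0 < dl & forall u, a <= u <= b -> `|u - t| < dl ->
      `|L u - L t - h t * (u - t)| <= e * `|u - t|)}.
  have kae : {ae mu, forall t n, a < t < b ->
      forall e : R, 0 < e -> exists2 dl : R, 0 < dl & forall u, a <= u <= b -> `|u - t| < dl ->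
      `|F n u - F n t - k n t * (u - t)| <= e * `|u - t|}.
    by apply: ae_foralln => n; have [_ _ _ _] := kP n.
  move: hae kae; apply: filterS2; first exact: (ae_filter_ringOfSetsType mu).
  move=> t ht kt tab; have {}ht := ht tab; have {}kt n := kt n tab.
  have phic n e : 0 < e -> exists2 dl, 0 < dl & forall u, a <= u <= b -> `|u - t| < dl ->
      `|phi n u - phi n t - c n t * (u - t)| <= e * `|u - t| /\
      `|L u - L t - h t * (u - t)| <= e * `|u - t|.
    move=> e0; have e20 : 0 < e / 2 by lra.
    have [dl1 dl10 H1] := kt n _ e20; have [dl2 dl20 H2] := ht _ e20.
    exists (Num.min dl1 dl2); first by rewrite lt_min dl10.
    move=> u uab; rewrite lt_min => /andP[/(H1 u uab) + /(H2 u uab)].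
    have ? := mulr_ge0 (ltW e0) (normr_ge0 (u - t)).
    rewrite /F -/(phi n u) -/(phi n t).
    rewrite (_ : phi n u + L u - (phi n t + L t) = phi n u - phi n t + (L u - L t)); last first.
      by rewrite opprD addrACA.
    exact: split_error.
  split; [|split] => //.
  - move=> n; apply/ler_addgt0Pr => e e0.
    have e30 : 0 < e / 2 by lra.
    have [dl dl0 H] := phic n _ e30; move: tab => /andP[at_ tb].
    pose m := Num.min (dl / 2) ((b - t) / 2).
    have m0 : 0 < m by rewrite lt_min; apply/andP; split; lra.
    have m1 : m <= dl / 2 by rewrite /m ge_min lexx.
    have m2 : m <= (b - t) / 2 by rewrite /m ge_min lexx orbT.
    have := H (t + m); rewrite addrAC subrr add0r gtr0_norm// => /(_ _ _).
    have -> : a <= t + m <= b by apply/andP; split; lra.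
    have -> : m < dl by lra.
    move=> /(_ isT isT)[].
    have : `|phi n (t + m) - phi n t| <= L (t + m) - L t.
      apply: (le_trans (pseudo_lip _ _ _ pd)).
      have -> : d (g (t + m)) (g t) = d (g t) (g (t + m)) by case: pd.
      by apply: Ld; lra.
    rewrite !ler_norml => /andP[? ?] /andP[? ?] /andP[? ?].
    by apply/andP; split; rewrite -(ler_pM2r m0); lra.
  - move=> n e e0; have [dl dl0 H] := phic n e e0; exists dl => // u uab utd.
    by have [] := H u uab utd.
have [N [mN N_null goodN]] := ae_open_itv good.
(* capped by h, so that M is finite everywhere *)
pose M t := fine (esups (fun n => (Num.min `|c n t| (h t))%:E) 0%N).
have Mle t : (esups (fun n => (Num.min `|c n t| (h t))%:E) 0%N <= (h t)%:E)%E.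
  by apply: ge_ereal_sup => _ [n _ <-]; rewrite lee_fin ge_min lexx orbT.
have leM n t : ((Num.min `|c n t| (h t))%:E <= esups (fun n => (Num.min `|c n t| (h t))%:E) 0%N)%E.
  by apply: ereal_sup_ubound; exists n.
have M_ge0 t : (0 <= esups (fun n => (Num.min `|c n t| (h t))%:E) 0%N)%E.
  by apply: le_trans (leM 0%N t); rewrite lee_fin le_min normr_ge0 h0.
have ME t : (M t)%:E = esups (fun n => (Num.min `|c n t| (h t))%:E) 0%N.
  by rewrite /M fineK// ge0_fin_numE//; apply: le_lt_trans (Mle t) _; exact: ltry.
have mM : measurable_fun [set: R] (EFin \o M).
  rewrite (_ : _ \o _ = (fun t => esups (fun n => (Num.min `|c n t| (h t))%:E) 0%N)); last first.
    by apply/funext => t; rewrite /= ME.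
  apply: measurable_fun_esups => n; apply/measurable_EFinP; apply: measurable_minr => //.
  exact: measurableT_comp.
have M0 t : (0 <= (M t)%:E)%E by rewrite ME.
have cM n t : a <= t <= b -> ~ N t -> `|c n t| <= M t.
  move=> tab Nt; have [ch _] := goodN t tab Nt.
  by rewrite -lee_fin ME; apply: le_trans (leM n t); rewrite lee_fin le_min lexx ch.
have phiM n s t : a <= s -> s <= t -> t <= b ->
    (`|phi n t - phi n s|%:E <= \int[mu]_(x in `[s, t]) (M x)%:E)%E.
  move=> as_ st tb; have [mk k0 ki kF _] := kP n.
  have kis : mu.-integrable `[s, t] (EFin \o k n) by apply: integrableS ki.
  have his : mu.-integrable `[s, t] (EFin \o h) by apply: integrableS hi.
  have -> : (`|phi n t - phi n s|%:E = `| \int[mu]_(x in `[s, t]) (c n x)%:E |)%E.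
    transitivity (`|\int[mu]_(x in `[s, t]) ((EFin \o k n) x - (EFin \o h) x)|)%E; last first.
      by congr (`| _ |)%E; apply: eq_integral => x _ /=; rewrite EFinB.
    rewrite integralB//= kF// hL// -EFinB /=; congr (`| _ |%:E).
    by rewrite /F -/(phi n t) -/(phi n s); lra.
  apply: (@le_trans _ _ (\int[mu]_(x in `[s, t]) `|(c n x)%:E|)%E).
    apply: le_abse_integral; first exact: measurable_itv.
    by apply/measurable_EFinP; exact: (measurable_funTS (mc n)).
  apply: (ge0_ae_le_integral_nomeas mN N_null) => //= x; rewrite in_itv/= => /andP[sx xt] Nx.
  by rewrite lee_fin; apply: cM => //; apply/andP; split; lra.
have dM s t : a <= s -> s <= t -> t <= b ->
    ((d (g s) (g t))%:E <= \int[mu]_(x in `[s, t]) (M x)%:E)%E.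
  move=> as_ + tb; rewrite le_eqVlt => /orP[/eqP<-|st].
    by have [-> _ _] := pd; apply: integral_ge0 => x _.
  apply/lee_addgt0Pr => e e0; have e20 : 0 < e / 2 by rewrite divr_gt0.
  have [dl dl0 H] := abs_cont1 Lac e20.
  have st' : s < Num.min t (s + dl) by rewrite lt_min st ltrDl.
  have [q /[!in_itv]/= /andP[sq qm]] := rat_in_itvoo st'.
  move: (qm); rewrite lt_min => /andP[qt qd].
  have := phiM (pickle q) s t as_ (ltW st) tb.
  rewrite /phi pickleK /=; set x := g (ratr q) => K.
  apply: (@le_trans _ _ (`|d (g t) x - d (g s) x| + e)%:E); last first.
    by rewrite EFinD leeD2r.
  rewrite lee_fin.
  have qs : d (g s) x < e / 2.
    apply: le_lt_trans (Ld s (ratr q) as_ (ltW sq) _) _; first by rewrite (le_trans (ltW qt)).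
    apply: le_lt_trans (ler_norm _) _; apply: H => //.
    - exact: ltW.
    - exact: le_trans (ltW qt) tb.
    - by rewrite ltrBlDl.
  have [_ ds dt] := pd; have := dt (g s) x (g t); rewrite [d x _]ds.
  by have := ler_norm (d (g t) x - d (g s) x); lra.
have LM : ((L b)%:E <= \int[mu]_(x in `[a, b]) (M x)%:E)%E.
  rewrite -lenE; apply: le_trans (path_len_le_add pd mM M0 (lexx a) (ltW ab) dM) _.
  by rewrite path_len_xx// add0e.
have Lh : (\int[mu]_(x in `[a, b]) (h x)%:E = (L b)%:E)%E by rewrite hL// ?La ?subr0// ltW.
have Mh t : M t <= h t by rewrite -lee_fin ME.
have mMR : measurable_fun [set: R] M by apply/measurable_EFinP.
have hMi : (\int[mu]_(x in `[a, b]) (h x - M x)%:E = 0)%E.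
  have his : mu.-integrable `[a, b] (EFin \o h) by apply: integrableS hi.
  have Mis : mu.-integrable `[a, b] (EFin \o M).
    apply: le_integrable his => //; first exact: measurable_funTS.
    by move=> t _ /=; rewrite lee_fin !ger0_norm// -lee_fin.
  have Mfin : (\int[mu]_(x in `[a, b]) (M x)%:E \is a fin_num)%E.
    exact: (integrable_fin_num _ Mis).
  transitivity (\int[mu]_(x in `[a, b]) ((EFin \o h) x - (EFin \o M) x))%E.
    by apply: eq_integral => x _ /=; rewrite EFinB.
  rewrite integralB//=; apply/eqP; rewrite eq_le; apply/andP; split.
    by rewrite leeBlDr// add0e Lh.
  rewrite leeBrDr// add0e.
  apply: ge0_le_integral => //; last by move=> x _; rewrite lee_fin.
  - by apply/measurable_EFinP; exact: measurable_funTS.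
  - by apply/measurable_EFinP; exact: measurable_funTS.
have aeMh : {ae mu, forall t, `[a, b]%classic t -> (h t - M t)%:E = 0%E}.
  apply: (ae_eq_integral_abs mu _ _).1 => //.
    by apply/measurable_EFinP; apply: measurable_funTS; exact: measurable_funB.
  rewrite -[RHS]hMi; apply: eq_integral => x _ /=.
  by rewrite ger0_norm// subr_ge0.
move: good aeMh; apply: filterS2; first exact: (ae_filter_ringOfSetsType mu).
move=> t gt hMt tab; have [ch [dphi dL]] := gt tab; move: (tab) => /andP[at_ tb].
have {hMt} hMt : h t = M t.
  have : `[a, b]%classic t by rewrite /= in_itv/=; apply/andP; split; exact: ltW.
  by move=> /hMt[] /eqP; rewrite subr_eq0 => /eqP.
move=> e e0; have e20 : 0 < e / 2 by rewrite divr_gt0.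
have [n hn] : exists n, h t - e / 2 < `|c n t|.
  apply: contrapT => nn; suff : h t <= h t - e / 2 by lra.
  rewrite {1}hMt -lee_fin ME; apply: ge_ereal_sup => _ [n _ <-].
  rewrite lee_fin ge_min leNgt; apply/orP; left; apply/negP => ?; apply: nn.
  by exists n.
have [dl1 dl10 H1] := dphi n _ e20; have [dl2 dl20 H2] := dL _ e0.
exists (Num.min dl1 dl2); first by rewrite lt_min dl10.
move=> u uab; rewrite lt_min => /andP[/(H1 u uab) + /(H2 u uab)].
have ut0 := normr_ge0 (u - t).
have up : d (g u) (g t) <= `|L u - L t|.
  move: uab => /andP[au ub]; have [ut|tu] := leP u t.
    by apply: le_trans (Ld u t au ut (ltW tb)) _; rewrite distrC ler_norm.
  have -> : d (g u) (g t) = d (g t) (g u) by case: pd.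
  by apply: le_trans (Ld t u (ltW at_) (ltW tu) ub) _; rewrite ler_norm.
have lo : `|phi n u - phi n t| <= d (g u) (g t) by exact: pseudo_lip.
by move=> H3 H4; exact: (speed_error (h0 t) H3 H4 lo up hn).
Qed.
End curves.

(** * Arc-length parametrization *)

Section arclength.
Context {R : realType} {T : Type}.
Implicit Types (d : T -> T -> R) (g : R -> T) (a b s t : R).

Lemma path_approx d a b g t e : pseudo d -> is_path d a b g -> a <= t <= b -> 0 < e ->
  exists2 dl : R, 0 < dl & forall u, a <= u <= b -> `|u - t| < dl -> d (g u) (g t) < e.
Proof.
move=> pd [_ /(_ t)] H tab e0; move/cvgrPdist_lt : (H tab) => /(_ e e0).
rewrite near_withinE => /nbhs_ballP[dl /= dl0 {}H]; exists dl => // u uab utd.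
have := H u; rewrite /ball/= distrC utd in_itv/= uab sub0r normrN.
by rewrite ger0_norm ?pseudo_ge0//; apply.
Qed.

(** tau s is the last time at which the length run through is at most s; the
    path may stop for a while, and g is constant there. *)
Lemma rectifiable_lip d a b g : is_metric d -> rectifiable d a b g ->
  exists l c, [/\ (l%:E = path_len d a b g)%E, 0 <= l, c 0 = g a, c l = g b &
    forall s t, 0 <= s -> s <= t -> t <= l -> d (c s) (c t) <= t - s].
Proof.
move=> [deq ds dt] rg.
have pd : pseudo d by split => // x; exact/deq.
have [L [ab La Ld lenE _]] := rectifiable_len pd rg.
have Lnd s t : a <= s -> s <= t -> t <= b -> L s <= L t.
  move=> as_ st tb; have := Ld s t as_ st tb.
  by have := pseudo_ge0 (g s) (g t) pd; lra.
have gp := rg.1.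
pose S s := [set t | a <= t <= b /\ L t <= s].
pose tau s := sup (S s).
have Sa s : 0 <= s -> S s a by move=> s0; split; rewrite ?lexx ?ab// La.
have Sub s : has_ubound (S s) by exists b => t [/andP[]].
have tauab s : 0 <= s -> a <= tau s <= b.
  move=> s0; apply/andP; split; first exact: ub_le_sup (Sa s s0).
  by apply: ge_sup; [exists a; exact: Sa|move=> t [/andP[]]].
have tau_le s u : 0 <= s -> a <= u -> u < tau s -> L u <= s.
  move=> s0 au; move=> /(sup_gt (ex_intro _ a (Sa s s0)))[t [/andP[at_ tb] Lt] ut].
  by apply: le_trans Lt; apply: Lnd => //; exact: ltW.
have tau_ge s u : 0 <= s -> u <= b -> tau s < u -> s < L u.
  move=> s0 ub tu; rewrite ltNge; apply/negP => Lu.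
  suff : u <= tau s by rewrite leNgt tu.
  apply: ub_le_sup => //; split => //; rewrite ub andbT.
  by have /andP[ata _] := tauab s s0; apply: le_trans (ltW tu).
have tau_nd s t : 0 <= s -> s <= t -> tau s <= tau t.
  move=> s0 st; apply: ge_sup; first by exists a; exact: Sa.
  move=> u [uab Lu]; apply: ub_le_sup => //; split => //; exact: le_trans st.
exists (L b), (g \o tau); split => //.
- by have := Lnd a b (lexx a) ab (lexx b); rewrite La.
- apply/deq; apply/eqP; rewrite eq_le pseudo_ge0// andbT; apply/ler_addgt0Pr => e e0.
  rewrite add0r /=; have ta := tauab 0 (lexx 0); have [dl dl0 H] := path_approx pd gp ta e0.
  have /andP[at_ tb] := ta; move: at_; rewrite le_eqVlt => /orP[/eqP<-|at_].
    by have [-> _ _] := pd; exact: ltW.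
  pose u := Num.max a (tau 0 - dl / 2).
  have au : a <= u by rewrite le_max lexx.
  have ut : u < tau 0 by rewrite gt_max at_ ltrBlDr ltrDl divr_gt0.
  have ud : tau 0 - dl / 2 <= u by rewrite le_max lexx orbT.
  have ub : u <= b := le_trans (ltW ut) tb.
  have Lu := tau_le 0 u (lexx 0) au ut.
  have := Ld a u (lexx a) au ub; rewrite La subr0 => gau.
  have := H u; rewrite au ub ltr0_norm ?subr_lt0// opprB => /(_ isT) gu.
  have := gu ltac:(lra); have := dt (g (tau 0)) (g u) (g a).
  rewrite [d (g (tau 0)) (g u)]ds [d (g u) (g a)]ds; lra.
- by congr (g _); apply/eqP; rewrite eq_le; apply/andP; split;
    [have /andP[] := tauab (L b) ltac:(by have := Lnd a b (lexx a) ab (lexx b); rewrite La)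
    |apply: ub_le_sup => //; split; rewrite ?lexx ?ab].
move=> s t s0 st tl /=; have t0 := le_trans s0 st.
have /andP[as_ sb] := tauab s s0; have /andP[at_ tb] := tauab t t0.
move: (tau_nd s t s0 st); rewrite le_eqVlt => /orP[/eqP->|tst].
  by have [-> _ _] := pd; rewrite subr_ge0.
apply/ler_addgt0Pr => e e0; have e20 : 0 < e / 2 by rewrite divr_gt0.
have [dl1 dl10 H1] := path_approx pd gp (tauab s s0) e20.
have [dl2 dl20 H2] := path_approx pd gp (tauab t t0) e20.
pose m := (tau s + tau t) / 2.
have sm : tau s < m by rewrite /m; lra.
have mt : m < tau t by rewrite /m; lra.
pose u := Num.min m (tau s + dl1 / 2); pose v := Num.max m (tau t - dl2 / 2).
have um : u <= m by rewrite ge_min lexx.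
have mv : m <= v by rewrite le_max lexx.
have su : tau s < u by rewrite lt_min sm ltrDl divr_gt0.
have vt : v < tau t by rewrite gt_max mt ltrBlDr ltrDl divr_gt0.
have ud : u <= tau s + dl1 / 2 by rewrite ge_min lexx orbT.
have vd : tau t - dl2 / 2 <= v by rewrite le_max lexx orbT.
have au : a <= u by lra.
have vb : v <= b by lra.
have uv : u <= v by lra.
have g1 : d (g u) (g (tau s)) < e / 2.
  by apply: H1; [apply/andP; split; lra|rewrite gtr0_norm ?subr_gt0//; lra].
have g2 : d (g v) (g (tau t)) < e / 2.
  by apply: H2; [apply/andP; split; lra|rewrite ltr0_norm ?subr_lt0// opprB; lra].
have := Ld u v au uv vb; have := tau_ge s u s0 (le_trans uv vb) su.
have := tau_le t v t0 (le_trans au uv) vt.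
have := dt (g (tau s)) (g u) (g (tau t)); have := dt (g u) (g v) (g (tau t)).
rewrite [d (g (tau s)) (g u)]ds; lra.
Qed.

Lemma length_space_lip d x y e : is_metric d -> length_space d -> 0 < e ->
  exists l c, [/\ l < d x y + e, 0 <= l, c 0 = x, c l = y &
    forall s t, 0 <= s -> s <= t -> t <= l -> d (c s) (c t) <= t - s].
Proof.
move=> md ld e0; have [_ dE] := ld x y; set S := (X in ereal_inf X) in dE.
have Sfin : ereal_inf S \is a fin_num by rewrite -dE.
have [_ [a [b [g [rg ga gb ->]]]]] := lb_ereal_inf_adherent e0 Sfin.
rewrite -dE -EFinD; have [l [c [<- l0 c0 cl cd]]] := rectifiable_lip md rg.
by rewrite lte_fin => le_; exists l, c; split => //; rewrite ?c0 ?cl.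
Qed.

End arclength.

(** * Norms of speeds *)

Section warping_norms.
Context {R : realType} (N : R * R -> R) (hN : warping_norm N).

Lemma warping_normD v w : N (v + w) <= N v + N w.
Proof. by case: hN => -[]. Qed.

Lemma warping_norm0 : N 0 = 0.
Proof. by case: hN => -[_ _ /(_ 0 0)] /=; rewrite !mul0r normr0 mul0r. Qed.

Lemma warping_normN v : N (- v) = N v.
Proof.
case: hN => -[_ _ /(_ (-1) v)] /=; rewrite !mulN1r normrN normr1 mul1r => <- _ _ _.
by case: v.
Qed.

Lemma warping_norm_ge0 v : 0 <= N v.
Proof.
by have := warping_normD v (- v); rewrite subrr warping_norm0 warping_normN; lra.
Qed.

Lemma warping_norm_le x y : N (x, y) <= `|x| + `|y|.
Proof.
case: hN => -[_ _ NZ] N1 N2 _.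
have -> : (x, y) = (x * 1, x * 0) + (y * 0, y * 1).
  by congr (_, _); rewrite /= ?mulr1 ?mulr0 ?addr0 ?add0r.
apply: le_trans (warping_normD _ _) _.
by rewrite (NZ x (1, 0)) (NZ y (0, 1)) N1 N2 !mulr1.
Qed.

Lemma warping_norm_ge1 x y : 0 <= x -> 0 <= y -> x <= N (x, y).
Proof.
case: hN => -[_ _ NZ] N1 _ Ninc x0 y0.
have E : x = N (x, 0).
  have := NZ x (1, 0); rewrite /= mulr1 mulr0 => ->.
  by rewrite N1 mulr1 ger0_norm.
by rewrite {1}E; apply: Ninc; rewrite ?lexx ?x0 ?y0.
Qed.

Lemma warping_norm_ge2 x y : 0 <= x -> 0 <= y -> y <= N (x, y).
Proof.
case: hN => -[_ _ NZ] _ N2 Ninc x0 y0.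
have E : y = N (0, y).
  have := NZ y (0, 1); rewrite /= mulr1 mulr0 => ->.
  by rewrite N2 mulr1 ger0_norm.
by rewrite {1}E; apply: Ninc; rewrite ?lexx ?x0 ?y0.
Qed.

Lemma warping_norm_lip v w : N v <= N w + `|v.1 - w.1| + `|v.2 - w.2|.
Proof.
have -> : v = w + (v - w) by rewrite addrC subrK.
apply: le_trans (warping_normD _ _) _; rewrite -addrA lerD2l.
have -> : w + (v - w) = v by rewrite addrC subrK.
exact: (warping_norm_le (v - w).1 (v - w).2).
Qed.

(** By the Lipschitz bound N is the infimum over rational points q of the functions
    (x, y) |-> N q + |x - q.1| + |y - q.2|. *)
Lemma measurable_warping_norm {d} {T : measurableType d} (D : set T) (f g : T -> R) :
  measurable_fun D f -> measurable_fun D g ->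
  measurable_fun D (fun t => N (f t, g t)).
Proof.
move=> mf mg.
pose q n : R * R := let r := odflt (0, 0) (unpickle n : option (rat * rat)) in
  (ratr r.1, ratr r.2).
pose F n t := N (q n) + `|f t - (q n).1| + `|g t - (q n).2|.
have F0 n t : 0 <= F n t by rewrite !addr_ge0// warping_norm_ge0.
have Flb t : has_lbound (range (F ^~ t)) by exists 0 => _ [n _ <-].
rewrite (_ : (fun t => N (f t, g t)) = (fun t => infs (F ^~ t) 0)).
  apply: measurable_fun_infs => // n.
  apply: measurable_funD; first apply: measurable_funD => //;
    by apply: measurableT_comp => //; apply: measurable_funB.
apply/funext => t; apply/eqP; rewrite eq_le; apply/andP; split.
  apply: lb_le_inf; first by exists (F 0%N t); exists 0%N.
  by move=> _ [n _ <-]; exact: warping_norm_lip.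
apply/ler_addgt0Pr => e e0; have e40 : 0 < e / 4 by rewrite divr_gt0.
have rd x : exists r : rat, `|x - ratr r| < e / 4.
  have : x - e / 4 < x + e / 4 by lra.
  move=> /rat_in_itvoo[r]; rewrite in_itv/= => /andP[? ?]; exists r.
  by rewrite ltr_norml; apply/andP; split; lra.
have [r1 h1] := rd (f t); have [r2 h2] := rd (g t).
apply: (@le_trans _ _ (F (pickle (r1, r2)) t)).
  by apply: ge_inf; [case: (Flb t) => m hm; exists m => _ [n _ <-]; apply: hm; exists n
                    |exists (pickle (r1, r2))].
rewrite /F /q pickleK /=.
have := warping_norm_lip (ratr r1, ratr r2) (f t, g t).
by rewrite /= ![`|ratr _ - _|]distrC; lra.
Qed.

End warping_norms.

(** * Reversing and joining curves *)

Section speed_bounds.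
Context {R : realType} {T : Type}.
Implicit Types (d : T -> T -> R) (g : R -> T) (a b s t : R).
Local Notation mu := (@lebesgue_measure R).

Definition ae_speed d a b g (h : R -> R) : Prop :=
  {ae mu, forall t, a < t < b -> has_speed d a b g t (h t)}.

(** The end points of the preimage of [a, b] under isom s e. *)
Definition isom_lo (s : bool) (e a b : R) : R := if s then a - e else e - b.
Definition isom_hi (s : bool) (e a b : R) : R := if s then b - e else e - a.

Lemma isom_itv (s : bool) e a b t :
  isom_lo s e a b <= t <= isom_hi s e a b ->
  a <= isom s e t <= b.
Proof. by rewrite /isom /isom_lo /isom_hi; case: s => /andP[? ?]; apply/andP; split; lra. Qed.

Lemma isom_itvoo (s : bool) e a b t :
  isom_lo s e a b < t < isom_hi s e a b ->
  a < isom s e t < b.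
Proof. by rewrite /isom /isom_lo /isom_hi; case: s => /andP[? ?]; apply/andP; split; lra. Qed.

Lemma ae_isom (s : bool) e (P : R -> Prop) : {ae mu, forall t, P t} ->
  {ae mu, forall t, P (isom s e t)}.
Proof.
move=> [M [mM M0 PM]]; exists (isom s e @^-1` M); split.
- by rewrite -[X in measurable X]setTI; exact: measurable_isom.
- by rewrite -M0; exact: lebesgue_isom.
- by move=> t /= nP; apply: PM => /=.
Qed.

Lemma ae_speed_isom d a b g h (s : bool) e : ae_speed d a b g h ->
  ae_speed d (isom_lo s e a b) (isom_hi s e a b)
    (g \o isom s e) (h \o isom s e).
Proof.
move=> /(ae_isom s e); apply: filterS; first exact: (ae_filter_ringOfSetsType mu).
move=> t H tab; have {}H := H (isom_itvoo tab).
move=> r r0; have [dl dl0 K] := H r r0; exists dl => // u uab utd.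
by rewrite /= -(isom_dist s e); apply: K; [exact: isom_itv|rewrite isom_dist].
Qed.

Lemma speed_bound_isom d a b g h (s : bool) e : pseudo d -> a <= b ->
  speed_bound d a b g h ->
  speed_bound d (isom_lo s e a b) (isom_hi s e a b)
    (g \o isom s e) (h \o isom s e).
Proof.
move=> pd ab [mh h0 hfin hd].
have mhE : measurable_fun [set: R] (EFin \o h) by apply/measurable_EFinP.
have E u v : (\int[mu]_(t in `[u, v]) (h t)%:E = \int[mu]_(t in
    `[isom_lo s e u v, isom_hi s e u v]) ((h \o isom s e) t)%:E)%E.
  rewrite (ge0_integral_isom s e)//; last 2 first.
  - exact: measurable_funTS.
  - by move=> t _; rewrite lee_fin.
  by rewrite isom_itvcc /isom_lo /isom_hi; case: s.
split.
- by apply: measurableT_comp => //; exact: measurable_isom.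
- by move=> t /=.
- by rewrite -E.
move=> x y ax xy yb.
have yab : a <= isom s e y <= b by apply: isom_itv; rewrite yb (le_trans ax).
have xab : a <= isom s e x <= b by apply: isom_itv; rewrite ax (le_trans xy).
rewrite /isom_lo /isom_hi in E ax yb *; case: s E ax yb xab yab => E ax yb /andP[x1 x2] /andP[y1 y2] /=.
  have xy' : isom true e x <= isom true e y by rewrite /isom lerD2r.
  apply: le_trans (hd _ _ x1 xy' y2) _; rewrite E.
  by rewrite /isom !addrK.
have yx' : isom false e y <= isom false e x by rewrite /isom lerD2r lerN2.
have -> : d (g (isom false e x)) (g (isom false e y)) =
  d (g (isom false e y)) (g (isom false e x)) by case: pd.
apply: le_trans (hd _ _ y1 yx' x2) _; rewrite E.
by rewrite /isom !opprD !opprK ![e + (_ - e)]addrC !subrK.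
Qed.

Lemma integral_eq_off_point (D : set R) (c : R) (f1 f2 : R -> \bar R) :
  (forall t, D t -> 0 <= f2 t)%E -> (forall t, D t -> t <> c -> f1 t = f2 t) ->
  (\int[mu]_(t in D) f1 t = \int[mu]_(t in D) f2 t)%E.
Proof.
move=> f20 f12; have mc : measurable ([set c] : set (measurableTypeR R)) by [].
exact: (ae_eq_integral_nomeas mc (lebesgue_measure_set1 c)).
Qed.

Definition join_at {V : Type} (b : R) (f1 f2 : R -> V) (t : R) : V :=
  if t <= b then f1 t else f2 t.

Lemma speed_bound_join d a b c g1 g2 h1 h2 : pseudo d -> a <= b -> b <= c ->
  g1 b = g2 b -> speed_bound d a b g1 h1 -> speed_bound d b c g2 h2 ->
  speed_bound d a c (join_at b g1 g2) (join_at b h1 h2).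
Proof.
move=> pd ab bc gb [mh1 h10 h1fin h1d] [mh2 h20 h2fin h2d].
have mh : measurable_fun [set: R] (join_at b h1 h2).
  apply: measurable_fun_ifT => //.
  by apply: measurable_fun_ler.
have h0 t : 0 <= join_at b h1 h2 t by rewrite /join_at; case: ifP.
have E1 s t : t <= b -> (\int[mu]_(x in `[s, t]) (join_at b h1 h2 x)%:E =
    \int[mu]_(x in `[s, t]) (h1 x)%:E)%E.
  move=> tb; apply: eq_integral => x; rewrite inE/= in_itv/= => /andP[_ xt].
  by rewrite /join_at (le_trans xt tb).
have E2 s t : b <= s -> (\int[mu]_(x in `[s, t]) (join_at b h1 h2 x)%:E =
    \int[mu]_(x in `[s, t]) (h2 x)%:E)%E.
  move=> bs; apply: (@integral_eq_off_point _ b) => x; first by rewrite lee_fin.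
  rewrite /= in_itv/= => /andP[sx _] xb.
  rewrite /join_at ifN// -ltNge lt_neqAle (le_trans bs sx) andbT.
  by apply/eqP => bx; apply: xb.
have mhE : measurable_fun [set: R] (EFin \o join_at b h1 h2) by apply/measurable_EFinP.
have hE0 t : (0 <= (join_at b h1 h2 t)%:E)%E by rewrite lee_fin.
split => //.
  by rewrite (integral_itv_split ab bc)// E1// E2// lte_add_pinfty.
move=> s t as_ st tc.
have [tb|bt] := leP t b.
  by rewrite /join_at tb (le_trans st tb) E1//; exact: h1d.
have [sb|bs] := leP s b; last first.
  rewrite /join_at !ifN -?ltNge// E2; last exact: ltW.
  by apply: h2d => //; exact: ltW.
rewrite /join_at sb ifN -?ltNge//.
rewrite (integral_itv_split sb (ltW bt))// E1// E2//.
have [_ _ dt] := pd; apply: (@le_trans _ _ ((d (g1 s) (g1 b))%:E + (d (g2 b) (g2 t))%:E)%E).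
  by rewrite -EFinD lee_fin gb.
by rewrite leeD// ?h1d// h2d// ltW.
Qed.

Lemma ae_speed_join d a b c g1 g2 h1 h2 : a <= b -> b <= c ->
  g1 b = g2 b -> ae_speed d a b g1 h1 -> ae_speed d b c g2 h2 ->
  ae_speed d a c (join_at b g1 g2) (join_at b h1 h2).
Proof.
move=> ab bc gb H1 H2.
have Hb : {ae mu, forall t, t != b}.
  exists [set b]; split => //; first exact: lebesgue_measure_set1.
  by move=> t /= /negP; rewrite negbK => /eqP.
move: H1 H2 Hb; apply: filterS3; first exact: (ae_filter_ringOfSetsType mu).
move=> t H1 H2 tb /andP[at_ tc] e e0.
have [tb'|bt] := ltP t b.
  have [|dl dl0 K] := H1 _ e e0; first by rewrite at_.
  exists (Num.min dl (b - t)); first by rewrite lt_min dl0 subr_gt0.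
  move=> u /andP[au uc]; rewrite lt_min => /andP[utd utb].
  have ub : u <= b by have := ler_norm (u - t); lra.
  by rewrite /join_at ub (ltW tb'); apply: K => //; rewrite au.
have {}bt : b < t by rewrite lt_neqAle eq_sym tb.
have [|dl dl0 K] := H2 _ e e0; first by rewrite bt.
exists (Num.min dl (t - b)); first by rewrite lt_min dl0 subr_gt0.
move=> u /andP[au uc]; rewrite lt_min => /andP[utd utb].
have bu : b < u by have := ler_norm (t - u); rewrite distrC; lra.
by rewrite /join_at !ifN -?ltNge//; apply: K => //; rewrite (ltW bu).
Qed.

End speed_bounds.

Arguments hval {R} t : simpl never.

Section speed_comparison.
Context {R : realType}.
Local Notation mu := (@lebesgue_measure R).

Lemma has_speed_mono_near {T T' : Type} (d : T -> T -> R) (d' : T' -> T' -> R)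
    (a b t v v' K : R) (g : R -> T) (g' : R -> T') :
  0 <= K -> a < t < b -> has_speed d a b g t v -> has_speed d' a b g' t v' ->
  (exists2 dl, 0 < dl & forall u, a <= u <= b -> `|u - t| < dl ->
    d' (g' u) (g' t) <= K * d (g u) (g t)) -> v' <= K * v.
Proof.
move=> K0 /andP[at_ tb] H H' [dn dn0 dd']; apply/ler_addgt0Pr => e e0.
have K10 : 0 < K + 1 by lra.
have e'0 : 0 < e / (K + 1) by rewrite divr_gt0.
have [dl dl0 Hu] := H _ e'0; have [dl' dl'0 Hu'] := H' _ e'0.
pose m := Num.min (Num.min (dl / 2) (dl' / 2)) (Num.min (dn / 2) (b - t)).
have m0 : 0 < m by rewrite !lt_min !divr_gt0// subr_gt0.
have m1 : m <= dl / 2 by rewrite /m !ge_min lexx.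
have m2 : m <= dl' / 2 by rewrite /m !ge_min lexx orbT.
have m3 : m <= b - t by rewrite /m !ge_min lexx !orbT.
have m4 : m <= dn / 2 by rewrite /m !ge_min lexx !orbT.
have tm : a <= t + m <= b by apply/andP; split; lra.
have := Hu _ tm; have := Hu' _ tm; have := dd' _ tm.
rewrite addrAC subrr add0r gtr0_norm//.
have -> : m < dn by lra. have -> : m < dl' by lra. have -> : m < dl by lra.
move=> /(_ isT) D /(_ isT) + /(_ isT); rewrite !ler_norml => /andP[L1 _] /andP[_ L2].
have eE : e = e / (K + 1) * (K + 1) by rewrite divfK// gt_eqF.
set q := e / (K + 1) in L1 L2 eE.
have L2' : K * d (g (t + m)) (g t) <= K * (v * m + q * m).
  by rewrite ler_wpM2l//; lra.
by rewrite -(ler_pM2r m0) eE; lra.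
Qed.

Lemma has_speed_mono {T T' : Type} (d : T -> T -> R) (d' : T' -> T' -> R)
    (a b t v v' K : R) (g : R -> T) (g' : R -> T') :
  0 <= K -> a < t < b -> has_speed d a b g t v -> has_speed d' a b g' t v' ->
  (forall u, a <= u <= b -> d' (g' u) (g' t) <= K * d (g u) (g t)) -> v' <= K * v.
Proof.
move=> K0 atb H H' dd'; apply: (has_speed_mono_near K0 atb H H').
by exists 1 => // u aub _; exact: dd'.
Qed.

End speed_comparison.

(** * The warped pseudodistance *)

Section warped_distance.
Context {R : realType} (N : R * R -> R) (w : R -> {nonneg R}) (Y : mmdata R)
        (phi : @halfline R -> {nonneg R}) (Phi : R -> R).
Local Notation mu := (@lebesgue_measure R).
Local Notation Hl := (@whalfline R w).

(** Phi is the warping function phi read on the line, where it can be integrated. *)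
Record warping : Prop := Warping {
  warping_N : warping_norm N ;
  warping_dY : is_metric (dist Y) ;
  warping_lY : length_space (dist Y) ;
  warping_phiE : forall x, (phi x)%:num = Phi (hval x) ;
  warping_measurable : measurable_fun [set: R] Phi ;
  warping_nd : forall s t, 0 <= s -> s <= t -> Phi s <= Phi t ;
  warping_gt0 : forall t, 0 < t -> 0 < Phi t }.

Hypothesis W : warping.

Let pdX : pseudo (dist Hl).
Proof.
split => [x|x y|x y z] /=; first by rewrite subrr normr0.
- by rewrite distrC.
- exact: ler_distD.
Qed.

Lemma metric_pseudo {T : Type} (d : T -> T -> R) : is_metric d -> pseudo d.
Proof. by move=> [d0 ds dt]; split => // x; exact/d0. Qed.

Let pdY : pseudo (dist Y). Proof. exact/metric_pseudo/warping_dY. Qed.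

Lemma warping_ge0 t : 0 <= t -> 0 <= Phi t.
Proof.
move=> t0; have := warping_phiE W (NngNum t0); rewrite /hval /= => <-.
exact: ge0.
Qed.

Lemma hval_ge0 (x : @halfline R) : 0 <= hval x. Proof. by rewrite /hval; exact: (ge0 (x : {nonneg R})). Qed.

(** The integrand of the warped length, with densities in place of the speeds. *)
Definition wspeed (g : R -> Hl * Y) (hX hY : R -> R) (t : R) : R :=
  N (hX t, (phi (g t).1)%:num * hY t).

Definition wlen a b g hX hY : \bar R := (\int[mu]_(t in `[a, b]) (wspeed g hX hY t)%:E)%E.

(** A curve of warped length l from z to z'. The densities of its two speeds are part of
    the data, so that reversing and joining curves acts on them by substitution. *)
Definition wseg (z z' : Hl * Y) (l : \bar R) : Prop :=
  exists a b g hX hY,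
    [/\ a <= b /\ g a = z /\ g b = z',
        speed_bound (dist Hl) a b (fst \o g) hX /\ ae_speed (dist Hl) a b (fst \o g) hX,
        speed_bound (dist Y) a b (snd \o g) hY /\ ae_speed (dist Y) a b (snd \o g) hY &
        l = wlen a b g hX hY].

Lemma wspeed_ge0 g hX hY t : 0 <= wspeed g hX hY t.
Proof. exact/warping_norm_ge0/warping_N. Qed.

Lemma measurable_fst_curve a b (g : R -> Hl * Y) hX : a <= b ->
  speed_bound (dist Hl) a b (fst \o g) hX ->
  measurable_fun `[a, b] (fun t => hval (g t).1).
Proof.
move=> ab sb; have [[[_ gp] _] _] := ac_path_of_bound pdX ab sb.
apply: subspace_continuous_measurable_fun; first exact: measurable_itv.
apply/subspace_continuousP => t; rewrite /= in_itv/= => /gp /cvgrPdist_lt H.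
apply/cvgrPdist_lt => e /H; apply: filterS => u.
by rewrite /= sub0r normrN normr_id distrC.
Qed.

Lemma measurable_wspeed a b g hX hY : a <= b ->
  speed_bound (dist Hl) a b (fst \o g) hX ->
  speed_bound (dist Y) a b (snd \o g) hY ->
  measurable_fun `[a, b] (EFin \o wspeed g hX hY).
Proof.
move=> ab sX sY; apply/measurable_EFinP; apply: (measurable_warping_norm (warping_N W)).
  by have [mh _ _ _] := sX; exact: measurable_funTS.
apply: measurable_funM; last by have [mh _ _ _] := sY; exact: measurable_funTS.
have -> : (fun t => (phi (g t).1)%:num) = Phi \o (fun t => hval (g t).1).
  by apply/funext => t; rewrite /= (warping_phiE W).
apply: measurableT_comp; first exact: warping_measurable W.
exact: measurable_fst_curve sX.
Qed.

Lemma ac_wseg a b (g : R -> Hl * Y) : ac_path (@dist_l1 R Hl Y) a b g ->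
  exists hX hY,
    [/\ speed_bound (dist Hl) a b (fst \o g) hX, ae_speed (dist Hl) a b (fst \o g) hX,
        speed_bound (dist Y) a b (snd \o g) hY & ae_speed (dist Y) a b (snd \o g) hY].
Proof.
move=> acg.
have pdl : pseudo (@dist_l1 R Hl Y).
  have [x0 xs xt] := pdX; have [y0 ys yt] := pdY.
  split => [z|z z'|z z' z'']; rewrite /dist_l1; first by rewrite x0 y0 addr0.
  - by rewrite xs ys.
  - by rewrite addrACA lerD.
have ab : a <= b by case: acg => -[[]].
have [h [mh h0 hfin hd] _] := ac_path_speed pdl acg.
have sX : speed_bound (dist Hl) a b (fst \o g) h.
  split => // s t as_ st tb; apply: le_trans (hd _ _ as_ st tb).
  by rewrite lee_fin /dist_l1 lerDl pseudo_ge0.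
have sY : speed_bound (dist Y) a b (snd \o g) h.
  split => // s t as_ st tb; apply: le_trans (hd _ _ as_ st tb).
  by rewrite lee_fin /dist_l1 lerDr pseudo_ge0.
have [hX bX aX] := ac_path_speed pdX (ac_path_of_bound pdX ab sX).
have [hY bY aY] := ac_path_speed pdY (ac_path_of_bound pdY ab sY).
by exists hX, hY.
Qed.

Lemma wseg_ac a b (g : R -> Hl * Y) hX hY : a <= b ->
  speed_bound (dist Hl) a b (fst \o g) hX -> speed_bound (dist Y) a b (snd \o g) hY ->
  ac_path (@dist_l1 R Hl Y) a b g.
Proof.
move=> ab [mX X0 Xf Xd] [mY Y0 Yf Yd].
have pdl : pseudo (@dist_l1 R Hl Y).
  have [x0 xs xt] := pdX; have [y0 ys yt] := pdY.
  split => [z|z z'|z z' z'']; rewrite /dist_l1; first by rewrite x0 y0 addr0.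
  - by rewrite xs ys.
  - by rewrite addrACA lerD.
have E s t : (\int[mu]_(x in `[s, t]) (hX x + hY x)%:E =
    \int[mu]_(x in `[s, t]) (hX x)%:E + \int[mu]_(x in `[s, t]) (hY x)%:E)%E.
  under eq_integral do rewrite EFinD.
  rewrite ge0_integralD//.
  - by move=> x _; rewrite lee_fin.
  - by apply/measurable_EFinP; exact: measurable_funTS.
  - by move=> x _; rewrite lee_fin.
  - by apply/measurable_EFinP; exact: measurable_funTS.
apply: (ac_path_of_bound (h := fun t => hX t + hY t) pdl ab); split.
- exact: measurable_funD.
- by move=> t; rewrite addr_ge0.
- by rewrite E lte_add_pinfty.
- by move=> s t as_ st tb; rewrite E /dist_l1 EFinD leeD ?Xd// Yd.
Qed.

Lemma warped_lenE a b (g : R -> Hl * Y) hX hY :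
  ae_speed (dist Hl) a b (fst \o g) hX -> ae_speed (dist Y) a b (snd \o g) hY ->
  @warped_len R N Hl Y phi a b g = wlen a b g hX hY.
Proof.
move=> aX aY; have FF := ae_filter_ringOfSetsType mu.
have [M [mM M0 HM]] : exists M : set (measurableTypeR R), [/\ measurable M, mu M = 0%E &
    forall t, a <= t <= b -> ~ M t -> [/\ a < t < b, has_speed (dist Hl) a b (fst \o g) t (hX t) &
      has_speed (dist Y) a b (snd \o g) t (hY t)]].
  apply: ae_open_itv; move: aX aY; apply: filterS2 => t sX sY tab.
  by split => //; [exact: sX|exact: sY].
apply: (ae_eq_integral_nomeas mM M0).
  by move=> t _; rewrite lee_fin wspeed_ge0.
move=> t; rewrite /= in_itv/= => tab Mt; have [tab' sX sY] := HM t tab Mt.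
by rewrite (has_speed_speed tab' sX) (has_speed_speed tab' sY).
Qed.

(** A path is absolutely continuous for the l1 distance iff both components are. *)
Lemma warped_pdistE z z' :
  @warped_pdist R N Hl Y phi z z' = fine (ereal_inf [set l | wseg z z' l]).
Proof.
rewrite /warped_pdist; congr (fine (ereal_inf _)); apply/seteqP; split => l.
  move=> [a [b [g [acg ga gb ->]]]]; have [hX [hY [bX aX bY aY]]] := ac_wseg acg.
  have ab : a <= b by case: acg => -[[]].
  by exists a, b, g, hX, hY; split => //; exact: warped_lenE.
move=> [a [b [g [hX [hY [[ab [ga gb]] [bX aX] [bY aY] ->]]]]]].
exists a, b, g; split => //; first exact: wseg_ac bX bY.
by rewrite (warped_lenE aX aY).
Qed.

Lemma wseg_sym z z' l : wseg z z' l -> wseg z' z l.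
Proof.
move=> [a [b [g [hX [hY [[ab [ga gb]] [bX aX] [bY aY] ->]]]]]].
have lo : isom_lo false (a + b) a b = a by rewrite /isom_lo addrK.
have hi : isom_hi false (a + b) a b = b by rewrite /isom_hi addrAC subrr add0r.
exists a, b, (g \o isom false (a + b)), (hX \o isom false (a + b)), (hY \o isom false (a + b)).
split.
- by rewrite /isom /= addrA [- a + a]addNr add0r addrCA addNr addr0.
- have := speed_bound_isom false (a + b) pdX ab bX.
  by have := ae_speed_isom false (a + b) aX; rewrite lo hi.
- have := speed_bound_isom false (a + b) pdY ab bY.
  by have := ae_speed_isom false (a + b) aY; rewrite lo hi.
rewrite /wlen (ge0_integral_isom false (a + b))//.
- by rewrite isom_itvcc /= addrK addrAC subrr add0r.
- exact: measurable_wspeed.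
- by move=> t _; rewrite lee_fin wspeed_ge0.
Qed.

Lemma integral_itv_split_in (f : R -> \bar R) (a s b : R) : a <= s -> s <= b ->
  measurable_fun `[a, b] f -> (forall t, 0 <= f t)%E ->
  (\int[mu]_(t in `[a, b]) f t =
    \int[mu]_(t in `[a, s]) f t + \int[mu]_(t in `[s, b]) f t)%E.
Proof.
move=> as_ sb mf f0.
have P u v : a <= u -> v <= b -> (\int[mu]_(t in `[u, v]) (f \_ `[a, b]) t =
    \int[mu]_(t in `[u, v]) f t)%E.
  move=> au vb; apply: eq_integral => t; rewrite inE /= in_itv/= => /andP[ut tv].
  by rewrite patchE mem_set//= in_itv/= (le_trans au)//= (le_trans tv).
rewrite -P// -[X in _ = (X + _)%E]P// -[X in _ = (_ + X)%E]P//.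
apply: integral_itv_split => //.
- by apply/(measurable_restrictT _ _).1.
- by move=> t; apply: erestrict_ge0 => x _.
Qed.

Lemma wseg_trans z z' z'' l1 l2 : wseg z z' l1 -> wseg z' z'' l2 -> wseg z z'' (l1 + l2)%E.
Proof.
move=> [a [b [g [hX [hY [[ab [ga gb]] [bX aX] [bY aY] ->]]]]]].
move=> [c [e [g' [hX' [hY' [[ce [gc ge]] [bX' aX'] [bY' aY'] ->]]]]]].
pose r := c - b.
have lo : isom_lo true r c e = b by rewrite /isom_lo /r opprB addrC subrK.
pose f := isom_hi true r c e.
have fE : isom_hi true r c e = f by [].
have bf : b <= f by rewrite /f /isom_hi /r; lra.
have bX2 := speed_bound_isom true r pdX ce bX'; rewrite lo fE in bX2.
have bY2 := speed_bound_isom true r pdY ce bY'; rewrite lo fE in bY2.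
have aX2 := ae_speed_isom true r aX'; rewrite lo fE in aX2.
have aY2 := ae_speed_isom true r aY'; rewrite lo fE in aY2.
have rb : isom true r b = c by rewrite /isom /r addrC subrK.
have rf : isom true r f = e by rewrite /isom /f /isom_hi subrK.
pose G := join_at b g (g' \o isom true r).
pose HX := join_at b hX (hX' \o isom true r).
pose HY := join_at b hY (hY' \o isom true r).
have GX : fst \o G = join_at b (fst \o g) (fst \o g' \o isom true r).
  by apply/funext => t; rewrite /G /join_at /=; case: ifP.
have GY : snd \o G = join_at b (snd \o g) (snd \o g' \o isom true r).
  by apply/funext => t; rewrite /G /join_at /=; case: ifP.
have sX : speed_bound (dist Hl) a f (fst \o G) HX.
  by rewrite GX; apply: speed_bound_join => //=; rewrite rb gb gc.
have sY : speed_bound (dist Y) a f (snd \o G) HY.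
  by rewrite GY; apply: speed_bound_join => //=; rewrite rb gb gc.
exists a, f, G, HX, HY; split.
- split; [exact: le_trans bf|split; first by rewrite /G /join_at ab].
  have [fb|bf'] := leP f b; last by rewrite /G /join_at ifN -?ltNge//= rf.
  have fb' : f = b by apply/eqP; rewrite eq_le fb.
  by rewrite /G /join_at fb' lexx gb -gc -ge -rb -rf fb'.
- by split => //; rewrite GX; apply: ae_speed_join => //=; rewrite rb gb gc.
- by split => //; rewrite GY; apply: ae_speed_join => //=; rewrite rb gb gc.
have mW : measurable_fun `[a, f] (EFin \o wspeed G HX HY).
  by apply: measurable_wspeed => //; exact: le_trans bf.
rewrite /wlen (integral_itv_split_in ab bf mW); last by move=> t; rewrite lee_fin wspeed_ge0.
congr (_ + _)%E.
  apply: eq_integral => t; rewrite inE/= in_itv/= => /andP[_ tb].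
  by rewrite /wspeed /G /HX /HY /join_at tb.
rewrite (ge0_integral_isom true r); first last.
- by move=> t _; rewrite lee_fin wspeed_ge0.
- exact: measurable_wspeed.
- exact: measurable_itv.
rewrite isom_itvcc.
have -> : c - r = b by rewrite /r opprB addrC subrK.
apply/esym; apply: (@integral_eq_off_point _ _ b) => t; first by rewrite lee_fin wspeed_ge0.
rewrite /= in_itv/= => /andP[bt _] tb.
have tb' : (t <= b) = false.
  by apply/negP => tb'; apply: tb; apply/eqP; rewrite eq_le tb'.
by rewrite /wspeed /G /HX /HY /join_at tb'.
Qed.

(** Total in t, by reflection of the negative heights. *)
Definition hpt (t : R) : @halfline R := NngNum (normr_ge0 t).

Lemma hvalK t : 0 <= t -> hval (hpt t) = t.
Proof. by move=> t0; rewrite /hval /= ger0_norm. Qed.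

Lemma hptK (x : @halfline R) : hpt (hval x) = x.
Proof. by apply: val_inj; rewrite /= ger0_norm//; exact: hval_ge0. Qed.

Lemma integral_itv_cst (a b r : R) : a <= b ->
  (\int[mu]_(t in `[a, b]) r%:E = (r * (b - a))%:E)%E.
Proof.
move=> ab; rewrite integral_cst//.
rewrite [X in (_ * X)%E]lebesgue_measure_itv/= lte_fin; case: ltP => ba.
  by rewrite -EFinD -EFinM.
have -> : b = a by apply/eqP; rewrite eq_le ab ba.
by rewrite subrr mulr0 mule0.
Qed.

Lemma speed_bound_lip {T : Type} (d : T -> T -> R) a b g K : a <= b -> 0 <= K ->
  (forall s t, a <= s -> s <= t -> t <= b -> d (g s) (g t) <= K * (t - s)) ->
  speed_bound d a b g (fun=> K).
Proof.
move=> ab K0 H; split => //; first by rewrite integral_itv_cst// ltry.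
by move=> s t as_ st tb; rewrite integral_itv_cst// lee_fin; exact: H.
Qed.

Lemma wseg_vertical (x x' : @halfline R) (y : Y) : hval x <= hval x' ->
  wseg (x, y) (x', y) (hval x' - hval x)%:E.
Proof.
move=> xx'; have [d0 _ _] := pdY; have x0 := hval_ge0 x.
exists (hval x), (hval x'), (fun t => (hpt t, y)), (fun=> 1), (fun=> 0); split.
- by rewrite !hptK.
- split.
    apply: speed_bound_lip => // s t xs st tx'.
    change (`|hval (hpt s) - hval (hpt t)| <= 1 * (t - s)).
    by rewrite !hvalK; [rewrite distrC ger0_norm ?mul1r ?subr_ge0|lra|lra].
  apply: aeW => t /andP[xt tx'] e e0; exists 1 => // u /andP[xu ux'] _.
  change (`| `|hval (hpt u) - hval (hpt t)| - 1 * `|u - t| | <= e * `|u - t|).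
  rewrite !hvalK; [|lra|lra].
  by rewrite mul1r subrr normr0 mulr_ge0// ltW.
- split.
    by apply: speed_bound_lip => // s t xs st tx'; rewrite /= d0 mul0r.
  apply: aeW => t _ e e0; exists 1 => // u _ _.
  by rewrite /= d0 mul0r subrr normr0 mulr_ge0// ltW.
rewrite /wlen; under eq_integral do rewrite /wspeed mulr0.
by case: (warping_N W) => _ -> _ _; rewrite integral_itv_cst// mul1r.
Qed.

(** At a fixed height the norm of the speeds is Phi times the speed in Y, which is at most
    1 for a parametrization by arc length. *)
Lemma wseg_horizontal (x : @halfline R) (y y' : Y) e : 0 < e ->
  exists2 l : R, l <= Phi (hval x) * (dist Y y y' + e) & wseg (x, y) (x, y') l%:E.
Proof.
move=> e0; have [d0 _ _] := pdX; have P0 := warping_ge0 (hval_ge0 x).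
have [l [c [ld l0 c0 cl clip]]] := length_space_lip y y' (warping_dY W) (warping_lY W) e0.
have bc : speed_bound (dist Y) 0 l c (fun=> 1).
  by apply: speed_bound_lip => // s t; rewrite mul1r; exact: clip.
have [h bh ah] := ac_path_speed pdY (ac_path_of_bound pdY l0 bc).
have bX : speed_bound (dist Hl) 0 l (fst \o (fun t => (x, c t))) (fun=> 0).
  by apply: speed_bound_lip => // s t ? ? ?; rewrite [dist _ _ _]d0 mul0r.
pose L := wlen 0 l (fun t => (x, c t)) (fun=> 0) h.
have wE : (L <= (Phi (hval x) * l)%:E)%E.
  rewrite -[X in (_ * X)%R]subr0 -integral_itv_cst//.
  have [M [mM M0 HM]] : exists M : set (measurableTypeR R), [/\ measurable M, mu M = 0%E &
      forall t, 0 <= t <= l -> ~ M t -> 0 < t < l /\ has_speed (dist Y) 0 l c t (h t)].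
    apply: ae_open_itv; move: ah.
    by apply: filterS => [|t H tl]; [exact: (ae_filter_ringOfSetsType mu)|split => //; exact: H].
  apply: (ge0_ae_le_integral_nomeas mM M0).
  - by move=> t _; rewrite lee_fin wspeed_ge0.
  - by move=> t _; rewrite lee_fin.
  move=> t; rewrite /= in_itv/= => t0l Mt; have [tb sp] := HM t t0l Mt; have /andP[t0 tl] := t0l.
  have ht1 : h t <= 1 * 1.
    apply: (@has_speed_mono R R Y (fun u v => `|u - v|) (dist Y) 0 l t 1 (h t) 1 id c) => //.
      by move=> r r0; exists 1 => // u _ _; rewrite mul1r subrr normr0 mulr_ge0// ltW.
    move=> u /andP[u0 ul]; rewrite mul1r; have [ut|tu] := leP u t.
      by rewrite distrC ger0_norm ?subr_ge0//; exact: clip.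
    have -> : dist Y (c u) (c t) = dist Y (c t) (c u) by case: pdY.
    by rewrite gtr0_norm ?subr_gt0//; apply: clip => //; exact: ltW.
  rewrite lee_fin /wspeed /=.
  case: (warping_N W) => -[_ _ NZ] _ N2 _.
  have -> : (0, (phi x)%:num * h t) = (((phi x)%:num * h t) * 0, ((phi x)%:num * h t) * 1).
    by rewrite mulr0 mulr1.
  rewrite (NZ _ (0, 1)) N2 mulr1 (warping_phiE W).
  have [_ h0 _ _] := bh; rewrite ger0_norm ?mulr_ge0//.
  by rewrite -[leRHS]mulr1 ler_wpM2l// -[1]mulr1.
have w0 : (0 <= L)%E.
  by apply: integral_ge0 => t _; rewrite lee_fin wspeed_ge0.
have wf : L \is a fin_num.
  by rewrite ge0_fin_numE//; apply: le_lt_trans wE _; exact: ltry.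
exists (fine L).
  rewrite -lee_fin fineK//; apply: le_trans wE _; rewrite lee_fin ler_wpM2l//.
  exact: ltW.
rewrite fineK//; exists 0, l, (fun t => (x, c t)), (fun=> 0), h; split => //.
- by rewrite c0 cl.
- split => //; apply: aeW => t _ r r0; exists 1 => // u _ _.
  by rewrite [dist _ _ _]d0 mul0r subrr normr0 mulr_ge0// ltW.
Qed.

Lemma wseg_ge0 z z' l : wseg z z' l -> (0 <= l)%E.
Proof.
move=> [a [b [g [hX [hY [_ _ _ ->]]]]]].
by apply: integral_ge0 => t _; rewrite lee_fin wspeed_ge0.
Qed.

Lemma wseg_vertical_sym (x x' : @halfline R) (y : Y) :
  wseg (x, y) (x', y) `|hval x - hval x'|%:E.
Proof.
have [xx'|x'x] := leP (hval x) (hval x').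
  by rewrite distrC ger0_norm ?subr_ge0//; exact: wseg_vertical.
by rewrite gtr0_norm ?subr_gt0//; apply/wseg_sym/wseg_vertical/ltW.
Qed.

Local Notation wd := (@warped_pdist R N Hl Y phi).

Lemma pdist_inf z z' : ((wd z z')%:E = ereal_inf [set l | wseg z z' l])%E.
Proof.
rewrite warped_pdistE fineK// ge0_fin_numE; last first.
  by apply: le_ereal_inf_tmp => l; exact: wseg_ge0.
case: z z' => [x y] [x' y'].
have [l _ hl] := wseg_horizontal x' y y' ltr01.
apply: (@le_lt_trans _ _ (`|hval x - hval x'|%:E + l%:E)%E); last first.
  by rewrite -EFinD ltry.
by apply: ereal_inf_lbound; exact: wseg_trans (wseg_vertical_sym x x' y) hl.
Qed.

Lemma pdist_le z z' l : wseg z z' l -> ((wd z z')%:E <= l)%E.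
Proof. by move=> h; rewrite pdist_inf; exact: ereal_inf_lbound. Qed.

Lemma pdist_adherent z z' e : 0 < e -> exists2 l, wseg z z' l & (l < (wd z z' + e)%:E)%E.
Proof.
move=> e0.
have : ereal_inf [set l | wseg z z' l] \is a fin_num by rewrite -pdist_inf.
by move=> /(lb_ereal_inf_adherent e0)[l hl]; rewrite -pdist_inf -EFinD; exists l.
Qed.

Lemma pdist_pseudo : pseudo wd.
Proof.
have wd0 z z' : 0 <= wd z z'.
  by rewrite -lee_fin pdist_inf; apply: le_ereal_inf_tmp => l; exact: wseg_ge0.
split.
- move=> [x y]; apply/eqP; rewrite eq_le wd0 andbT -lee_fin.
  by apply: pdist_le; have := wseg_vertical_sym x x y; rewrite subrr normr0.
- move=> z z'; apply: EFin_inj; rewrite !pdist_inf; congr ereal_inf.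
  by apply/seteqP; split => l /=; exact: wseg_sym.
move=> z z' z''; apply/ler_addgt0Pr => e e0; have e20 : 0 < e / 2 by rewrite divr_gt0.
have [l1 h1 le1] := pdist_adherent z z' e20; have [l2 h2 le2] := pdist_adherent z' z'' e20.
rewrite -lee_fin; apply: le_trans (pdist_le (wseg_trans h1 h2)) _.
apply: (@le_trans _ _ ((wd z z' + e / 2)%:E + (wd z' z'' + e / 2)%:E)%E).
  by apply: leeD; exact: ltW.
by rewrite -EFinD lee_fin; lra.
Qed.

Lemma pdist_vertical_le (x x' : @halfline R) (y : Y) :
  wd (x, y) (x', y) <= `|hval x - hval x'|.
Proof. by rewrite -lee_fin; apply: pdist_le; exact: wseg_vertical_sym. Qed.

Lemma pdist_horizontal_le (x : @halfline R) (y y' : Y) :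
  wd (x, y) (x, y') <= Phi (hval x) * dist Y y y'.
Proof.
have P0 := warping_ge0 (hval_ge0 x).
apply/ler_addgt0Pr => e e0; have e'0 : 0 < e / (Phi (hval x) + 1) by rewrite divr_gt0//; lra.
have [l le_ hl] := wseg_horizontal x y y' e'0.
rewrite -lee_fin; apply: le_trans (pdist_le hl) _; rewrite lee_fin.
apply: le_trans le_ _; rewrite mulrDr lerD2l mulrCA ler_piMr ?(ltW e0)//.
by rewrite ler_pdivrMr; lra.
Qed.

(** A curve cannot leave a strip narrower than its length. *)
Lemma wseg_height a b g hX hY s : a <= s -> s <= b ->
  speed_bound (dist Hl) a b (fst \o g) hX -> speed_bound (dist Y) a b (snd \o g) hY ->
  (`|hval (g a).1 - hval (g s).1|%:E <= wlen a b g hX hY)%E.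
Proof.
move=> as_ sb bX bY; have [mX X0 Xf Xd] := bX; have [mY Y0 Yf Yd] := bY.
apply: (le_trans (Xd a s (lexx a) as_ sb)).
apply: (@le_trans _ _ (\int[mu]_(x in `[a, b]) (hX x)%:E)%E).
  by apply: le_integral_itv => //; apply/measurable_EFinP.
apply: ge0_le_integral => //.
- by move=> t _; rewrite lee_fin.
- by apply/measurable_EFinP; exact: measurable_funTS.
- by apply: measurable_wspeed => //; exact: le_trans sb.
- move=> t _; rewrite lee_fin; apply: (warping_norm_ge1 (warping_N W)) => //.
  by rewrite mulr_ge0.
Qed.

Lemma pdist_ge z z' : `|hval z.1 - hval z'.1| <= wd z z'.
Proof.
rewrite -lee_fin pdist_inf; apply: le_ereal_inf_tmp => l.
move=> [a [b [g [hX [hY [[ab [ga gb]] [bX _] [bY _] ->]]]]]].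
by rewrite -ga -gb; exact: wseg_height.
Qed.

(** A curve shorter than e stays at heights where Phi >= m, so that its length is at least
    m times that of its component in Y. *)
Lemma pdist_lower z z' e m : wd z z' < e -> 0 <= m ->
  (forall t, 0 <= t -> hval z.1 - e <= t -> m <= Phi t) ->
  m * dist Y z.2 z'.2 <= wd z z'.
Proof.
move=> ze P0 mP; have e0 : 0 < e by apply: le_lt_trans ze; apply: pseudo_ge0 pdist_pseudo.
apply/ler_addgt0Pr => r r0.
have rr0 : 0 < Num.min r (e - wd z z') by rewrite lt_min r0 subr_gt0.
have [_ [a [b [g [hX [hY [[ab [ga gb]] [bX _] [bY _] ->]]]]]] lt_] := pdist_adherent z z' rr0.
have wr : (wlen a b g hX hY <= (wd z z' + r)%:E)%E.
  by apply: le_trans (ltW lt_) _; rewrite lee_fin lerD2l ge_min lexx.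
have we : (wlen a b g hX hY < e%:E)%E.
  by apply: lt_le_trans lt_ _; rewrite lee_fin -lerBrDl ge_min lexx orbT.
have [mX X0 Xf Xd] := bX; have [mY Y0 Yf Yd] := bY.
rewrite -lee_fin; apply: le_trans wr.
apply: (@le_trans _ _ (m%:E * \int[mu]_(t in `[a, b]) (hY t)%:E)%E).
  by rewrite EFinM lee_wpmul2l ?lee_fin// -ga -gb; exact: Yd.
rewrite -ge0_integralZl//; last 2 first.
- by apply/measurable_EFinP; exact: measurable_funTS.
- by move=> t _; rewrite lee_fin.
apply: ge0_le_integral => //.
- by move=> t _; rewrite -EFinM lee_fin mulr_ge0.
- by apply/measurable_EFinP; apply: measurable_funM => //; exact: measurable_funTS.
- exact: measurable_wspeed.
move=> t; rewrite /= in_itv/= => /andP[at_ tb]; rewrite -EFinM lee_fin.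
apply: (@le_trans _ _ ((phi (g t).1)%:num * hY t)); last first.
  by apply: (warping_norm_ge2 (warping_N W)) => //; rewrite mulr_ge0.
rewrite ler_wpM2r// (warping_phiE W) mP ?hval_ge0//.
have := wseg_height at_ tb bX bY => /le_lt_trans /(_ we); rewrite lte_fin ga.
by rewrite ltr_norml => /andP[? ?]; lra.
Qed.

(** * The quotient *)

Local Notation H := (@warped R N Hl Y phi).

(** Coordinates on the quotient. The fibre coordinate wfib is meaningful at positive
    heights only, since the fibre at height 0 may collapse to a point. *)
Definition wpt (t : R) (y : Y) : H := @warped_proj R N Hl Y phi (hpt t, y).
Definition wht (P : H) : R := hval (warped_repr P).1.
Definition wfib (P : H) : Y := (warped_repr P).2.

Lemma warped_reprK (P : H) : @warped_proj R N Hl Y phi (warped_repr P) = P.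
Proof.
apply: val_inj; rewrite /= /warped_repr.
by case: cid2 => z /= _.
Qed.

Lemma wptK (P : H) : wpt (wht P) (wfib P) = P.
Proof. by rewrite /wpt /wht /wfib hptK -surjective_pairing warped_reprK. Qed.

Lemma pdist_repr z : wd z (warped_repr (@warped_proj R N Hl Y phi z)) = 0.
Proof.
have [wd0 _ _] := pdist_pseudo.
have := congr1 val (warped_reprK (@warped_proj R N Hl Y phi z)).
set P := @warped_proj R N Hl Y phi z; rewrite /= => E.
suff : @warped_class R N Hl Y phi z (warped_repr P) by [].
by rewrite -E; exact: wd0.
Qed.

Lemma warped_dist_proj z z' :
  dist H (@warped_proj R N Hl Y phi z) (@warped_proj R N Hl Y phi z') = wd z z'.
Proof.
rewrite /= /warped_dist; have [wd0 ws wt] := pdist_pseudo.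
have h := pdist_repr z; have h' := pdist_repr z'.
set r := warped_repr _ in h *; set r' := warped_repr _ in h' *.
have := wt r z r'; have := wt z z' r'; have := wt z r z'; have := wt r r' z'.
by rewrite [wd r z]ws [wd r' z']ws h h' => *; apply/eqP; rewrite eq_le; apply/andP; split; lra.
Qed.

Lemma pseudo_dist : pseudo (dist H).
Proof.
have [wd0 ws wt] := pdist_pseudo.
by split => [P|P P'|P P' P''] /=; rewrite /warped_dist.
Qed.

Lemma dist_wpt t t' (y y' : Y) : dist H (wpt t y) (wpt t' y') = wd (hpt t, y) (hpt t', y').
Proof. exact: warped_dist_proj. Qed.

Lemma dist_ht (P P' : H) : `|wht P - wht P'| <= dist H P P'.
Proof. exact: pdist_ge. Qed.

Lemma dist_vertical t t' (y : Y) : 0 <= t -> 0 <= t' ->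
  dist H (wpt t y) (wpt t' y) = `|t - t'|.
Proof.
move=> t0 t'0; rewrite dist_wpt; apply/eqP; rewrite eq_le.
have := pdist_vertical_le (hpt t) (hpt t') y; have := pdist_ge (hpt t, y) (hpt t', y).
by rewrite /= !hvalK// => -> ->.
Qed.

Lemma dist_horizontal t (y y' : Y) : 0 <= t ->
  dist H (wpt t y) (wpt t y') <= Phi t * dist Y y y'.
Proof.
by move=> t0; rewrite dist_wpt; have := pdist_horizontal_le (hpt t) y y'; rewrite hvalK.
Qed.

Lemma wht_wpt t (y : Y) : 0 <= t -> wht (wpt t y) = t.
Proof.
move=> t0; have := pdist_ge (hpt t, y) (warped_repr (wpt t y)); rewrite pdist_repr /= hvalK//.
by rewrite normr_le0 subr_eq0 => /eqP.
Qed.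

Lemma dist_fib_ge (P P' : H) e m : dist H P P' < e -> 0 <= m ->
  (forall t, 0 <= t -> wht P - e <= t -> m <= Phi t) ->
  m * dist Y (wfib P) (wfib P') <= dist H P P'.
Proof. exact: pdist_lower. Qed.

Lemma dist_fib (P P' : H) e : dist H P P' < e -> e <= wht P ->
  Phi (wht P - e) * dist Y (wfib P) (wfib P') <= dist H P P'.
Proof.
move=> Pe eP; apply: (dist_fib_ge Pe); first by apply: warping_ge0; rewrite subr_ge0.
by move=> t _; apply: (warping_nd W); rewrite subr_ge0.
Qed.

Lemma wfib_wpt t (y : Y) : 0 < t -> wfib (wpt t y) = y.
Proof.
move=> t0; have z := pdist_repr (hpt t, y).
have t20 : 0 < t / 2 by rewrite divr_gt0.
have := @pdist_lower (hpt t, y) (warped_repr (wpt t y)) (t / 2) (Phi (t / 2)).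
rewrite z /= (hvalK (ltW t0)) => /(_ t20 (ltW (warping_gt0 W t20))) K.
have {K} : Phi (t / 2) * dist Y y (warped_repr (wpt t y)).2 <= 0.
  by apply: K => s _ ts; apply: (warping_nd W); lra.
rewrite pmulr_rle0; last by apply: (warping_gt0 W); lra.
move=> h; have [d0 _ _] := warping_dY W; apply/esym/d0/eqP.
by rewrite eq_le h; apply: pseudo_ge0 pdY.
Qed.

End warped_distance.

Lemma ereal_rat {R : realType} (x y : \bar R) : (x < y)%E ->
  exists2 r : rat, (x < (ratr r)%:E)%E & ((ratr r)%:E < y)%E.
Proof.
have rr (u v : R) : u < v -> exists2 r : rat, u < ratr r & ratr r < v.
  by move=> /rat_in_itvoo[r]; rewrite in_itv/= => /andP[? ?]; exists r.
case: x => [x||]; case: y => [y||] //=.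
- by rewrite lte_fin => /rr[r ? ?]; exists r; rewrite lte_fin.
- move=> _; have [r ? ?] := rr x (x + 1) ltac:(lra).
  by exists r; [rewrite lte_fin|rewrite ltry].
- move=> _; have [r ? ?] := rr (y - 1) y ltac:(lra).
  by exists r; [rewrite ltNyr|rewrite lte_fin].
- by move=> _; exists 0; [rewrite ltNyr|rewrite ltry].
Qed.

Lemma measure0_bigcup {d} {T : measurableType d} {R : realType}
    (mu : {measure set T -> \bar R}) (F : (set T)^nat) :
  (forall n, measurable (F n)) -> (forall n, mu (F n) = 0%E) -> mu (\bigcup_n F n) = 0%E.
Proof.
move=> mF F0; apply/eqP; rewrite eq_le measure_ge0 andbT.
have := @measure_sigma_subadditive _ _ _ mu (\bigcup_n F n) F mF (bigcup_measurable (fun n _ => mF n)) (@subset_refl _ _).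
by rewrite eseries0.
Qed.

(** * Outer measures carried by a section *)

Section section_measure.
Context {R : realType} (H : mmdata R) {d} {T : measurableType d}
        (nu : {measure set T -> \bar R}) (S : H -> T).
Local Open Scope ereal_scope.

(** mass H is the outer measure that nu induces through S. On a quotient, S is a choice of
    coordinates of the classes, which are determined up to null sets only. *)
Record carried : Prop := Carried {
  carried_preimage : forall B, measurable B -> mass H (S @^-1` B) = nu B ;
  carried_cover : forall A, exists2 B, measurable B & A `<=` S @^-1` B /\ nu B = mass H A }.

Hypothesis C : carried.

Lemma carried_caratheodory B : measurable B -> (mass H).-caratheodory (S @^-1` B).
Proof.
move=> mB; apply: le_caratheodory_measurable => A.
have [B' mB' [AB' <-]] := carried_cover C A.
rewrite (measureDI nu mB' mB) addeC leeD//.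
  apply: (@le_trans _ _ (mass H (S @^-1` (B' `\` B)))).
    by apply: le_outer_measure => h [/AB' ? ?]; split.
  by rewrite (carried_preimage C)//; exact: measurableD.
apply: (@le_trans _ _ (mass H (S @^-1` (B' `&` B)))).
  by apply: le_outer_measure => h [/AB' ? ?]; split.
by rewrite (carried_preimage C)//; exact: measurableI.
Qed.

Lemma measurable_section : measurable_fun [set: cara H] (S : cara H -> T).
Proof. by move=> _ B mB; rewrite setTI; exact: carried_caratheodory. Qed.

Lemma ge0_integral_section (f : T -> \bar R) : measurable_fun [set: T] f ->
  (forall z, 0 <= f z) -> \int[mmeas H]_(h in [set: cara H]) f (S h) = \int[nu]_z f z.
Proof.
move=> mf f0; rewrite (ge0_integral_transfer measurable_section (mu := mmeas H) (m := nu))//.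
by move=> A mA; rewrite -(carried_preimage C mA).
Qed.

Hypothesis sf : sigma_finite [set: T] nu.

(** For a Caratheodory set A of finite mass, a measurable cover B of A satisfies
    mass (B minus A) = 0, and a measurable cover of this difference is the null set. *)
Lemma caratheodory_section A : (mass H).-caratheodory A ->
  exists B M, [/\ measurable B, measurable M, nu M = 0 &
    forall h, ~ M (S h) -> (A h <-> B (S h))].
Proof.
move=> cA; have [F FT mF] := sf.
have piece n : exists BM : set T * set T, [/\ measurable BM.1, measurable BM.2, nu BM.2 = 0 &
    forall h, F n (S h) -> ~ BM.2 (S h) -> (A h <-> BM.1 (S h))].
  have [mFn Fny] := mF n; pose An := A `&` S @^-1` F n.
  have cAn : (mass H).-caratheodory An.
    by apply: caratheodory_measurable_setI => //; exact: carried_caratheodory.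
  have [B mB [AB nuB]] := carried_cover C An.
  have Any : mass H An < +oo.
    apply: le_lt_trans Fny; rewrite -(carried_preimage C mFn).
    by apply: le_outer_measure => h [].
  have diff0 : mass H (S @^-1` B `\` An) = 0.
    have := cAn (S @^-1` B); rewrite (carried_preimage C mB) nuB setIC setIidl//.
    rewrite setDE => E; have Afin : mass H An \is a fin_num by rewrite ge0_fin_numE// outer_measure_ge0.
    have := congr1 (fun x => x - mass H An) E.
    by rewrite subee// addeAC subee// add0e.
  have [M mM [DM nuM]] := carried_cover C (S @^-1` B `\` An).
  exists (B, M); split => //=; first by rewrite nuM.
  move=> h Fh Mh; split => [Ah|Bh]; first by apply: AB; split.
  by apply: contrapT => Ah; apply: Mh; apply: DM; split => // -[].
have [BM BMP] := choice piece.
exists (\bigcup_n ((BM n).1 `&` F n)), (\bigcup_n (BM n).2); split.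
- apply: bigcup_measurable => n _; apply: measurableI; first by have [] := BMP n.
  by have [] := mF n.
- by apply: bigcup_measurable => n _; have [] := BMP n.
- by apply: measure0_bigcup => n; have [] := BMP n.
move=> h Mh; split => [Ah|[n _ [Bh Fh]]].
  have : [set: T] (S h) by []. rewrite FT => -[n _ Fh]; exists n => //; split => //.
  have [_ _ _ K] := BMP n; apply/(K h Fh) => //.
  by move=> ?; apply: Mh; exists n.
have [_ _ _ K] := BMP n; apply/(K h Fh) => //.
by move=> ?; apply: Mh; exists n.
Qed.

(** f is rebuilt from its superlevel sets at rational levels, each of which agrees with the
    preimage of a measurable set off a null set. *)
Lemma mmeasurable_section (f : H -> \bar R) : mmeasurable H f ->
  exists f0 M, [/\ measurable_fun [set: T] f0, measurable M, nu M = 0 &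
    forall h, ~ M (S h) -> f h = f0 (S h)].
Proof.
move=> mf.
pose q n : R := ratr (odflt 0%Q (unpickle n)).
have piece n : exists BM : set T * set T, [/\ measurable BM.1, measurable BM.2, nu BM.2 = 0 &
    forall h, ~ BM.2 (S h) -> ((q n)%:E < f h <-> BM.1 (S h))].
  have cA : (mass H).-caratheodory [set h | (q n)%:E < f h].
    by have := emeasurable_fun_o_infty measurableT mf (q n)%:E; rewrite setTI.
  by have [B [M [mB mM M0 BM]]] := caratheodory_section cA; exists (B, M).
have [BM BMP] := choice piece.
pose f0 z := esups (fun n => if z \in (BM n).1 then (q n)%:E else -oo) 0%N.
exists f0, (\bigcup_n (BM n).2); split.
- apply: measurable_fun_esups => n; apply: measurable_fun_ifT => //.
  apply: (measurable_fun_bool true); rewrite setTI.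
  rewrite (_ : _ @^-1` _ = (BM n).1); first by have [] := BMP n.
  by apply/seteqP; split => z /= => [/set_mem|/mem_set].
- by apply: bigcup_measurable => n _; have [] := BMP n.
- by apply: measure0_bigcup => n; have [] := BMP n.
move=> h Mh; have K n : (q n)%:E < f h <-> (BM n).1 (S h).
  by have [_ _ _] := BMP n; apply => ?; apply: Mh; exists n.
apply/eqP; rewrite eq_le; apply/andP; split; last first.
  apply: ge_ereal_sup => _ [n _ <-]; case: ifPn => [/[!inE] /K /ltW//|_].
  exact: leNye.
rewrite leNgt; apply/negP => lt_.
have [r fr rf] : exists2 r : rat, f0 (S h) < (ratr r)%:E & (ratr r)%:E < f h.
  exact: ereal_rat.
have qr : q (pickle r) = ratr r by rewrite /q pickleK.
suff : (ratr r)%:E <= f0 (S h) by rewrite leNgt fr.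
apply: ereal_sup_ubound; exists (pickle r) => //.
by rewrite mem_set ?qr//; apply/K; rewrite qr.
Qed.

End section_measure.

(** * Measurable covers of outer measures *)

(** Covers whose measures tend to the outer measure are intersected. *)
Lemma outer_cover {d} {T : measurableType d} {R : realType}
    (m : {measure set T -> \bar R}) (A : set T) (r : \bar R) :
  (forall B, measurable B -> A `<=` B -> r <= m B)%E ->
  (r < +oo -> forall e, (0 < e)%R -> exists B, [/\ measurable B, A `<=` B & m B <= r + e%:E])%E ->
  exists2 B, measurable B & A `<=` B /\ m B = r.
Proof.
move=> lower upper; have [ry|] := ltP r +oo%E; last first.
  rewrite leye_eq => /eqP ry; exists setT => //; split => //; apply/eqP.
  by rewrite ry eq_le leey -ry lower.
have {upper} /choice [B PB] : forall n, exists B, [/\ measurable B, A `<=` B & m B <= r + n.+1%:R^-1%:E]%E.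
  by move=> n; apply: upper.
have mB : measurable (\bigcap_n B n) by apply: bigcapT_measurable => n; have [] := PB n.
exists (\bigcap_n B n) => //.
have AB : A `<=` \bigcap_n B n by move=> x Ax n _; have [_ AB _] := PB n; exact: AB.
split => //; apply/eqP; rewrite eq_le lower// andbT; apply/lee_addgt0Pr => e e0.
have [n ne] : exists n : nat, n.+1%:R^-1 < e.
  have [n _ Hn] := near_infty_natSinv_lt (PosNum e0); exists n; exact: (Hn n (leqnn n)).
have [mBn _ Bn] := PB n; apply: (@le_trans _ _ (m (B n))).
  by apply: le_measure; rewrite ?inE//; apply: bigcap_inf.
by apply: (le_trans Bn); rewrite leeD2l// lee_fin ltW.
Qed.

Lemma mu_ext_cover {d} {T : measurableType d} {R : realType}
    (m : {measure set T -> \bar R}) (A : set T) :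
  exists2 B, measurable B & A `<=` B /\ m B = mu_ext m A.
Proof.
apply: outer_cover.
  move=> B mB AB; rewrite -(measurable_mu_extE m mB).
  by apply: le_mu_ext.
move=> Ay e e0; have Af : mu_ext m A \is a fin_num.
  by rewrite ge0_fin_numE//; apply: mu_ext_ge0.
have [_ [F [mF AF] <-] lt_] := lb_ereal_inf_adherent e0 Af.
exists (\bigcup_n F n); split => //; first by apply: bigcup_measurable.
apply: le_trans (ltW lt_).
by apply: measure_sigma_subadditive => //; exact: bigcup_measurable.
Qed.

(** * The weighted half-line *)

Section weighted_halfline.
Context {R : realType} (w : R -> {nonneg R}).
Hypothesis mw : measurable_fun [set: R] (fun t => (w t)%:num).
Local Open Scope ereal_scope.
Local Notation mu := (@lebesgue_measure R).

Definition weight_measure (_ : measurable_fun [set: R] (fun t => (w t)%:num)) :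
  set (measurableTypeR R) -> \bar R := weight_set w.

Let mw' : measurable_fun [set: R] (fun t => ((w t)%:num)%:E).
Proof. by apply/measurable_EFinP. Qed.

Let wm_sigma : semi_sigma_additive (weight_measure mw).
Proof.
move=> F mF tF _; rewrite /weight_measure /weight_set setI_bigcupl.
rewrite ge0_integral_bigcup//.
- by apply: is_cvg_nneseries => n _ _; apply: integral_ge0 => t _; rewrite lee_fin.
- by move=> n; apply: measurableI => //; exact: measurable_itv.
- exact: measurable_funTS.
exact: trivIset_setIr.
Qed.

HB.instance Definition _ := isMeasure.Build _ _ _ (weight_measure mw)
  (weight_set0 w) (weight_set_ge0 w) wm_sigma.

Definition wm : {measure set (measurableTypeR R) -> \bar R} := weight_measure mw.

Lemma wmE (A : set (measurableTypeR R)) : measurable A ->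
  wm A = \int[mu]_(t in A) (((w t)%:num * \1_(`[0, +oo[) t)%R)%:E.
Proof.
move=> mA; rewrite /wm/= /weight_measure /weight_set integral_mkcondr.
apply: eq_integral => t _; rewrite patchE indicE.
by case: (t \in _); rewrite ?mulr1 ?mulr0.
Qed.

Lemma wm_neg : wm `]-oo, 0%R]%classic = 0.
Proof.
rewrite /wm/= /weight_measure /weight_set.
have -> : `]-oo, 0%R]%classic `&` `[0%R, +oo[ = [set 0%R] :> set R.
  apply/seteqP; split => t /=; rewrite !in_itv/= ?andbT.
    by move=> [t0 t1]; apply/eqP; rewrite eq_le t0.
  by move=> ->; rewrite lexx.
by rewrite integral_set1.
Qed.

Lemma weight_outerE (A : set (@halfline R)) : weight_outer w A = mu_ext wm (hval @` A).
Proof. by []. Qed.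

Lemma hval_preimage (B : set R) : hval @` (hval @^-1` B) = B `&` `[0%R, +oo[.
Proof.
apply/seteqP; split => [_ [x Bx <-]|t [Bt]].
  by split => //=; rewrite in_itv/= andbT; exact: hval_ge0.
by rewrite /= in_itv/= andbT => t0; exists (hpt t); rewrite /= ?hvalK.
Qed.

Lemma weight_outer_preimage (B : set (measurableTypeR R)) : measurable B ->
  weight_outer w (hval @^-1` B) = wm B.
Proof.
move=> mB; rewrite weight_outerE hval_preimage measurable_mu_extE; last first.
  by apply: measurableI => //; exact: measurable_itv.
by rewrite /wm/= /weight_measure /weight_set -setIA setIid.
Qed.

Lemma hval_caratheodory (B : set (measurableTypeR R)) : measurable B ->
  (mass (whalfline w)).-caratheodory (hval @^-1` B).
Proof.
move=> mB A; rewrite /= !weight_outerE.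
rewrite [LHS](caratheodory_measurable_mu_ext wm mB (hval @` A)).
have inj (D : set R) : hval @` A `&` D = hval @` (A `&` hval @^-1` D).
  apply/seteqP; split => [_ [[x Ax <-] Dx]|_ [x [Ax Dx] <-]]; first by exists x.
  by split => //; exists x.
by rewrite !inj.
Qed.

End weighted_halfline.

Section sigma_finite_packing.
Context {d} {T : measurableType d} {R : realType} (m : {measure set T -> \bar R}).
Hypothesis sf : sigma_finite [set: T] m.

(** The proof is an argument so that the structure below is found by unification. *)
Definition sigma_finite_pack (_ : sigma_finite [set: T] m) : set T -> \bar R := m.

HB.instance Definition _ := Measure.copy (sigma_finite_pack sf) m.
HB.instance Definition _ := Measure_isSigmaFinite.Build _ _ _ (sigma_finite_pack sf) sf.

End sigma_finite_packing.

(** * The product outer measure on rectangles *)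

(** Each rectangle P x Q of a cover is cut into the part in F x G and two rectangles that
    cover the rest: the part over the complement of F, and the part over F in the
    complement of G. *)
Lemma caratheodory_rect {R : realType} (X Y : mmdata R) (F : set X) (G : set Y) :
  (mass X).-caratheodory F -> (mass Y).-caratheodory G ->
  (@prod_outer R X Y).-caratheodory (F `*` G).
Proof.
move=> cF cG; apply: (@le_caratheodory_measurable R (X * Y)%type (@prod_outer R X Y)) => A.
apply: le_ereal_inf_tmp => _ [[P Q] [/= cPQ APQ] <-] /=.
have cP k : (mass X).-caratheodory (P k) by have [] := cPQ k.
have cQ k : (mass Y).-caratheodory (Q k) by have [] := cPQ k.
have w0 (U : nat -> set X) (V : nat -> set Y) k : (0 <= mass X (U k) * mass Y (V k))%E.
  by apply: mule_ge0; exact: outer_measure_ge0.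
have D k : (mass X (P k) * mass Y (Q k) =
    mass X (P k `&` F) * mass Y (Q k `&` G) +
    (mass X (P k `&` ~` F) * mass Y (Q k) + mass X (P k `&` F) * mass Y (Q k `&` ~` G)))%E.
  rewrite {1}(cF (P k)) ge0_muleDl ?outer_measure_ge0// addeC addeCA; congr (_ + _)%E.
  by rewrite {1}(cG (Q k)) ge0_muleDr ?outer_measure_ge0.
under eq_eseriesr do rewrite D.
rewrite nneseriesD; [|by move=> *; exact: (w0 (fun k => P k `&` F) (fun k => Q k `&` G))|
  by move=> *; apply: adde_ge0; apply: mule_ge0; exact: outer_measure_ge0].
rewrite nneseriesD; [|by move=> *; exact: (w0 (fun k => P k `&` ~` F))|
  by move=> *; exact: (w0 (fun k => P k `&` F) (fun k => Q k `&` ~` G))].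
apply: leeD.
  apply: ereal_inf_lbound; exists (fun k => P k `&` F, fun k => Q k `&` G) => //; split => /=.
    by move=> k; split; apply: caratheodory_measurable_setI.
  by move=> z [/APQ[k _ [Pz Qz]] [Fz Gz]]; exists k.
pose A1 := A `&` ((~` F) `*` setT); pose A2 := A `&` (F `*` ~` G).
apply: (@le_trans _ _ (prod_outer A1 + prod_outer A2)%E).
  apply: (@le_trans _ _ (prod_outer (A1 `|` A2))); last first.
    exact: (outer_measureU2 (@prod_outer R X Y : {outer_measure set (X * Y)%type -> \bar R})).
  apply: le_prod_outer => z [Az /not_andP nFG]; have [Fz|Fz] := pselect (F z.1); last by left.
  by right; split => //; split => //; case: nFG.
apply: leeD; apply: ereal_inf_lbound.
  exists (fun k => P k `&` ~` F, Q) => //; split => /=.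
    move=> k; split => //; apply: caratheodory_measurable_setI => //.
    exact: caratheodory_measurable_setC.
  by move=> z [/APQ[k _ [Pz Qz]] [Fz _]]; exists k.
exists (fun k => P k `&` F, fun k => Q k `&` ~` G) => //; split => /=.
  move=> k; split; apply: caratheodory_measurable_setI => //.
  exact: caratheodory_measurable_setC.
by move=> z [/APQ[k _ [Pz Qz]] [Fz Gz]]; exists k.
Qed.

Section product_with_halfline.
Context {R : realType} (w : R -> {nonneg R}) (Y : mmdata R).
Hypothesis mw : measurable_fun [set: R] (fun t => (w t)%:num).
Hypothesis sw : sigma_finite [set: measurableTypeR R] (wm mw).
Hypothesis sY : sigma_finite [set: cara Y] (mmeas Y).
Local Open Scope ereal_scope.
Local Notation Hl := (@whalfline R w).

Definition wY : {measure set (measurableTypeR R * cara Y) -> \bar R} :=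
  (@sigma_finite_pack _ (measurableTypeR R) R (wm mw) sw \x
   @sigma_finite_pack _ (cara Y) R (mmeas Y) sY)%E.

Definition emb (z : Hl * Y) : measurableTypeR R * cara Y := (hval z.1, z.2).

Lemma wY_rect A B : measurable A -> measurable B -> wY (A `*` B) = wm mw A * mass Y B.
Proof. by move=> mA mB; exact: product_measure1E. Qed.

Let po : {outer_measure set (Hl * Y) -> \bar R} := @prod_outer R Hl Y.

Lemma prod_outer_approx (A : set (Hl * Y)) : po A < +oo -> forall e, (0 < e)%R ->
  exists B, [/\ measurable B, emb @` A `<=` B & wY B <= po A + e%:E].
Proof.
move=> Ay e e0; have Af : po A \is a fin_num by rewrite ge0_fin_numE// outer_measure_ge0.
have [_ [[P Q] [/= cPQ APQ] <-] lt_] := lb_ereal_inf_adherent e0 Af.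
have /choice[F FP] : forall k, exists B : set (measurableTypeR R),
    [/\ measurable B, hval @` P k `<=` B & wm mw B = weight_outer w (P k)].
  by move=> k; have [B mB [PB BE]] := mu_ext_cover (wm mw) (hval @` P k); exists B.
have mF k : measurable (F k) by have [] := FP k.
have cQ k : measurable (Q k : set (cara Y)) by have [] := cPQ k.
have mFQ k : measurable (F k `*` Q k : set (measurableTypeR R * cara Y)).
  exact: measurableX.
exists (\bigcup_k (F k `*` Q k)); split.
- exact: bigcup_measurable.
- move=> _ [z /APQ[k _ [Pz Qz]] <-]; exists k => //; split => //=.
  by have [_ FPk _] := FP k; apply: FPk; exists z.1.
apply: le_trans (ltW lt_).
apply: (@le_trans _ _ (\sum_(k <oo) wY (F k `*` Q k))).
  by apply: (@measure_sigma_subadditive _ _ _ wY) => //; exact: bigcup_measurable.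
apply: lee_nneseries => [k _ _|k _]; first exact: measure_ge0.
rewrite [leLHS]wY_rect//.
by have [_ _ ->] := FP k.
Qed.

Let po_cara := caratheodory_type po.

Lemma measurable_emb : measurable_fun [set: po_cara] (emb : po_cara -> measurableTypeR R * cara Y).
Proof.
apply: measurable_fun_pair => /=.
  move=> _ A mA; rewrite setTI.
  have -> : (fun x : po_cara => hval x.1) @^-1` A = (hval @^-1` A) `*` setT.
    by apply/seteqP; split => // z [].
  apply: (@caratheodory_rect R Hl Y); first exact: (hval_caratheodory mw).
  exact: (@measurableT _ (cara Y)).
move=> _ A mA; rewrite setTI.
have -> : (fun x : po_cara => x.2) @^-1` A = setT `*` A.
  by apply/seteqP; split => // z [].
apply: (@caratheodory_rect R Hl Y) => //.
exact: (@measurableT _ (cara Hl)).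
Qed.

Let pom : {measure set po_cara -> \bar R} := po.

Lemma wm_halfline (A : set (measurableTypeR R)) : wm mw (A `&` `[0%R, +oo[) = wm mw A.
Proof. by rewrite /wm/= /weight_measure /weight_set -setIA setIid. Qed.

Lemma prod_outer_rect (A : set (measurableTypeR R)) (B : set (cara Y)) :
  measurable A -> measurable B ->
  po (emb @^-1` (A `*` B)) = wm mw A * mass Y B.
Proof.
move=> mA mB; apply/eqP; rewrite eq_le; apply/andP; split.
  apply: ereal_inf_lbound.
  exists (fun k => if k == 0%N then hval @^-1` A else set0,
          fun k => if k == 0%N then B else set0).
    split => /=.
      case=> [|k] /=; split => //; [exact: (hval_caratheodory mw)| |];
      exact: caratheodory_measurable_set0.
    by move=> z [Az Bz]; exists 0%N.
  have w0 k : 0 <= mass Hl (if k == 0%N then hval @^-1` A else set0) *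
                   mass Y (if k == 0%N then B else set0).
    by apply: mule_ge0; exact: outer_measure_ge0.
  rewrite (nneseries_split 0%N 1%N); last by move=> k _; exact: (w0 k).
  rewrite [X in _ + X]eseries0; last by case=> // k _ _ /=; rewrite outer_measure0 mul0e.
  by rewrite adde0 big_nat1 /= weight_outer_preimage.
have [Ay|] := ltP (po (emb @^-1` (A `*` B))) +oo; last first.
  by rewrite leye_eq => /eqP ->; rewrite leey.
apply/lee_addgt0Pr => e e0; have [D [mD AD Dle]] := prod_outer_approx Ay e0.
apply: le_trans Dle; rewrite -wm_halfline -wY_rect//; last first.
  by apply: measurableI => //; exact: measurable_itv.
apply: le_measure; rewrite ?inE//.
  by apply: measurableX => //; apply: measurableI => //; exact: measurable_itv.
move=> [t y] [[At t0] By]; apply: AD; exists (hpt t, y).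
  by rewrite /emb /= hvalK//; move: t0; rewrite /= in_itv/= andbT.
by rewrite /emb /= hvalK//; move: t0; rewrite /= in_itv/= andbT.
Qed.

(** The pushforward of the restriction of the product outer measure to its Caratheodory
    sets is a measure with the right values on rectangles. *)
Theorem prod_outer_wY B : measurable B -> po (emb @^-1` B) = wY B.
Proof.
move=> mB; pose m' := measure_function_pushforward__canonical__measure_function_Measure
  pom measurable_emb.
apply/esym; apply: (product_measure_unique (m' := m')) => // A1 A2 mA1 mA2.
exact: prod_outer_rect.
Qed.

Lemma prod_outer_cover (A : set (Hl * Y)) :
  exists2 B, measurable B & emb @` A `<=` B /\ wY B = po A.
Proof.
apply: (@outer_cover _ _ R wY).
  move=> B mB AB; rewrite -prod_outer_wY//; apply: le_outer_measure => z Az.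
  by apply: AB; exists z.
exact: prod_outer_approx.
Qed.

Context (N : R * R -> R) (phi : Hl -> {nonneg R}) (Phi : R -> R).
Hypothesis W : warping N Y phi Phi.
Local Notation H := (@warped R N Hl Y phi).

Definition wsec (h : H) : measurableTypeR R * cara Y := (wht h, wfib h).

(** Coordinates determine a point at positive height, and the fibre at height 0 is null. *)
Theorem carried_warped : carried wY wsec.
Proof.
split.
  move=> B mB.
  have mZ : measurable (`]-oo, 0%R]%classic `*` setT : set (measurableTypeR R * cara Y)).
    by apply: measurableX => //; exact: measurable_itv.
  have Z0 : po (emb @^-1` (`]-oo, 0%R]%classic `*` setT)) = 0.
    by rewrite prod_outer_wY// wY_rect// wm_neg mul0e.
  have agree z : (0 < hval z.1)%R -> wsec (@warped_proj R N Hl Y phi z) = emb z.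
    move=> z0; have E : @warped_proj R N Hl Y phi z = wpt N w phi (hval z.1) z.2.
      by rewrite /wpt hptK -surjective_pairing.
    by rewrite /wsec E (wht_wpt w W _ (ltW z0)) (wfib_wpt w W _ z0).
  rewrite -[LHS]/(po (@warped_proj R N Hl Y phi @^-1` (wsec @^-1` B))) -prod_outer_wY//.
  have null (A A' : set (Hl * Y)) : (forall z, (0 < hval z.1)%R -> A z -> A' z) -> po A <= po A'.
    move=> AA'; rewrite -[leRHS]adde0 -Z0.
    apply: le_trans (outer_measureU2 po _ _); apply: le_outer_measure => z Az.
    have [z0|z0] := ltP 0%R (hval z.1); first by left; exact: AA'.
    by right; split => //=; rewrite in_itv.
  by apply/eqP; rewrite eq_le; apply/andP; split; apply: null => z z0 /=; rewrite agree.
move=> A; have [B mB [AB BE]] := prod_outer_cover (@warped_proj R N Hl Y phi @^-1` A).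
exists B => //; split => // h Ah; apply: AB; exists (hpt (wht h), wfib h).
  by rewrite /= -/(wpt N w phi (wht h) (wfib h)) wptK.
by rewrite /emb /= hvalK// /wht; exact: hval_ge0.
Qed.

End product_with_halfline.

(** * A weighted Hardy inequality *)

Section jensen.
Context {R : realType}.
Implicit Types (p a m : R).

(** Young's inequality, in the form of the tangent to x ^ p at m. *)
Lemma young_tangent p (x : \bar R) m : 1 <= p -> 0 < m -> (0 <= x)%E ->
  (x * (m `^ (p - 1))%:E <= (x `^ p) * (p^-1)%:E + ((1 - p^-1) * m `^ p)%:E)%E.
Proof.
move=> p1 m0; have p0 : 0 < p by lra.
case: x => [x| |] //.
  rewrite lee_fin => x0; rewrite poweR_EFin -!EFinM -EFinD lee_fin.
  have [->|pn1] := eqVneq p 1.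
    by rewrite subrr powRr0 powRr1// invr1 subrr mul0r addr0.
  have p1' : 0 < p - 1 by rewrite subr_gt0 lt_neqAle eq_sym pn1.
  have q0 : 0 < p / (p - 1) by rewrite divr_gt0.
  have := @conjugate_powR R x (m `^ (p - 1)) p (p / (p - 1)) x0 (powR_ge0 _ _) p0 q0.
  rewrite -powRrM (_ : (p - 1) * (p / (p - 1)) = p); last by field; rewrite gt_eqF.
  rewrite (_ : (p / (p - 1))^-1 = 1 - p^-1); last by field; rewrite !gt_eqF.
  rewrite addrC subrK => /(_ erefl) /le_trans; apply.
  by rewrite lerD2l mulrC.
move=> _; rewrite poweRyr ?gt_eqF// !gt0_mulye ?lte_fin ?powR_gt0 ?invr_gt0//.
Qed.

(** The tangent inequality at the mean m is integrated against the density k. If the mean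
    is infinite, the tangent at 1 shows that the mean of f ^ p is infinite as well. *)
Lemma jensen_powR {d} {T : measurableType d} (mu : {measure set T -> \bar R})
    (f : T -> \bar R) (k : T -> R) p : 1 <= p ->
  measurable_fun [set: T] f -> (forall x, 0 <= f x)%E ->
  measurable_fun [set: T] k -> (forall x, 0 <= k x) ->
  (\int[mu]_x (k x)%:E <= 1)%E ->
  ((\int[mu]_x (f x * (k x)%:E)) `^ p <= \int[mu]_x ((f x `^ p) * (k x)%:E))%E.
Proof.
move=> p1 mf f0 mk k0 k1; have p0 : 0 < p by lra.
have mk' : measurable_fun [set: T] (fun x => (k x)%:E) by apply/measurable_EFinP.
have mfk : measurable_fun [set: T] (fun x => f x * (k x)%:E)%E by exact: emeasurable_funM.
have mfp : measurable_fun [set: T] (fun x => f x `^ p)%E.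
  exact: measurableT_comp (measurable_poweR p) mf.
have mfpk : measurable_fun [set: T] (fun x => (f x `^ p) * (k x)%:E)%E by exact: emeasurable_funM.
have fk0 x : (0 <= f x * (k x)%:E)%E by rewrite mule_ge0 ?lee_fin.
have fpk0 x : (0 <= (f x `^ p) * (k x)%:E)%E by rewrite mule_ge0 ?lee_fin// poweR_ge0.
set I := (\int[mu]_x (f x * (k x)%:E))%E.
have I0 : (0 <= I)%E by apply: integral_ge0.
set J := (\int[mu]_x ((f x `^ p) * (k x)%:E))%E.
have J0 : (0 <= J)%E by apply: integral_ge0.
have key m : 0 < m -> (I * (m `^ (p - 1))%:E <= J * (p^-1)%:E + ((1 - p^-1) * m `^ p)%:E)%E.
  move=> m0; have c0 : 0 <= (1 - p^-1) * m `^ p.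
    by rewrite mulr_ge0 ?powR_ge0// subr_ge0 invf_le1.
  rewrite /I -ge0_integralZr ?lee_fin ?powR_ge0//.
  rewrite /J -ge0_integralZr ?lee_fin ?invr_ge0 ?(ltW p0)//.
  apply: (@le_trans _ _ (\int[mu]_x ((f x `^ p) * (k x)%:E * (p^-1)%:E + ((1 - p^-1) * m `^ p)%:E * (k x)%:E)))%E.
    apply: ge0_le_integral => //.
    - by move=> x _; rewrite mule_ge0 ?lee_fin ?powR_ge0.
    - by apply: emeasurable_funM => //; exact: measurable_cst.
    - apply: emeasurable_funD; apply: emeasurable_funM => //; exact: measurable_cst.
    move=> x _; rewrite muleAC [leRHS](_ : _ = ((f x `^ p) * (p^-1)%:E + ((1 - p^-1) * m `^ p)%:E) * (k x)%:E)%E.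
      by rewrite lee_wpmul2r ?lee_fin//; exact: young_tangent.
    rewrite ge0_muleDl ?lee_fin//; first by rewrite muleAC.
    by rewrite mule_ge0 ?poweR_ge0 ?lee_fin ?invr_ge0 ?(ltW p0).
  rewrite ge0_integralD//; last 4 first.
  - by move=> x _; rewrite mule_ge0 ?lee_fin ?invr_ge0 ?(ltW p0).
  - by apply: emeasurable_funM => //; exact: measurable_cst.
  - by move=> x _; rewrite -EFinM lee_fin mulr_ge0.
  - by apply: emeasurable_funM => //; exact: measurable_cst.
  rewrite leeD2l// ge0_integralZl// ?lee_fin//; last by move=> x _; rewrite lee_fin.
  by rewrite -[leRHS]mule1 lee_wpmul2l ?lee_fin.
have [Iy|] := ltP I +oo%E; last first.
  rewrite leye_eq => /eqP Iy; have := key 1 ltr01; rewrite Iy powR1 mule1.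
  case: J J0 {key} => [J| |] // _; last by rewrite poweRyr ?gt_eqF.
have If : I \is a fin_num by rewrite ge0_fin_numE.
have [I_0|In0] := eqVneq I 0%E; first by rewrite I_0 poweR0r ?gt_eqF.
have m0 : 0 < fine I by rewrite fine_gt0// Iy andbT lt_neqAle eq_sym In0.
have := key _ m0; rewrite -{1}(fineK If) -EFinM.
rewrite -{1}[fine I]powRr1 ?(ltW m0)// -powRD; last by rewrite (gt_eqF m0) implybT.
rewrite (_ : 1 + (p - 1) = p); last by lra.
rewrite -[X in (X `^ p)%E](fineK If) poweR_EFin.
move: J0; case: (J) => [j| |] //.
  move=> _ h; have {h} : fine I `^ p <= j * p^-1 + (1 - p^-1) * fine I `^ p by exact: h.
  rewrite lee_fin => h.
have : p^-1 * fine I `^ p <= j * p^-1 by lra.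
by rewrite mulrC ler_pM2r// invr_gt0.
by move=> _ _; rewrite leey.
Qed.

End jensen.

Section hardy.
Context {R : realType}.
Local Notation mu := (@lebesgue_measure R).
Local Open Scope ereal_scope.

(** Substituting s = t + r turns the tail integral into an average over r of the
    translates of f; each translate is contracted by the growth of the weight. *)
Lemma hardy (w : R -> R) (beta p : R) (f : R -> \bar R) :
  (0 < beta)%R -> (1 <= p)%R ->
  measurable_fun [set: R] w -> (forall t, 0 <= w t)%R ->
  (forall t s, (0 <= s)%R -> (w t * expR (beta * s) <= w (t + s))%R) ->
  measurable_fun [set: R] f -> (forall t, 0 <= f t) ->
  \int[mu]_t ((\int[mu]_(s in `[t, +oo[) f s) `^ p * (w t)%:E) <=
  ((p / beta) `^ p)%:E * \int[mu]_t ((f t `^ p) * (w t)%:E).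
Proof.
move=> b0 p1 mw w0 wg mf f0; have p0 : (0 < p)%R by lra.
pose de := (beta / p)%R; have d0 : (0 < de)%R by rewrite divr_gt0.
pose k : R -> R := exponential_pdf de.
have k0 s : (0 <= k s)%R by apply: exponential_pdf_ge0; exact: ltW.
have mk : measurable_fun [set: R] k by exact: measurable_exponential_pdf.
have k1 : \int[mu]_s (k s)%:E <= 1 by rewrite integral_exponential_pdf.
(* the growth of the weight at rate beta is shared between the density and the power *)
pose h t s : \bar R := f (t + s)%R * (expR (de * s) / de)%:E.
have mts : measurable_fun [set: R * R] (fun z => f (z.1 + z.2)%R).
  by apply: (measurableT_comp mf); apply: measurable_funD.
have mh t : measurable_fun [set: R] (h t).
  apply: emeasurable_funM.
    by apply: (measurableT_comp mf); apply: measurable_funD.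
  apply/measurable_EFinP; apply: measurable_funM => //.
  by apply: measurableT_comp => //; apply: measurable_funM.
have h0 t s : 0 <= h t s by rewrite mule_ge0 ?lee_fin// divr_ge0 ?expR_ge0 ?(ltW d0).
have tail t : \int[mu]_(s in `[t, +oo[) f s = \int[mu]_s (h t s * (k s)%:E).
  rewrite (ge0_integral_isom true t)//; last exact: measurable_funTS.
  rewrite [RHS](_ : _ = \int[mu]_(s in `[0%R, +oo[) f (t + s)%R).
    rewrite (_ : isom true t @^-1` `[t, +oo[ = `[0%R, +oo[%classic); last first.
      by apply/seteqP; split => s; rewrite /= /isom !in_itv/= !andbT lerDr.
    by apply: eq_integral => s _; rewrite /isom addrC.
  rewrite [RHS]integral_mkcond; apply: eq_integral => s _.
  rewrite patchE /k /exponential_pdf patchE; case: ifPn => _; last by rewrite mule0.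
  rewrite /h -muleA -EFinM (_ : (_ * _ = 1)%R) ?mule1//.
  by rewrite mulrA divfK ?gt_eqF// mulNr expRN divff ?gt_eqF// expR_gt0.
apply: (@le_trans _ _ (\int[mu]_t \int[mu]_s (((h t s) `^ p * (k s)%:E) * (w t)%:E))).
  apply: (@ge0_ae_le_integral_nomeas _ _ _ _ _ set0) => // t _.
  - by rewrite mule_ge0 ?poweR_ge0 ?lee_fin.
  - by apply: integral_ge0 => s _; rewrite !mule_ge0 ?poweR_ge0 ?lee_fin.
  move=> _; rewrite ge0_integralZr ?lee_fin//; last 2 first.
  - apply: emeasurable_funM; last exact/measurable_EFinP.
    exact: measurableT_comp (measurable_poweR p) (mh t).
  - by move=> s _; rewrite mule_ge0 ?poweR_ge0 ?lee_fin.
  by apply: lee_wpmul2r; [rewrite lee_fin|rewrite tail; exact: (@jensen_powR R _ _ mu (h t) k p p1 (mh t) (h0 t) mk k0 k1)].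
pose F (z : R * R) := (h z.1 z.2) `^ p * (k z.2)%:E * (w z.1)%:E.
have mF : measurable_fun [set: R * R] F.
  apply: emeasurable_funM; last by apply/measurable_EFinP; exact: measurableT_comp.
  apply: emeasurable_funM; last by apply/measurable_EFinP; exact: measurableT_comp.
  apply: measurableT_comp (measurable_poweR p) _; apply: emeasurable_funM => //.
  apply/measurable_EFinP; apply: measurable_funM => //.
  by apply: measurableT_comp => //; apply: measurable_funM.
have F0 z : 0 <= F z by rewrite /F !mule_ge0 ?poweR_ge0 ?lee_fin.
rewrite [leLHS](_ : _ = \int[mu]_s \int[mu]_t F (t, s)); last first.
  exact: (@fubini_tonelli _ _ _ _ R mu mu F mF F0).
set I := \int[mu]_t ((f t `^ p) * (w t)%:E).
have mI : measurable_fun [set: R] (fun t => (f t `^ p) * (w t)%:E).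
  apply: emeasurable_funM; last exact/measurable_EFinP.
  exact: measurableT_comp (measurable_poweR p) mf.
have I0 t : 0 <= (f t `^ p) * (w t)%:E by rewrite mule_ge0 ?poweR_ge0 ?lee_fin.
have I00 : 0 <= I by apply: integral_ge0.
apply: (@le_trans _ _ (\int[mu]_s (((p / beta) `^ p)%:E * I * (k s)%:E))); last first.
  rewrite ge0_integralZl//; first 1 last.
  - exact/measurable_EFinP.
  - by move=> s _; rewrite lee_fin.
  - by rewrite mule_ge0// lee_fin powR_ge0.
  by rewrite -[leRHS]mule1 lee_wpmul2l// mule_ge0// lee_fin powR_ge0.
apply: (@ge0_ae_le_integral_nomeas _ _ _ _ _ set0) => // s _.
- exact: integral_ge0.
- by rewrite !mule_ge0 ?lee_fin ?powR_ge0.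
move=> _; have [s0|s0] := ltP s 0%R.
  have ks : k s = 0%R.
    by rewrite /k /exponential_pdf patchE memNset//= in_itv/= andbT leNgt s0.
  rewrite ks mule0 [leLHS]integral0_eq// => t _.
  by rewrite /F /= ks mule0 mul0e.
have -> : ((p / beta) `^ p)%:E * I * (k s)%:E =
    \int[mu]_t (((p / beta) `^ p * k s)%:E * ((f (t + s)%R `^ p) * (w (t + s)%R)%:E)).
  rewrite ge0_integralZl//; first last.
  - by rewrite lee_fin mulr_ge0 ?powR_ge0.
  - apply: (measurableT_comp mI) => //; exact: measurable_funD.
  rewrite muleAC -EFinM; congr (_ * _).
  rewrite /I (ge0_integral_isom true s)//.
apply: ge0_le_integral => //.
- move=> _ A mA; exact: (measurableT_comp mF (pair2_measurable s)).
- apply: emeasurable_funM => //.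
  by apply: (measurableT_comp mI); exact: measurable_funD.
move=> t _; rewrite /F /h /= poweRM ?lee_fin ?divr_ge0 ?expR_ge0 ?(ltW d0)//.
rewrite poweR_EFin powRM ?invr_ge0 ?expR_ge0 ?(ltW d0)//.
rewrite -[leLHS]muleA -[leLHS]muleA -!EFinM muleCA -EFinM lee_wpmul2l ?poweR_ge0//.
rewrite lee_fin -expRM (_ : (de * s * p = beta * s)%R); last first.
  by rewrite /de; field; rewrite gt_eqF.
rewrite (_ : (de^-1 = p / beta)%R); last by rewrite /de invf_div.
have := ler_wpM2l (mulr_ge0 (powR_ge0 (p / beta) p) (k0 s)) (wg t s s0).
by move=> K; apply: le_trans K; rewrite le_eqVlt; apply/orP; left; apply/eqP; ring.
all: exact: ltW.
Qed.

End hardy.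

(** * Warped products of a half-line with a metric measure space *)

Lemma countable_enum {T : pointedType} (D : set T) : countable D ->
  exists e : nat -> T, forall x, D x -> exists k, e k = x.
Proof.
move=> /countable_injP[f inj].
have /choice[e eP] n : exists x, forall x', D x' -> f x' = n -> x' = x.
  have [[x Dx fx]|nx] := pselect (exists2 x, D x & f x = n).
    by exists x => x' Dx' fx'; apply: inj; rewrite ?inE// fx fx'.
  by exists point => x' Dx' fx'; case: nx; exists x'.
by exists e => x Dx; exists (f x); rewrite -(eP _ x).
Qed.

Section filling.
Context {R : realType} (N : R * R -> R) (w : R -> {nonneg R}) (Y : mmdata R)
        (phi : @halfline R -> {nonneg R}) (Phi : R -> R) (beta : R).
Local Notation mu := (@lebesgue_measure R).
Local Notation Hl := (@whalfline R w).
Local Notation H := (@warped R N Hl Y phi).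
Local Notation pt := (@wpt R N w Y phi).

(** The features shared by the weights exp (beta t) and sinh (t) ^ beta: growth means that
    w t * exp (- beta t) is nondecreasing on the half-line. *)
Record filling : Prop := Filling {
  filling_warping : warping N Y phi Phi ;
  filling_mm : metric_measure_space Y ;
  filling_beta : 0 < beta ;
  filling_measurable : measurable_fun [set: R] (fun t => (w t)%:num) ;
  filling_growth : forall s t, 0 <= s -> 0 <= t ->
    (w t)%:num * expR (beta * s) <= (w (t + s))%:num ;
  filling_gt0 : forall t, 0 < t -> 0 < (w t)%:num }.

Hypothesis F : filling.
Let W := filling_warping F.
Let mw := filling_measurable F.
Let pdY : pseudo (dist Y). Proof. exact: metric_pseudo (warping_dY W). Qed.

Lemma filling_nd s t : 0 <= s -> s <= t -> (w s)%:num <= (w t)%:num.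
Proof.
move=> s0 st; have := filling_growth F (s := t - s) ltac:(lra) s0.
rewrite subrKC; apply: le_trans; rewrite -[leLHS]mulr1 ler_wpM2l//.
by rewrite -[leLHS]expR0 ler_expR mulr_ge0//; [exact: ltW (filling_beta F)|lra].
Qed.

(** The density of the weighted half-line as a measure on the whole line. *)
Definition weight (t : R) : R := (w t)%:num * \1_(`[0, +oo[) t.

Lemma weight_ge0 t : 0 <= weight t. Proof. by rewrite mulr_ge0. Qed.

Lemma weightE t : 0 <= t -> weight t = (w t)%:num.
Proof. by move=> t0; rewrite /weight indicE mem_set ?mulr1//= in_itv/= t0. Qed.

Lemma weight_neg t : t < 0 -> weight t = 0.
Proof.
by move=> t0; rewrite /weight indicE memNset ?mulr0//= in_itv/= andbT leNgt t0.
Qed.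

Lemma measurable_weight : measurable_fun [set: R] weight.
Proof. by apply: measurable_funM => //; apply: measurable_indic. Qed.

Lemma weight_growth t s : 0 <= s -> weight t * expR (beta * s) <= weight (t + s).
Proof.
move=> s0; have [t0|t0] := ltP t 0; first by rewrite weight_neg// mul0r weight_ge0.
by rewrite !weightE ?addr_ge0//; exact: filling_growth.
Qed.

Lemma weight_lty (b : R) : 0 <= b -> (wm mw `[(- b)%R, b]%classic < +oo)%E.
Proof.
move=> b0; rewrite wmE//.
apply: (@le_lt_trans _ _ (\int[mu]_(t in `[(- b)%R, b]) ((w b)%:num)%:E)%E).
  apply: ge0_le_integral => //.
  - by apply/measurable_EFinP; apply: measurable_funTS; exact: measurable_weight.
  move=> t; rewrite /= in_itv/= => /andP[_ tb]; rewrite lee_fin.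
  have [t0|t0] := ltP t 0; first by rewrite -/(weight t) weight_neg.
  by rewrite -/(weight t) weightE//; exact: filling_nd.
by rewrite integral_itv_cst ?ltry// ge0_cp.
Qed.

Lemma sigma_finite_weight : sigma_finite [set: measurableTypeR R] (wm mw).
Proof.
exists (fun n : nat => `[- n%:R, n%:R]%classic).
  apply/seteqP; split => // t _; have [n tn] : exists n : nat, `|t| <= n%:R.
    by exists (Num.truncn `|t|).+1; apply/ltW; exact: Num.Theory.truncnS_gt.
  by exists n => //=; rewrite in_itv/= -ler_norml.
by move=> n; split => //; exact: weight_lty.
Qed.

(** ** Borel and Caratheodory sets *)

Lemma dist_sym {T : Type} (d : T -> T -> R) x y : pseudo d -> d x y = d y x.
Proof. by case. Qed.

Lemma dopen_oball {T : Type} (d : T -> T -> R) x r : pseudo d -> dopen d (oball d x r).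
Proof.
move=> [_ _ dt] y xy; exists (r - d x y); first by rewrite subr_gt0.
by move=> z; rewrite /oball /= ltrBrDl => h; apply: le_lt_trans h; exact: dt.
Qed.

Lemma dborel_cara (Z : mmdata R) (A : set Z) : metric_measure_space Z ->
  dborel (dist Z) A -> measurable (A : set (cara Z)).
Proof. by move=> [_ _ [bc _] _] /bc. Qed.

Lemma oball_cara (y : Y) r : measurable (oball (dist Y) y r : set (cara Y)).
Proof.
apply: dborel_cara (filling_mm F) _; apply: sub_sigma_algebra; exact: dopen_oball.
Qed.

Lemma oball_lty (y : Y) r : (mmeas Y (oball (dist Y) y r) < +oo)%E.
Proof.
have [r0|r0] := ltP 0 r.
  by have [_ _ _ /(_ y r r0)/andP[]] := filling_mm F.
rewrite (_ : oball _ _ _ = set0) ?measure0 ?ltry//; apply/seteqP; split => // z.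
rewrite /oball /= => h; have := pseudo_ge0 y z pdY; lra.
Qed.

Lemma sigma_finite_mmeas : sigma_finite [set: cara Y] (mmeas Y).
Proof.
exists (fun n : nat => oball (dist Y) point n%:R).
  apply/seteqP; split => // y _.
  by exists (Num.truncn (dist Y point y)).+1 => //; exact: Num.Theory.truncnS_gt.
by move=> n; split; [exact: oball_cara|exact: oball_lty].
Qed.

Local Notation T := (measurableTypeR R * cara Y)%type.
Definition fmeas : {measure set T -> \bar R} := wY sigma_finite_weight sigma_finite_mmeas.
Definition fsec : H -> T := @wsec R w Y N phi.

Lemma filling_carried : carried fmeas fsec.
Proof. exact: (carried_warped _ _ W). Qed.

Lemma sigma_finite_fmeas : sigma_finite [set: T] fmeas.
Proof.
have /sigma_finiteP[A [AT ndA Aoo]] :=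
  sigma_finiteT (@sigma_finite_pack _ (measurableTypeR R) R (wm mw) sigma_finite_weight).
have /sigma_finiteP[B [BT ndB Boo]] :=
  sigma_finiteT (@sigma_finite_pack _ (cara Y) R (mmeas Y) sigma_finite_mmeas).
exists (fun n => A n `*` B n).
  rewrite -setXTT AT BT; apply/seteqP; split => [[x y] [/= [n _ Anx] [k _ Bky]]|[x y]].
    exists (maxn n k) => //; split.
    - by move: x Anx; exact/subsetPset/ndA/leq_maxl.
    - by move: y Bky; exact/subsetPset/ndB/leq_maxr.
  by move=> [n _ [/= ? ?]]; split; exists n.
move=> k; have [? Ak] := Aoo k; have [? Bk] := Boo k.
split; first exact: measurableX.
rewrite [ltLHS]wY_rect//.
by rewrite lte_mul_pinfty// ?ge0_fin_numE// measure_ge0.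
Qed.

Lemma wpt_normr t (y : Y) : pt `|t| y = pt t y.
Proof.
rewrite /wpt; congr (warped_proj _ _ (_, _)); apply: val_inj => /=.
by rewrite normr_id.
Qed.

Lemma dist_wpt_le t t' (y y' : Y) :
  dist H (pt t y) (pt t' y') <= `|t - t'| + Phi `|t| * dist Y y y'.
Proof.
have [_ _ dt] := pseudo_dist (N := N) w W.
apply: le_trans (dt _ (pt t y') _) _; rewrite addrC lerD//.
  rewrite -(wpt_normr t) -(wpt_normr t') (dist_vertical w W)//.
  exact: ler_dist_dist.
by rewrite -(wpt_normr t y) -(wpt_normr t y') (dist_horizontal w W).
Qed.

Lemma dopen_slice (U : set H) t : dopen (dist H) U -> dopen (dist Y) [set y | U (pt t y)].
Proof.
move=> oU y /oU[e e0 eU]; have P0 := warping_ge0 W (normr_ge0 t).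
exists (e / (Phi `|t| + 1)); first by rewrite divr_gt0// ltr_wpDl.
move=> z; rewrite /oball /= => yz; apply: eU; apply: le_lt_trans (dist_wpt_le _ _ _ _) _.
rewrite subrr normr0 add0r; move: yz; rewrite ltr_pdivlMr ?ltr_wpDl// mulrC.
have := pseudo_ge0 y z pdY; lra.
Qed.

(** The slice at height t is a continuous map from Y, by dist_wpt_le. *)
Lemma measurable_slice t : measurable_fun [set: borelT Y] (pt t : borelT Y -> borelT H).
Proof.
apply: (@measurability _ _ (borelT Y) (borelT H) setT (pt t) (dopen (dist H)) erefl).
move=> _ [U oU <-]; rewrite setTI; apply: sub_sigma_algebra; exact: dopen_slice.
Qed.

(** An open set is a countable union of boxes, by separability of Y. *)
Lemma measurable_open_coordinates (U : set H) : dopen (dist H) U ->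
  measurable ([set z : R * Y | U (pt z.1 z.2)] : set T).
Proof.
move=> oU; have [_ [D cD dD] _ _] := filling_mm F.
have [e eD] := countable_enum cD.
pose box (n : nat) : set T :=
  if unpickle n is Some (k, q, r) then
    let B := (ball (ratr q : R) (ratr r : R) `*` oball (dist Y) (e k) (ratr r)) in
    if `[< B `<=` [set z | U (pt z.1 z.2)] >] then B else set0
  else set0.
rewrite (_ : [set z | _] = \bigcup_n box n).
  apply: bigcup_measurable => n _; rewrite /box; case: unpickle => [[[k q] r]|] //.
  case: ifPn => // _; apply: measurableX; last exact: oball_cara.
  exact: measurable_ball.
apply/seteqP; split => [[t y] /= Uty|[t y] [n _]]; last first.
  rewrite /box; case: unpickle => [[[k q] r]|] //=.
  by case: ifPn => // /asboolP BU /BU.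
have [e0 e00 eU] := oU _ Uty; have P0 := warping_ge0 W (normr_ge0 t).
have c0 : 0 < 2 + 2 * Phi `|t| by lra.
have := @rat_in_itvoo R 0 (e0 / (2 + 2 * Phi `|t|)).
rewrite divr_gt0// => /(_ isT)[r]; rewrite in_itv/= => /andP[r0 re].
have [y' Dy' yy'] := dD y _ r0.
have [k ky'] := eD _ Dy'.
have := @rat_in_itvoo R (t - ratr r) (t + ratr r).
rewrite ltrD2l gt0_cp// => /(_ isT)[q]; rewrite in_itv/= => /andP[q1 q2].
exists (pickle (k, q, r)) => //; rewrite /box pickleK.
have in_B : (ball (ratr q : R) (ratr r : R) `*` oball (dist Y) (e k) (ratr r)) (t, y).
  split => /=; first by rewrite /ball /= ltr_norml; apply/andP; split; lra.
  by rewrite /oball /= ky' (dist_sym _ _ pdY).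
rewrite ifT//; apply/asboolP => -[t' y'']; rewrite /ball /oball /= => -[qt ey].
apply: eU; rewrite /oball /=; apply: le_lt_trans (dist_wpt_le _ _ _ _) _.
have d1 : dist Y y y'' < 2 * ratr r.
  have [_ _ dt] := pdY; apply: le_lt_trans (dt _ y' _) _.
  by rewrite ky' in ey; lra.
have d2 : `|t - t'| < 2 * ratr r.
  by move: qt; rewrite !ltr_norml => /andP[? ?]; apply/andP; split; lra.
have := ler_wpM2l P0 (ltW d1); move: re; rewrite ltr_pdivlMr//.
lra.
Qed.

Lemma measurable_coordinates : measurable_fun [set: T]
  ((fun z => pt z.1 z.2) : T -> borelT H).
Proof.
apply: (@measurability _ _ T (borelT H) setT _ (dopen (dist H)) erefl).
move=> _ [U oU <-]; rewrite setTI; exact: measurable_open_coordinates.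
Qed.

Lemma borel_coordinates (g : H -> \bar R) :
  measurable_fun [set: borelT H] (g : borelT H -> \bar R) ->
  measurable_fun [set: T] (fun z : T => g (pt z.1 z.2)).
Proof. by move=> mg; exact: measurableT_comp measurable_coordinates. Qed.

Lemma borel_slice (g : H -> \bar R) t :
  measurable_fun [set: borelT H] (g : borelT H -> \bar R) ->
  measurable_fun [set: borelT Y] ((fun y => g (pt t y)) : borelT Y -> \bar R).
Proof. by move=> mg; exact: measurableT_comp (measurable_slice t). Qed.

Lemma borel_mmeasurable (g : H -> \bar R) :
  measurable_fun [set: borelT H] (g : borelT H -> \bar R) -> mmeasurable H g.
Proof.
move=> mg; have := measurableT_comp (borel_coordinates mg) (measurable_section filling_carried).
by apply: eq_measurable_fun => h _; rewrite /= wptK.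
Qed.

Lemma oball_caraH (P : H) r : measurable (oball (dist H) P r : set (cara H)).
Proof.
have oU : dopen (dist H) (oball (dist H) P r).
  by apply: dopen_oball; exact: (pseudo_dist (N := N) w W).
have := measurable_section filling_carried measurableT (measurable_open_coordinates oU).
by rewrite setTI; congr measurable; apply/seteqP; split => h; rewrite /= wptK.
Qed.

(** ** Iterated integrals *)

Lemma integral_weight (f : measurableTypeR R -> \bar R) :
  measurable_fun [set: measurableTypeR R] f -> (forall t, 0 <= f t)%E ->
  (\int[@sigma_finite_pack _ (measurableTypeR R) R (wm mw) sigma_finite_weight]_t f t =
   \int[mu]_t (f t * (weight t)%:E))%E.
Proof.
exact: (@ge0_integral_density _ (measurableTypeR R) R mu
  (@sigma_finite_pack _ (measurableTypeR R) R (wm mw) sigma_finite_weight)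
  weight measurable_weight weight_ge0 (wmE mw)).
Qed.

Lemma fmeas12 (f : T -> \bar R) : measurable_fun [set: T] f -> (forall z, 0 <= f z)%E ->
  (\int[fmeas]_z f z = \int[mu]_t ((\int[mmeas Y]_y f (t, y)) * (weight t)%:E))%E.
Proof.
move=> mf f0; rewrite /fmeas /wY fubini_tonelli1// integral_weight//.
- exact: (@measurable_fun_fubini_tonelli_F _ _ _ _ R
    (@sigma_finite_pack _ (cara Y) R (mmeas Y) sigma_finite_mmeas) f mf f0).
- by move=> t; exact: integral_ge0.
Qed.

Lemma fmeas21 (f : T -> \bar R) : measurable_fun [set: T] f -> (forall z, 0 <= f z)%E ->
  (\int[fmeas]_z f z = \int[mmeas Y]_y \int[mu]_t (f (t, y) * (weight t)%:E))%E.
Proof.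
move=> mf f0; rewrite /fmeas /wY fubini_tonelli2//.
apply: eq_integral => y _; rewrite /fubini_G integral_weight//.
exact: (measurableT_comp mf (pair2_measurable y)).
Qed.

Lemma measurable_fiber_integral (f : T -> \bar R) :
  measurable_fun [set: T] f -> (forall z, 0 <= f z)%E ->
  measurable_fun [set: cara Y] (fun y => \int[mu]_t (f (t, y) * (weight t)%:E))%E.
Proof.
move=> mf f0; have := @measurable_fun_fubini_tonelli_G _ _ (measurableTypeR R) (cara Y) R
  (@sigma_finite_pack _ (measurableTypeR R) R (wm mw) sigma_finite_weight) f mf f0.
apply: eq_measurable_fun => y _; rewrite /fubini_G integral_weight//.
exact: (measurableT_comp mf (pair2_measurable y)).
Qed.

Lemma measurable_slice_integral (f : T -> \bar R) :
  measurable_fun [set: T] f -> (forall z, 0 <= f z)%E ->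
  measurable_fun [set: R] (fun t => (\int[mmeas Y]_y f (t, y)) * (weight t)%:E)%E.
Proof.
move=> mf f0; apply: emeasurable_funM; last first.
  by apply/measurable_EFinP; exact: measurable_weight.
exact: (@measurable_fun_fubini_tonelli_F _ _ (measurableTypeR R) (cara Y) R
  (@sigma_finite_pack _ (cara Y) R (mmeas Y) sigma_finite_mmeas) f mf f0).
Qed.

Let mslice (M : set T) : measurable M -> measurable_fun [set: T] (fun z => (\1_M z : R)%:E).
Proof. by move=> mM; apply/measurable_EFinP; exact: measurable_indic. Qed.

Lemma fmeas_null1 (M : set T) : measurable M -> fmeas M = 0%E ->
  {ae mu, forall t, 0 < t -> mmeas Y (xsection M t) = 0%E}.
Proof.
move=> mM M0.
have := fmeas12 (mslice mM) (fun z => ltac:(by rewrite lee_fin)).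
rewrite integral_indic// setIT M0 => E0.
have sliceE t : (\int[mmeas Y]_y (\1_M (t, y))%:E = mmeas Y (xsection M t))%E.
  rewrite -[X in mmeas Y X]setIT -integral_indic//; last exact: measurable_xsection.
  by apply: eq_integral => y _; rewrite !indicE mem_xsection.
have mk : measurable_fun [set: R] (fun t => mmeas Y (xsection M t) * (weight t)%:E)%E.
  have := measurable_slice_integral (mslice mM) (fun z => ltac:(by rewrite lee_fin)).
  by apply: eq_measurable_fun => t _; rewrite sliceE.
have /(ae_eq_integral_abs mu measurableT mk) : (\int[mu]_t `|mmeas Y (xsection M t) * (weight t)%:E| = 0)%E.
  rewrite [RHS]E0; apply: eq_integral => t _; rewrite sliceE gee0_abs// mule_ge0//.
  by rewrite lee_fin weight_ge0.
apply: filterS => t /(_ I) /eqP; rewrite mule_eq0 => /orP[/eqP //|].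
by move=> + t0; rewrite eqe weightE ?(ltW t0)// gt_eqF// (filling_gt0 F).
Qed.

Lemma fmeas_null2 (M : set T) : measurable M -> fmeas M = 0%E ->
  {ae mmeas Y, forall y : cara Y, {ae mu, forall t, 0 < t -> ~ M (t, y)}}.
Proof.
move=> mM M0.
have := fmeas21 (mslice mM) (fun z => ltac:(by rewrite lee_fin)).
rewrite integral_indic// setIT M0 => E0.
pose f y := (\int[mu]_t ((\1_M (t, y))%:E * (weight t)%:E))%E.
have f0 y : (0 <= f y)%E by apply: integral_ge0 => t _; rewrite mule_ge0 ?lee_fin ?weight_ge0.
have my y : measurable_fun [set: measurableTypeR R] (fun t => (\1_M (t, y) : R)%:E).
  exact: (measurableT_comp (mslice mM) (pair2_measurable y)).
have mf : measurable_fun [set: cara Y] f.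
  by apply: (measurable_fiber_integral (mslice mM)) => z; rewrite lee_fin.
have /(ae_eq_integral_abs (mmeas Y) measurableT mf) : (\int[mmeas Y]_y `|f y| = 0)%E.
  by rewrite [RHS]E0; apply: eq_integral => y _; rewrite gee0_abs.
apply: filterS => y /(_ I) fy0.
have mk : measurable_fun [set: R] (fun t => (\1_M (t, y))%:E * (weight t)%:E)%E.
  by apply: emeasurable_funM; [exact: my|apply/measurable_EFinP; exact: measurable_weight].
have /(ae_eq_integral_abs mu measurableT mk) : (\int[mu]_t `|(\1_M (t, y))%:E * (weight t)%:E| = 0)%E.
  rewrite -[RHS]fy0; apply: eq_integral => t _; rewrite gee0_abs// mule_ge0// lee_fin//.
  exact: weight_ge0.
apply: filterS => t /(_ I) /eqP + t0 Mt; rewrite indicE mem_set// mul1e eqe weightE ?(ltW t0)//.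
by rewrite gt_eqF// (filling_gt0 F).
Qed.

End filling.

(** * Upper gradients along vertical and horizontal curves *)

Lemma ae_lty {d} {T : measurableType d} {R : realType} (m : {measure set T -> \bar R})
    (f : T -> \bar R) : measurable_fun [set: T] f -> (forall x, 0 <= f x)%E ->
  (\int[m]_x f x < +oo)%E -> {ae m, forall x, (f x < +oo)%E}.
Proof.
move=> mf f0 foo.
have fi : m.-integrable setT f.
  by apply/integrableP; split => //; under eq_integral do rewrite gee0_abs//.
have := integrable_ae measurableT fi.
by apply: filterS => x /(_ I); rewrite ge0_fin_numE.
Qed.

Lemma ae_exists {d} {T : measurableType d} {R : realType} (m : {measure set T -> \bar R})
    (A : set T) (P : T -> Prop) : measurable A -> (0 < m A)%E ->
  {ae m, forall x, P x} -> exists2 x, A x & P x.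
Proof.
move=> mA A0 [M [mM M0 PM]]; apply: contrapT => nP.
move: A0; apply/negP; rewrite -leNgt -M0; apply: le_measure; rewrite ?inE//.
by move=> x Ax; apply: PM => /= Px; apply: nP; exists x.
Qed.

Section line_integrals.
Context {R : realType} {T : Type}.
Local Notation mu := (@lebesgue_measure R).

Lemma line_integral_ae_speed (d : T -> T -> R) a b g h (rho : T -> \bar R) :
  (forall z, 0 <= rho z)%E -> (forall t, 0 <= h t) -> ae_speed d a b g h ->
  line_integral d a b g rho = (\int[mu]_(t in `[a, b]) (rho (g t) * (h t)%:E))%E.
Proof.
move=> r0 h0 hs; have [M [mM M0 hM]] : exists M : set (measurableTypeR R),
    [/\ measurable M, mu M = 0%E & forall t, a <= t <= b -> ~ M t ->
      a < t < b /\ has_speed d a b g t (h t)].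
  apply: ae_open_itv; move: hs.
  by apply: filterS => [|t H tab]; [exact: (ae_filter_ringOfSetsType mu)|split => //; exact: H].
apply: (ae_eq_integral_nomeas mM M0); first by move=> t _; rewrite mule_ge0 ?lee_fin.
move=> t; rewrite /= in_itv/= => tab Mt; have [tab' sp] := hM t tab Mt.
by rewrite (has_speed_speed tab' sp).
Qed.

End line_integrals.

Section filling_gradients.
Context {R : realType} (N : R * R -> R) (w : R -> {nonneg R}) (Y : mmdata R)
        (phi : @halfline R -> {nonneg R}) (Phi : R -> R) (beta : R).
Local Notation mu := (@lebesgue_measure R).
Local Notation Hl := (@whalfline R w).
Local Notation H := (@warped R N Hl Y phi).
Local Notation pt := (@wpt R N w Y phi).
Hypothesis W : warping N Y phi Phi.
Let pdY : pseudo (dist Y). Proof. exact: metric_pseudo (warping_dY W). Qed.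
Let pdH : pseudo (dist H). Proof. exact: (pseudo_dist (N := N) w W). Qed.
Context (u g : H -> \bar R).
Hypothesis ug : upper_gradient H u g.

(** Vertical lines have speed 1. *)
Lemma vertical_gradient (y : Y) s t : 0 <= s -> s < t ->
  (`|u (pt t y) - u (pt s y)| <= \int[mu]_(r in `[s, t]) g (pt r y))%E.
Proof.
move=> s0 st'; have st := ltW st'; have [g0 _ gP] := ug; pose c r := pt r y.
have cd x z : 0 <= x -> 0 <= z -> dist H (c x) (c z) = `|x - z|.
  by move=> x0 z0; rewrite (dist_vertical w W).
have sb : speed_bound (dist H) s t c (fun=> 1).
  apply: speed_bound_lip => // x z sx xz zt.
  have x0 := le_trans s0 sx; have z0 := le_trans x0 xz.
  by rewrite mul1r (cd _ _ x0 z0) distrC ger0_norm// subr_ge0.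
have := gP s t c (ac_path_of_bound pdH st sb).
rewrite (@line_integral_ae_speed _ _ _ _ _ _ (fun=> 1))//.
  under eq_integral do rewrite mule1.
  apply; exists s, t; rewrite !lexx st; split => // E.
  have := cd s t s0 (le_trans s0 st); rewrite E; have [-> _ _] := pdH.
  by move/esym/eqP; rewrite normr_eq0 subr_eq0 lt_eqF.
apply: aeW => x /andP[sx xt] e e0; exists 1 => // z /andP[sz zt] _.
have x0 := le_trans s0 (ltW sx); have z0 := le_trans s0 sz.
by rewrite (cd _ _ z0 x0) mul1r subrr normr0 mulr_ge0// ltW.
Qed.

(** The slice at height t is a Phi t-Lipschitz copy of Y, so the speed of a curve in Y
    increases by at most this factor. *)
Lemma horizontal_gradient t : 0 < t ->
  (measurable_fun [set: borelT Y] ((fun y => g (pt t y)) : borelT Y -> \bar R)) ->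
  upper_gradient Y (fun y => u (pt t y)) (fun y => (Phi t)%:E * g (pt t y))%E.
Proof.
move=> t0 mgt; have [g0 _ gP] := ug; have P0 := warping_ge0 W (ltW t0).
split => [y||a b c acc [s1 [s2 [s1ab s2ab cne]]]].
- by rewrite mule_ge0 ?lee_fin.
- by apply: emeasurable_funM => //; exact: measurable_cst.
have [h hb hs] := ac_path_speed pdY acc; have [mh h0 hf hd] := hb.
have ab : a <= b by case: acc => -[[]].
have sb : speed_bound (dist H) a b (pt t \o c) (fun r => Phi t * h r).
  have IE x z : (\int[mu]_(r in `[x, z]) (Phi t * h r)%:E =
      (Phi t)%:E * \int[mu]_(r in `[x, z]) (h r)%:E)%E.
    under eq_integral do rewrite EFinM.
    rewrite ge0_integralZl ?lee_fin// => [|r _]; last by rewrite lee_fin.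
    by apply/measurable_EFinP; exact: measurable_funTS.
  split => [|r||x z ax xz zb].
  - by apply: measurable_funM => //; exact: measurable_cst.
  - by rewrite mulr_ge0.
  - by rewrite IE lte_mul_pinfty// lee_fin.
  rewrite IE; apply: (@le_trans _ _ ((Phi t)%:E * (dist Y (c x) (c z))%:E)%E).
    by rewrite -EFinM lee_fin; exact: (dist_horizontal w W _ _ (ltW t0)).
  by rewrite lee_wpmul2l ?lee_fin//; exact: hd.
have acH := ac_path_of_bound pdH ab sb.
have [h' hb' hs'] := ac_path_speed pdH acH; have [_ h'0 _ _] := hb'.
have -> : line_integral (dist Y) a b c (fun y => (Phi t)%:E * g (pt t y))%E =
    (\int[mu]_(r in `[a, b]) ((Phi t)%:E * g (pt t (c r)) * (h r)%:E))%E.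
  by apply: line_integral_ae_speed => // y; rewrite mule_ge0 ?lee_fin.
apply: le_trans (gP a b (pt t \o c) acH _) _.
  exists s1, s2; split => // E; apply: cne.
  by rewrite -(wfib_wpt w W (c s1) t0) -(wfib_wpt w W (c s2) t0); congr wfib.
rewrite (line_integral_ae_speed (h := h'))//.
have [M [mM M0 hM]] : exists M : set (measurableTypeR R), [/\ measurable M, mu M = 0%E &
    forall r, a <= r <= b -> ~ M r -> h' r <= Phi t * h r].
  apply: ae_open_itv; have FF := ae_filter_ringOfSetsType mu.
  move: hs hs'; apply: filterS2 => r hr hr' arb.
  apply: (has_speed_mono P0 arb (hr arb) (hr' arb)) => z _.
  exact: (dist_horizontal w W _ _ (ltW t0)).
apply: (ge0_ae_le_integral_nomeas mM M0).
- by move=> r _; rewrite mule_ge0 ?lee_fin.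
- by move=> r _; rewrite !mule_ge0 ?lee_fin.
move=> r; rewrite /= in_itv/= => rab Mr.
rewrite [leRHS](_ : _ = g (pt t (c r)) * (Phi t * h r)%:E)%E; last first.
  by rewrite EFinM muleA [((Phi t)%:E * _)%E]muleC.
by rewrite lee_wpmul2l// lee_fin hM.
Qed.

End filling_gradients.

(** * Gluing local constants *)

Lemma clamp_lip {R : realType} (l s t : R) :
  `|Num.max 0 (Num.min s l) - Num.max 0 (Num.min t l)| <= `|s - t|.
Proof.
have mx (a b : R) : `|Num.max 0 a - Num.max 0 b| <= `|a - b|.
  rewrite !maxEle; do 2?case: ifPn; rewrite -?ltNge => ? ?;
  by rewrite ler_norml; case: (ler0P (a - b)) => ?; apply/andP; split; lra.
apply: (le_trans (mx _ _)); rewrite !minEle; do 2?case: ifPn; rewrite -?ltNge => ? ?;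
by rewrite ler_norml; case: (ler0P (s - t)) => ?; apply/andP; split; lra.
Qed.

Section gluing.
Context {R : realType} (Y : mmdata R).
Hypothesis mmY : metric_measure_space Y.
Hypothesis lY : length_space (dist Y).
Let pdY : pseudo (dist Y). Proof. by have [dY _ _ _] := mmY; exact: metric_pseudo. Qed.

(** Along a curve the function is locally constant, hence has derivative 0. *)
Lemma locally_constant (k r : Y -> R) : (forall x, 0 < r x) ->
  (forall x y, oball (dist Y) x (r x) y -> k y = k x) -> forall x y, k x = k y.
Proof.
move=> r0 kr x y; have [dY _ _ _] := mmY.
have [l [c [_ l0 <- <- cl]]] := length_space_lip x y dY lY ltr01.
pose cut (s : R) := Num.max 0 (Num.min s l).
have cut_in s : 0 <= cut s <= l by rewrite /cut le_max lexx ge_max l0 ge_min lexx orbT.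
have <- : cut 0 = 0 by rewrite /cut (min_idPl l0) maxxx.
have <- : cut l = l by rewrite /cut minxx (max_idPr l0).
pose f s := k (c (cut s)); rewrite -/(f 0) -/(f l).
apply: (@is_derive_0_is_cst R f) => s.
apply: (@near_eq_is_derive _ _ _ (cst (f s)) f) => //.
  near=> t; rewrite /= /f; apply/esym/kr; rewrite /oball /=.
  apply: (@le_lt_trans _ _ `|cut s - cut t|).
    have [/andP[s0 sl] /andP[t0 tl]] := (cut_in s, cut_in t).
    have [st|ts] := leP (cut s) (cut t).
      by rewrite distrC ger0_norm ?subr_ge0//; exact: cl.
    have -> : dist Y (c (cut s)) (c (cut t)) = dist Y (c (cut t)) (c (cut s)) by case: pdY.
    by rewrite gtr0_norm ?subr_gt0//; apply: cl => //; exact: ltW.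
  apply: le_lt_trans (clamp_lip _ _ _) _.
  near: t; apply: (@cvgr_dist_lt _ R^o) => //; exact: cvg_id.
Unshelve. all: by end_near. Qed.

(** By separability, A is covered by countably many of the balls with rational radii and
    centres in a countable dense set that meet A in a null set. *)
Lemma null_cover (A : set Y) :
  (forall x, exists2 r, 0 < r & mass Y (oball (dist Y) x r `&` A) = 0%E) -> mass Y A = 0%E.
Proof.
move=> loc; have [_ [D cD dD] _ _] := mmY; have [e eD] := countable_enum cD.
pose box (n : nat) : set Y :=
  if unpickle n is Some (k, q) then
    let B := oball (dist Y) (e k) (ratr q) `&` A in
    if `[< mass Y B = 0%E >] then B else set0
  else set0.
have box0 n : mass Y (box n) = 0%E.
  rewrite /box; case: unpickle => [[k q]|]; last exact: outer_measure0.
  by case: ifPn => [/asboolP//|_]; exact: outer_measure0.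
apply/eqP; rewrite eq_le outer_measure_ge0 andbT.
apply: (@le_trans _ _ (mass Y (\bigcup_n box n))); last first.
  apply: le_trans (outer_measure_sigma_subadditive _ _) _.
  by rewrite eseries0.
apply: le_outer_measure => x Ax; have [r r0 rA] := loc x.
have := @rat_in_itvoo R 0 (r / 2); rewrite divr_gt0// => /(_ isT)[q].
rewrite in_itv/= => /andP[q0 qr]; have [y Dy xy] := dD x _ q0; have [k ky] := eD _ Dy.
have [_ ds dt] := pdY.
exists (pickle (k, q)) => //; rewrite /box pickleK ifT.
  by split => //; rewrite /oball /= ky ds.
apply/asboolP/eqP; rewrite eq_le outer_measure_ge0 andbT -rA.
apply: le_outer_measure => z [+ Az]; rewrite /oball /= ky => yz; split => //.
by apply: le_lt_trans (dt _ y _) _; lra.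
Qed.

(** Two overlapping balls contain a common ball, which has positive mass and hence a point
    where L holds with both constants. *)
Lemma glue_constants (L : Y -> R -> Prop) :
  (forall y k k', L y k -> L y k' -> k = k') ->
  (forall x, exists r k, 0 < r /\ mass Y (oball (dist Y) x r `&` [set y | ~ L y k]) = 0%E) ->
  exists k, mass Y [set y | ~ L y k] = 0%E.
Proof.
move=> Lu /choice[r] /choice[k rk].
have loc x y : oball (dist Y) x (r x) y -> k y = k x.
  move=> xy; have [rx0 Bx] := rk x; have [ry0 By] := rk y.
  pose e := Num.min (r y) (r x - dist Y x y).
  have e0 : 0 < e by rewrite lt_min ry0 subr_gt0.
  have [_ _ _ /(_ y e e0)/andP[pos _]] := mmY.
  apply: contrapT => nk; move: pos; apply/negP; rewrite -leNgt.
  rewrite -[leRHS]adde0 -{1}Bx -By.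
  apply: le_trans (outer_measureU2 _ _ _); apply: le_outer_measure => z.
  rewrite /oball /e /= lt_min => /andP[zy zx]; have [Lx|nLx] := pselect (L z (k x)).
    by right; split => // Ly; apply: nk; exact: Lu Ly Lx.
  left; split => //=; have [_ _ dt] := pdY; apply: le_lt_trans (dt _ y _) _; lra.
have kc := locally_constant (fun x => (rk x).1) loc.
exists (k point); apply: null_cover => x; exists (r x); first by have [] := rk x.
by rewrite (kc point x); have [] := rk x.
Qed.

End gluing.

(** * The Sobolev-Poincare inequality on a filling *)

Section power_norms.
Context {d} {T : measurableType d} {R : realType} (m : {measure set T -> \bar R}).
Implicit Types (f g : T -> \bar R) (p C : R).
Local Open Scope ereal_scope.

Lemma le_poweR (x y : \bar R) p : (0 <= p)%R -> 0 <= x -> x <= y -> x `^ p <= y `^ p.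
Proof.
move=> p0 x0 xy; apply: (gt0_ler_poweR p0) => //; rewrite in_itv/= leey andbT//.
exact: le_trans xy.
Qed.

Lemma Lnorm_lty f p : (0 < p)%R -> 'N[m]_(p%:E)[f] < +oo <-> \int[m]_x (`|f x| `^ p) < +oo.
Proof.
move=> p0; have pn : p != 0%R by rewrite gt_eqF.
by rewrite -poweR_Lnorm//; split => [/(poweR_lty p)|/(lty_poweRy pn)].
Qed.

Lemma Lnorm_le_mul f g p C : (0 < p)%R -> (0 <= C)%R ->
  'N[m]_(p%:E)[f] <= C%:E * 'N[m]_(p%:E)[g] <->
  \int[m]_x (`|f x| `^ p) <= (C `^ p)%:E * \int[m]_x (`|g x| `^ p).
Proof.
move=> p0 C0; have pn : p != 0%R by rewrite gt_eqF.
have CN0 : 0 <= C%:E * 'N[m]_(p%:E)[g] by rewrite mule_ge0 ?lee_fin ?Lnorm_ge0.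
have E : (C `^ p)%:E * \int[m]_x (`|g x| `^ p) = (C%:E * 'N[m]_(p%:E)[g]) `^ p.
  by rewrite poweRM ?lee_fin ?Lnorm_ge0// poweR_EFin poweR_Lnorm.
rewrite E -poweR_Lnorm//; split => [h|/le_poweR].
  by apply: le_poweR => //; [exact: ltW|exact: Lnorm_ge0].
have pV : (0 <= p^-1)%R by rewrite invr_ge0 ltW.
move=> /(_ _ pV (poweR_ge0 _ _)); rewrite -!poweRrM divff// !poweRe1//.
exact: Lnorm_ge0.
Qed.

End power_norms.

(** Otherwise f > e almost everywhere on a half-line. *)
Lemma small_value {R : realType} (f : R -> \bar R) (P : R -> Prop) (T e : R) :
  (forall t, 0 <= f t)%E -> (\int[@lebesgue_measure R]_t f t < +oo)%E ->
  {ae @lebesgue_measure R, forall t, P t} -> 0 < e ->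
  exists t, [/\ T <= t, P t & (f t <= e%:E)%E].
Proof.
move=> f0 foo [M [mM M0 PM]] e0; apply: contrapT => nP.
have large t : T <= t -> ~ M t -> (e%:E <= f t)%E.
  move=> Tt Mt; rewrite leNgt; apply/negP => /ltW fe; apply: nP; exists t; split => //.
  by apply: contrapT => nPt; apply: Mt; exact: PM.
move: foo; set I := (X in (X < _)%E) => foo.
have I0 : (0 <= I)%E by apply: integral_ge0.
pose n := (fine I + 1) / e.
have n0 : 0 <= n by rewrite divr_ge0 ?addr_ge0 ?fine_ge0// ltW.
have : ((e * (T + n - T))%:E <= I)%E.
  rewrite -integral_itv_cst; last by lra.
  rewrite integral_mkcond; apply: (@ge0_ae_le_integral_nomeas _ _ _ _ _ M) => // t _.
    by rewrite patchE; case: ifPn => // _; rewrite lee_fin ltW.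
  move=> Mt; rewrite patchE; case: ifPn => // /[!inE]/=; rewrite in_itv/= => /andP[Tt _].
  exact: large.
rewrite addrC addKr /n mulrC divfK ?gt_eqF// -[X in (_ <= X)%E]fineK ?ge0_fin_numE//.
rewrite lee_fin; lra.
Qed.

Section filling_poincare.
Context {R : realType} (N : R * R -> R) (w : R -> {nonneg R}) (Y : mmdata R)
        (phi : @halfline R -> {nonneg R}) (Phi : R -> R) (beta : R).
Local Notation mu := (@lebesgue_measure R).
Local Notation Hl := (@whalfline R w).
Local Notation H := (@warped R N Hl Y phi).
Local Notation pt := (@wpt R N w Y phi).
Local Notation T := (measurableTypeR R * cara Y)%type.
Hypothesis F : filling N w Y phi Phi beta.
Let W := filling_warping F.
Local Notation wt := (weight w).
Local Notation nu := (fmeas F).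
Let pdY : pseudo (dist Y). Proof. exact: metric_pseudo (warping_dY W). Qed.

Context (p : R).
Hypothesis p1 : 1 <= p.
Let p0 : 0 < p. Proof. by have p1' := p1; lra. Qed.

Section one_function.
Context (u g : H -> \bar R).
Hypothesis ug : upper_gradient H u g.
Hypothesis gLp : in_Lp H p g.
Let g0 : forall h, (0 <= g h)%E. Proof. by case: ug. Qed.
Let mg : measurable_fun [set: borelT H] (g : borelT H -> \bar R). Proof. by case: ug. Qed.

Definition fiber_energy (y : Y) : \bar R := (\int[mu]_t ((g (pt t y) `^ p) * (wt t)%:E))%E.
Definition fiber_tail (y : Y) (t : R) : \bar R := (\int[mu]_(r in `[t, +oo[) g (pt r y))%E.
Local Notation K := ((p / beta) `^ p).

Let mG : measurable_fun [set: T] (fun z : T => g (pt z.1 z.2)).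
Proof. exact: (borel_coordinates F). Qed.

Let mGp : measurable_fun [set: T] (fun z : T => g (pt z.1 z.2) `^ p)%E.
Proof. exact: measurableT_comp (measurable_poweR p) mG. Qed.

Let mGy y : measurable_fun [set: R] (fun r => g (pt r y)).
Proof.
have h : measurable_fun [set: measurableTypeR R] (fun r => g (pt r y)).
  exact: (measurableT_comp mG (pair2_measurable (y : cara Y))).
exact: h.
Qed.

Let tail_ge0 y t : (0 <= fiber_tail y t)%E.
Proof. exact: integral_ge0. Qed.

Let energy_ge0 y : (0 <= fiber_energy y)%E.
Proof. by apply: integral_ge0 => t _; rewrite mule_ge0 ?poweR_ge0 ?lee_fin ?weight_ge0. Qed.

Let tail_le y s t : s <= t -> (fiber_tail y t <= fiber_tail y s)%E.
Proof.
move=> st; apply: ge0_subset_integral => //.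
- by apply: measurable_funTS; exact: mGy.
by move=> r; rewrite /= !in_itv/= !andbT; exact: le_trans.
Qed.

Lemma energy_total :
  (\int[mmeas H]_(h in [set: cara H]) (g h `^ p) = \int[mmeas Y]_y fiber_energy y)%E.
Proof.
rewrite -(fmeas21 F mGp); last by move=> z; exact: poweR_ge0.
rewrite -(ge0_integral_section (filling_carried F) mGp); last by move=> z; exact: poweR_ge0.
by apply: eq_integral => h _; rewrite /= wptK.
Qed.

Lemma energy_total_slices :
  (\int[mmeas H]_(h in [set: cara H]) (g h `^ p) =
   \int[mu]_t ((\int[mmeas Y]_y (g (pt t y) `^ p)) * (wt t)%:E))%E.
Proof.
rewrite -(fmeas12 F mGp); last by move=> z; exact: poweR_ge0.
rewrite -(ge0_integral_section (filling_carried F) mGp); last by move=> z; exact: poweR_ge0.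
by apply: eq_integral => h _; rewrite /= wptK.
Qed.

Lemma energy_total_lty : (\int[mmeas H]_(h in [set: cara H]) (g h `^ p) < +oo)%E.
Proof.
have := (Lnorm_lty (mmeas H) (g : cara H -> \bar R) p0).1 gLp.
rewrite [X in (X < _)%E -> _](_ : _ = \int[mmeas H]_(h in [set: cara H]) (g h `^ p))%E//.
by apply: eq_integral => h _; rewrite gee0_abs.
Qed.

Lemma measurable_energy : measurable_fun [set: cara Y] fiber_energy.
Proof. by apply: (measurable_fiber_integral F mGp) => z; exact: poweR_ge0. Qed.

Lemma ae_energy : {ae mmeas Y, forall y : cara Y, (fiber_energy y < +oo)%E}.
Proof.
by apply: ae_lty; [exact: measurable_energy|move=> y; exact: energy_ge0|
  rewrite -energy_total; exact: energy_total_lty].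
Qed.

Lemma fiber_hardy y :
  (\int[mu]_t ((fiber_tail y t `^ p) * (wt t)%:E) <= K%:E * fiber_energy y)%E.
Proof.
apply: hardy => //; [exact: filling_beta F|exact: (measurable_weight F)| |].
- exact: weight_ge0.
- by move=> t s; exact: (weight_growth F).
Qed.

(** The tail is nonincreasing, hence dominated by its weighted mean over an interval. *)
Lemma tail_bound y t : 0 < t ->
  ((fiber_tail y t `^ p) * ((w (t / 2))%:num * (t / 2))%:E <= K%:E * fiber_energy y)%E.
Proof.
move=> t0; apply: le_trans (fiber_hardy y).
have -> : t / 2 = t - t / 2 by lra.
have t2 : t / 2 <= t by lra.
have t20 : 0 < t / 2 by lra.
rewrite {1}(_ : t - t / 2 = t / 2); last by lra.
rewrite -integral_itv_cst// -ge0_integralZl//; last exact: poweR_ge0.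
rewrite integral_mkcond; apply: (@ge0_ae_le_integral_nomeas _ _ _ _ _ set0) => // s _.
- by rewrite patchE; case: ifPn => // _; rewrite mule_ge0 ?poweR_ge0 ?lee_fin.
- by rewrite mule_ge0 ?poweR_ge0 ?lee_fin ?weight_ge0.
move=> _; rewrite patchE; case: ifPn => [|_]; last first.
  by rewrite mule_ge0 ?poweR_ge0 ?lee_fin ?weight_ge0.
rewrite inE /= in_itv/= => /andP[ts st].
apply: lee_pmul; rewrite ?poweR_ge0 ?lee_fin//.
  by apply: le_poweR => //; [exact: ltW|exact: tail_le].
by rewrite weightE; [apply: (filling_nd F) => //; lra|lra].
Qed.

Let Kfin y : (fiber_energy y < +oo)%E -> exists2 B : R, 0 <= B & (K%:E * fiber_energy y = B%:E)%E.
Proof.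
move=> yoo; exists (K * fine (fiber_energy y)).
  by rewrite mulr_ge0 ?powR_ge0// fine_ge0.
by rewrite EFinM fineK// ge0_fin_numE.
Qed.

Lemma tail_lty y t : (fiber_energy y < +oo)%E -> 0 < t -> (fiber_tail y t < +oo)%E.
Proof.
move=> /Kfin[B B0 BE] t0; have := tail_bound y t0; rewrite BE.
have c0 : 0 < (w (t / 2))%:num * (t / 2).
  by rewrite mulr_gt0 ?(filling_gt0 F)// divr_gt0.
rewrite ltey => h; apply/eqP => E; move: h; rewrite E poweRyr ?gt_eqF//.
by rewrite gt0_mulye ?lte_fin// leye_eq.
Qed.

(** In tail_bound the factor multiplying the power of the tail grows at least linearly. *)
Lemma tail_small y e : (fiber_energy y < +oo)%E -> 0 < e ->
  exists2 t, 0 < t & forall s, t <= s -> (fiber_tail y s <= e%:E)%E.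
Proof.
move=> yoo e0; have [B B0 BE] := Kfin yoo.
have w1 : 0 < (w 1)%:num by exact: (filling_gt0 F).
have c0 : 0 < e `^ p * (w 1)%:num by rewrite mulr_gt0// powR_gt0.
exists (2 + 2 * (B + 1) / (e `^ p * (w 1)%:num)).
  by rewrite ltr_pwDl// divr_ge0 ?(ltW c0)//; lra.
move=> s; rewrite -lerBrDl ler_pdivrMr// => ts.
have s2 : 2 <= s.
  have : 0 <= (s - 2) * (e `^ p * (w 1)%:num) by lra.
  by rewrite pmulr_lge0//; lra.
have s0 : 0 < s by lra.
rewrite leNgt; apply/negP => es; have := tail_bound y s0; rewrite BE leNgt => /negP; apply.
apply: (@lt_le_trans _ _ ((e `^ p)%:E * ((w 1)%:num * (s / 2))%:E)%E); last first.
  apply: lee_pmul; rewrite ?lee_fin ?powR_ge0 ?mulr_ge0//; first by lra.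
  - by rewrite -poweR_EFin; apply: le_poweR; [exact: ltW|rewrite lee_fin ltW|exact: ltW].
  by rewrite ler_wpM2r//; [lra|apply: (filling_nd F) => //; lra].
rewrite -EFinM lte_fin mulrA mulrCA.
have : 0 <= 2 * (e `^ p * (w 1)%:num) by lra.
rewrite mulrBl in ts; lra.
Qed.

Let fin_sub (x y : \bar R) : (`|x - y| < +oo)%E -> x \is a fin_num /\ y \is a fin_num.
Proof. by case: x => [x||]; case: y => [y||]. Qed.

Lemma fiber_osc y s t : 0 < s -> s < t -> (`|u (pt t y) - u (pt s y)| <= fiber_tail y s)%E.
Proof.
move=> s0 st; apply: le_trans (vertical_gradient W ug y (ltW s0) st) _.
apply: ge0_subset_integral => //; first by apply: measurable_funTS; exact: mGy.
by move=> r; rewrite /= !in_itv/= andbT => /andP[].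
Qed.

Lemma fiber_fin y t : (fiber_energy y < +oo)%E -> 0 < t -> u (pt t y) \is a fin_num.
Proof.
move=> yoo t0; have tt : t < t + 1 by lra.
by have [] := fin_sub (le_lt_trans (fiber_osc y t0 tt) (tail_lty yoo t0)).
Qed.

(** k is the limit of u along the vertical line over y, together with the rate of
    convergence. *)
Definition fiber_limit (y : Y) (k : R) : Prop := (fiber_energy y < +oo)%E /\
  forall t, 0 < t -> (`|u (pt t y) - k%:E| <= fiber_tail y t)%E.

(** The intervals centred at u(t, y) with radius the tail at t meet pairwise, hence all
    contain a common point. *)
Lemma fiber_limit_exists y : (fiber_energy y < +oo)%E -> exists k, fiber_limit y k.
Proof.
move=> yoo; pose v t := fine (u (pt t y)); pose r t := fine (fiber_tail y t).
have vE t : 0 < t -> u (pt t y) = (v t)%:E by move=> t0; rewrite /v fineK// fiber_fin.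
have rE t : 0 < t -> fiber_tail y t = (r t)%:E.
  by move=> t0; rewrite /r fineK// ge0_fin_numE// tail_lty.
have r0 t : 0 <= r t by rewrite fine_ge0.
have osc s t : 0 < s -> s < t -> `|v t - v s| <= r s.
  move=> s0 st; have t0 := lt_trans s0 st.
  by have := fiber_osc y s0 st; rewrite !vE// rE// -EFinB lee_fin.
have meet s t : 0 < s -> 0 < t -> v s - r s <= v t + r t.
  move=> s0 t0; have [st|ts|<-] := ltgtP s t.
  - have := osc s t s0 st; have := r0 t; rewrite ler_norml => ? /andP[]; lra.
  - have := osc t s t0 ts; have := r0 s; rewrite ler_norml => ? /andP[]; lra.
  - by have := r0 s; lra.
pose S := [set v s - r s | s in [set s | 0 < s]].
have Sub t : 0 < t -> ubound S (v t + r t) by move=> t0 _ [s s0 <-]; exact: meet.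
have S0 : S !=set0 by exists (v 1 - r 1), 1 => //=; exact: ltr01.
exists (sup S); split => // t t0; rewrite vE// rE// -EFinB lee_fin.
have h1 : sup S <= v t + r t by apply: ge_sup => //; exact: Sub.
have h2 : v t - r t <= sup S.
  by apply: ub_le_sup; [exists (v 1 + r 1); apply: Sub; exact: ltr01|exists t].
by rewrite ler_norml; apply/andP; split; lra.
Qed.

Lemma fiber_limit_unique y k k' : fiber_limit y k -> fiber_limit y k' -> k = k'.
Proof.
move=> [yoo hk] [_ hk']; apply/eqP; rewrite -subr_eq0 -normr_le0.
apply/ler_addgt0Pr => e e0; rewrite add0r.
have [t t0 /(_ t (lexx t)) small] := tail_small yoo (divr_gt0 e0 (ltr0n _ 2)).
have uf := fiber_fin yoo t0.
have := le_trans (hk t t0) small; have := le_trans (hk' t t0) small.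
rewrite -(fineK uf) -!EFinB !lee_fin !ler_norml => /andP[? ?] /andP[? ?].
by apply/andP; split; lra.
Qed.

End one_function.
End filling_poincare.

(** ** The vertical limit is constant *)

Section filling_limit.
Context {R : realType} (N : R * R -> R) (w : R -> {nonneg R}) (Y : mmdata R)
        (phi : @halfline R -> {nonneg R}) (Phi : R -> R) (beta : R).
Local Notation mu := (@lebesgue_measure R).
Local Notation Hl := (@whalfline R w).
Local Notation H := (@warped R N Hl Y phi).
Local Notation pt := (@wpt R N w Y phi).
Local Notation T := (measurableTypeR R * cara Y)%type.
Hypothesis F : filling N w Y phi Phi beta.
Let W := filling_warping F.
Local Notation wt := (weight w).
Local Notation nu := (fmeas F).
Let mmY := filling_mm F.
Let pdY : pseudo (dist Y). Proof. exact: metric_pseudo (warping_dY W). Qed.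

Context (p : R).
Hypothesis p1 : 1 <= p.
Let p0 : 0 < p. Proof. by have p1' := p1; lra. Qed.

Context (u g : H -> \bar R).
Hypothesis mu_ : mmeasurable H u.
Hypothesis iu : integrable_over_balls H u.

(** In coordinates u is a measurable function f0 off a null set M, and almost every slice
    of M is null. Integrability on balls of Y follows since boxes lie in balls. *)
Lemma ae_slices : {ae mu, forall t, 0 < t ->
  mmeasurable Y (fun y => u (pt t y)) /\ integrable_over_balls Y (fun y => u (pt t y))}.
Proof.
have [f0 [M [mf0 mM M0 uf0]]] :=
  mmeasurable_section (filling_carried F) (sigma_finite_fmeas F) mu_.
pose box (n : nat) : set T := `[0, n%:R]%classic `*` oball (dist Y) point n%:R.
have mbox n : measurable (box n) by apply: measurableX; [exact: measurable_itv|exact: (oball_cara F)].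
pose f n z := (`|f0 z| * (\1_(box n) z)%:E)%E.
have mf n : measurable_fun [set: T] (f n).
  apply: emeasurable_funM; first exact: measurableT_comp.
  by apply/measurable_EFinP; exact: measurable_indic.
have fn0 n z : (0 <= f n z)%E by rewrite mule_ge0 ?lee_fin.
have box_lty n : (\int[nu]_z f n z < +oo)%E.
  have P0 := warping_ge0 W (normr_ge0 (0 : R)).
  pose r : R := n%:R + Phi `|0 : R| * n%:R + 1.
  have r0 : 0 < r by rewrite ltr_wpDl// addr_ge0// mulr_ge0.
  have /integrableP[_] := iu (pt 0 point) r0; apply: le_lt_trans.
  rewrite -(ge0_integral_section (filling_carried F) (mf n) (fn0 n)).
  rewrite [leRHS]integral_mkcond.
  apply: (@ge0_ae_le_integral_nomeas _ _ _ (mmeas H) _ (fsec (w := w) (N := N) (Y := Y) (phi := phi) @^-1` M)) => //.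
  - exact: (carried_caratheodory (filling_carried F)).
  - by rewrite -M0 -(carried_preimage (filling_carried F) mM).
  - by move=> h _; rewrite patchE; case: ifPn.
  move=> h _ Mh; rewrite patchE /f -uf0// indicE.
  have [inb|_] := boolP (fsec h \in box n); last first.
    by rewrite mule0; case: ifPn.
  rewrite mule1 mem_set//; move: inb; rewrite inE => -[/=]; rewrite in_itv/= => /andP[h0 hn].
  rewrite /oball /= => hd; rewrite -(wptK h); apply: le_lt_trans (dist_wpt_le F _ _ _ _) _.
  rewrite sub0r normrN (ger0_norm h0).
  have := ler_wpM2l P0 (ltW hd); rewrite /r; lra.
have aeb : {ae mu, forall t, forall n, ((\int[mmeas Y]_y f n (t, y)) * (wt t)%:E < +oo)%E}.
  apply: ae_foralln => n; apply: ae_lty.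
  - exact: (measurable_slice_integral F (mf n) (fn0 n)).
  - by move=> t; rewrite mule_ge0 ?lee_fin ?weight_ge0// integral_ge0.
  - by rewrite -(fmeas12 F (mf n) (fn0 n)).
have FF := ae_filter_ringOfSetsType mu.
move: (fmeas_null1 mM M0) aeb; apply: filterS2 => t Mt bt t0.
have {}Mt := Mt t0; have mMt := measurable_xsection t mM.
have E y : ~ xsection M t y -> u (pt t y) = f0 (t, y).
  move=> nM; have S : fsec (pt t y) = (t, y).
    by rewrite /fsec /wsec (wht_wpt w W _ (ltW t0)) (wfib_wpt w W _ t0).
  by rewrite uf0 S// => Mty; apply: nM; rewrite /xsection /= inE.
have mut : mmeasurable Y (fun y => u (pt t y)).
  apply: (@ae_measurable_fun _ _ R (mmeas Y) _ _ (fun y => f0 (t, y))).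
  - exact: (@measure_is_complete_caratheodory R Y (mass Y)).
  - exists (xsection M t); split => // y /not_implyP[_ ne].
    by apply: contrapT => nM; apply: ne; rewrite E.
  - exact: (measurableT_comp mf0 (pair1_measurable t)).
split => // x r r0; apply/integrableP; split; first exact: measurable_funTS.
pose b := Num.max t (dist Y point x + r).
have [n bn] : exists n : nat, b < n%:R by exists (Num.truncn b).+1; exact: truncnS_gt.
move: bn; rewrite gt_max => /andP[tn xn].
have wt0 : 0 < wt t by rewrite weightE ?(ltW t0)// (filling_gt0 F).
have fin : (\int[mmeas Y]_y f n (t, y) < +oo)%E.
  have := bt n; rewrite !ltey; apply: contra_neq => ->.
  by rewrite gt0_mulye ?lte_fin.
apply: le_lt_trans fin; rewrite integral_mkcond.
apply: (@ge0_ae_le_integral_nomeas _ _ _ (mmeas Y) _ (xsection M t)) => //.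
- by move=> y _; rewrite patchE; case: ifPn.
move=> y _ nM; rewrite patchE; case: ifPn => // /[!inE] xy.
rewrite /f -E// indicE mem_set ?mule1//; split => /=; first by rewrite in_itv/= !ltW.
have [_ _ dt] := pdY; move: xy; rewrite /oball /= => xy.
apply: le_lt_trans (dt _ x _) _; lra.
Qed.

Hypothesis ug : upper_gradient H u g.
Hypothesis gLp : in_Lp H p g.
Hypothesis WLP : weak_local_poincare Y p p.
Context (T0 : R).
Hypothesis PhiW : forall t, T0 <= t -> Phi t `^ p <= (w t)%:num.

Let g0 : forall h, (0 <= g h)%E. Proof. by case: ug. Qed.
Let mg : measurable_fun [set: borelT H] (g : borelT H -> \bar R). Proof. by case: ug. Qed.
Let slice_energy t : \bar R := ((\int[mmeas Y]_y (g (pt t y) `^ p)) * (wt t)%:E)%E.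

Let mgt t : mmeasurable Y (fun y => g (pt t y)).
Proof.
have mgb := borel_slice F t mg.
move=> _ B mB; have := mgb measurableT B mB; rewrite !setTI => /(dborel_cara mmY).
by [].
Qed.

(** The slice inherits the upper gradient Phi t * g, and Phi t ^ p <= w t bounds its energy
    by the share of the height t in the total energy. *)
Lemma slice_poincare x C r t : 0 < C -> 0 < r -> 0 < t -> T0 <= t ->
  (forall v h, mmeasurable Y v -> integrable_over_balls Y v -> upper_gradient Y v h ->
    let B := oball (dist Y) x r in
    'N[mmeas Y]_(p%:E)[((fun y : cara Y => v y - (average v B)%:E) \_ B)] <=
      C%:E * 'N[mmeas Y]_(p%:E)[(h : cara Y -> \bar R)])%E ->
  mmeasurable Y (fun y => u (pt t y)) -> integrable_over_balls Y (fun y => u (pt t y)) ->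
  exists a : R, (\int[mmeas Y]_y (`|((fun y => u (pt t y) - a%:E) \_ (oball (dist Y) x r)) y| `^ p)
    <= (C `^ p)%:E * slice_energy t)%E.
Proof.
move=> C0 r0 t0 Tt wlp mut iut.
have P0 := warping_ge0 W (ltW t0).
exists (average (fun y => u (pt t y)) (oball (dist Y) x r)).
have hug := horizontal_gradient W ug t0 (borel_slice F t mg).
have := wlp _ _ mut iut hug; move/(Lnorm_le_mul _ _ _ p0 (ltW C0)) => /le_trans; apply.
rewrite lee_wpmul2l ?lee_fin ?powR_ge0//.
under eq_integral do rewrite gee0_abs ?mule_ge0 ?lee_fin// poweRM ?lee_fin// poweR_EFin.
rewrite ge0_integralZl ?lee_fin ?powR_ge0//; last 2 first.
- exact: measurableT_comp (measurable_poweR p) (mgt t).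
- by move=> y _; exact: poweR_ge0.
rewrite /slice_energy muleC lee_wpmul2l ?integral_ge0//.
- by move=> y _; exact: poweR_ge0.
by rewrite lee_fin weightE ?(ltW t0)// PhiW.
Qed.

(** Choose heights t_j tending to infinity with summable slice energies. By the Poincare
    inequality, u (t_j, y) - a_j tends to 0 for almost every y in the ball, for suitable
    constants a_j. As u (t_j, y) tends to the vertical limit at y, so does a_j; hence the
    vertical limit does not depend on y. *)
Lemma limit_locally_constant x : exists r k, 0 < r /\
  mass Y (oball (dist Y) x r `&` [set y | ~ fiber_limit p u g y k]) = 0%E.
Proof.
have [C [r [C0 r0 wlp]]] := WLP x; exists r.
pose B := oball (dist Y) x r; have mB : measurable (B : set (cara Y)) by exact: (oball_cara F).
have Cp0 : 0 < C `^ p by rewrite powR_gt0.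
have energy_lty : (\int[mu]_t slice_energy t < +oo)%E.
  by rewrite -(energy_total_slices F p ug); exact: (energy_total_lty p1 ug gLp).
have slice_energy0 t : (0 <= slice_energy t)%E.
  by rewrite mule_ge0 ?lee_fin ?weight_ge0// integral_ge0// => y _; exact: poweR_ge0.
have step (j : nat) : exists ta : R * R, [/\ 0 < ta.1, j%:R <= ta.1,
    mmeasurable Y (fun y => u (pt ta.1 y)) &
    (\int[mmeas Y]_y (`|((fun y => u (pt ta.1 y) - ta.2%:E) \_ B) y| `^ p)
      <= (1 / (2 ^ j.+1)%:R)%:E)%E].
  have e0 : 0 < (1 / (2 ^ j.+1)%:R) / (C `^ p) :> R.
    by rewrite !divr_gt0// ltr0n expn_gt0.
  have [t [tj sl te]] := small_value (Num.max T0 (j%:R + 1)) slice_energy0 energy_lty ae_slices e0.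
  move: tj; rewrite ge_max => /andP[tT tj].
  have t0 : 0 < t by apply: lt_le_trans tj; rewrite ltr_wpDl.
  have [mut iut] := sl t0; have [a aP] := slice_poincare C0 r0 t0 tT wlp mut iut.
  exists (t, a); split => //=; first by lra.
  apply: le_trans aP _.
  apply: (@le_trans _ _ ((C `^ p)%:E * ((1 / (2 ^ j.+1)%:R) / (C `^ p))%:E)%E).
    by rewrite lee_wpmul2l// lee_fin ltW.
  by rewrite -EFinM lee_fin mulrC divfK// gt_eqF.
have {step} /choice[ta taP] := step.
pose f j y := (`|((fun y => u (pt (ta j).1 y) - (ta j).2%:E) \_ B) y| `^ p)%E.
have f0 j y : (0 <= f j y)%E by exact: poweR_ge0.
have mf j : measurable_fun [set: cara Y] (f j).
  apply: measurableT_comp (measurable_poweR p) _; apply: measurableT_comp => //.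
  apply/(measurable_restrictT _ mB); apply: measurable_funTS.
  by apply: emeasurable_funB => //; have [] := taP j.
have sum_lty : {ae mmeas Y, forall y : cara Y, (\sum_(0 <= j <oo) f j y < +oo)%E}.
  apply: ae_lty.
  - by apply: ge0_emeasurable_sum => // j y _ _; exact: f0.
  - by move=> y; apply: nneseries_ge0 => j _ _; exact: f0.
  rewrite integral_nneseries//; apply: (@le_lt_trans _ _ 1%:E); last exact: ltry.
  apply: le_trans (epsilon_trick0 xpredT ler01); apply: lee_nneseries => [j _ _|j _].
    by apply: integral_ge0 => y _; exact: f0.
  by have [] := taP j.
have lim y k : (\sum_(0 <= j <oo) f j y < +oo)%E -> B y -> fiber_limit p u g y k ->
    forall e, 0 < e -> exists J : nat, forall j, (J <= j)%N -> `|(ta j).2 - k| <= e.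
  move=> soo By Ly e e0; have [yoo yk] := Ly.
  have e20 : 0 < e / 2 by lra.
  have [t t0 small] := tail_small F p1 ug yoo e20.
  have := nneseries_tail_cvg soo (fun j _ => f0 j y).
  have pe0 : 0 < (e / 2) `^ p by rewrite powR_gt0.
  move=> /fine_cvgP[finS /cvgrPdist_le /(_ _ pe0)[J1 _ HJ1]].
  have [J2 tJ2] : exists J2 : nat, t < J2%:R by exists (Num.truncn t).+1; exact: truncnS_gt.
  have [J3 _ HJ3] := finS.
  exists (maxn (maxn J1 J2) J3) => j; rewrite !geq_max => /andP[/andP[j1 j2] j3].
  have [tj0 jt _ _] := taP j.
  have uf := fiber_fin F p1 ug yoo tj0.
  have h1 : (fiber_tail g y (ta j).1 <= (e / 2)%:E)%E.
    apply: small; apply: le_trans jt; apply: (le_trans (ltW tJ2)); rewrite ler_nat//.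
  have h2 : (f j y <= ((e / 2) `^ p)%:E)%E.
    have := HJ1 j j1; rewrite /= sub0r normrN => hh.
    apply: (@le_trans _ _ (\sum_(j <= k <oo) f k y)%E).
      have := @nneseries_lim_ge R (fun k => f k y) xpredT j j.+1 (fun n _ _ => f0 n y).
      by rewrite big_nat1.
    rewrite -(fineK (HJ3 j j3)) lee_fin.
    by apply: le_trans hh; exact: ler_norm.
  have := yk _ tj0; move: h2 h1; rewrite /f patchE mem_set//.
  rewrite -(fineK uf); set v := fine _ => h2 h1 h3.
  have {}h2 : `|v - (ta j).2| `^ p <= (e / 2) `^ p by exact: h2.
  have {h1}h3 : `|v - k| <= e / 2 by have := le_trans h3 h1.
  have {}h2 : `|v - (ta j).2| <= e / 2.
    rewrite leNgt; apply/negP => lt_; move: h2; rewrite leNgt => /negP; apply.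
    by apply: gt0_ltr_powR; rewrite ?nnegrE// ltW.
  move: h2 h3; rewrite !ler_norml => /andP[? ?] /andP[? ?]; apply/andP; split; lra.
have FF := ae_filter_ringOfSetsType (mmeas Y).
have good : {ae mmeas Y, forall y : cara Y, (\sum_(0 <= j <oo) f j y < +oo)%E /\
    exists k, fiber_limit p u g y k}.
  move: sum_lty (ae_energy F p1 ug gLp); apply: filterS2 => y h1 h2; split => //.
  exact: (fiber_limit_exists F p1 ug h2).
have Bpos : (0 < mmeas Y B)%E by have [_ _ _ /(_ x r r0)/andP[]] := mmY.
have [y1 By1 [s1 [k Lk]]] := ae_exists mB Bpos good.
exists k; split => //.
move: good => [M [mM M0 HM]].
apply/eqP; rewrite eq_le outer_measure_ge0 andbT -[leRHS]M0.
apply: le_outer_measure => y [By nLy]; apply: HM => -[sy [k' Ly]]; apply: nLy.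
suff -> : k = k' by [].
apply/eqP; rewrite -subr_eq0 -normr_le0; apply/ler_addgt0Pr => e e0; rewrite add0r.
have e20 : 0 < e / 2 by lra.
have [J h] := lim _ _ s1 By1 Lk _ e20; have [J' h'] := lim _ _ sy By Ly _ e20.
have := h _ (leq_maxl J J'); have := h' _ (leq_maxr J J').
by rewrite !ler_norml => /andP[? ?] /andP[? ?]; apply/andP; split; lra.
Qed.

(** On almost every fibre |u - k| is at most the tail of g, for the same k; the Hardy
    inequality on the fibres is integrated over Y. *)
Theorem filling_sobolev : exists c : R,
  (\int[mmeas H]_(h in [set: cara H]) (`|u h - c%:E| `^ p) <=
   ((p / beta) `^ p)%:E * \int[mmeas H]_(h in [set: cara H]) (g h `^ p))%E.
Proof.
have [k k0] := glue_constants mmY (warping_lY W) (fiber_limit_unique F p1 ug)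
  limit_locally_constant.
exists k; pose bad : set (cara Y) := [set y | ~ fiber_limit p u g y k].
have mbad : measurable bad.
  apply: (@le_caratheodory_measurable R _ (mass Y)) => A.
  rewrite [X in (X + _)%E](_ : _ = 0%E) ?add0e; last first.
    apply/eqP; rewrite eq_le outer_measure_ge0 andbT -[leRHS]k0.
    by apply: le_outer_measure => y [].
  by apply: le_outer_measure => y [].
have [f0 [M [mf0 mM M0 uf0]]] :=
  mmeasurable_section (filling_carried F) (sigma_finite_fmeas F) mu_.
pose f z := (`|f0 z - k%:E| `^ p)%E.
have mf : measurable_fun [set: T] f.
  apply: measurableT_comp (measurable_poweR p) _; apply: measurableT_comp => //.
  exact: emeasurable_funB.
have f_ge0 z : (0 <= f z)%E by exact: poweR_ge0.
rewrite (energy_total F p ug).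
rewrite [leLHS](_ : _ = \int[nu]_z f z)%E; last first.
  rewrite -(ge0_integral_section (filling_carried F) mf f_ge0).
  apply: (@ae_eq_integral_nomeas _ _ _ (mmeas H) _ (fsec (w := w) (N := N) (Y := Y) (phi := phi) @^-1` M)) => //.
  - exact: (carried_caratheodory (filling_carried F)).
  - by rewrite -[RHS]M0 -(carried_preimage (filling_carried F) mM).
  - by move=> h _ Mh; rewrite /f -uf0.
rewrite (fmeas21 F mf f_ge0) -ge0_integralZl//; last 3 first.
- exact: (measurable_energy F p ug).
- by move=> y _; apply: integral_ge0 => t _; rewrite mule_ge0 ?poweR_ge0 ?lee_fin ?weight_ge0.
- by rewrite lee_fin powR_ge0.
have FF := ae_filter_ringOfSetsType (mmeas Y).
have [M' [mM' M'0 HM']] := fmeas_null2 mM M0.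
apply: (@ge0_ae_le_integral_nomeas _ _ _ (mmeas Y) _ (M' `|` bad)) => //.
- exact: measurableU.
- apply/eqP; rewrite eq_le measure_ge0 andbT.
  by apply: le_trans (measureU2 _ mM' mbad) _; rewrite [X in (X + _)%E]M'0 add0e [leLHS]k0.
- by move=> y _; apply: integral_ge0 => t _; rewrite mule_ge0 ?lee_fin ?weight_ge0.
- move=> y _; rewrite mule_ge0 ?lee_fin ?powR_ge0//.
  by apply: integral_ge0 => t _; rewrite mule_ge0 ?poweR_ge0 ?lee_fin ?weight_ge0.
move=> y _ /not_orP[nM' nbad].
have [yoo yk] : fiber_limit p u g y k by apply: contrapT.
have [M2 [mM2 M20 HM2]] : {ae mu, forall t, 0 < t -> ~ M (t, y)}.
  by apply: contrapT => nn; apply: nM'; apply: HM'.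
apply: le_trans (fiber_hardy F p1 ug y).
have m0 : measurable (M2 `|` [set 0] : set (measurableTypeR R)).
  by apply: measurableU => //; exact: measurable_set1.
apply: (@ge0_ae_le_integral_nomeas _ _ _ mu _ (M2 `|` [set 0])) => //.
- have [_ E] := null_with_ends 0 0 mM2 M20; rewrite -[RHS]E; congr (_ _).
  by rewrite setUid.
- by move=> t _; rewrite mule_ge0 ?lee_fin ?weight_ge0.
- by move=> t _; rewrite mule_ge0 ?poweR_ge0 ?lee_fin ?weight_ge0.
move=> t _ /not_orP[nM2 tn0].
have [t0|t0] := ltP 0 t; last first.
  by rewrite weight_neg ?mule0// lt_neqAle t0 andbT; apply/eqP.
rewrite lee_wpmul2r ?lee_fin ?weight_ge0// le_poweR//; first exact: ltW.
have Mty : ~ M (t, y) by apply: contrapT => nn; apply: nM2; apply: HM2 => /(_ t0).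
have S : fsec (pt t y) = (t, y).
  by rewrite /fsec /wsec (wht_wpt w W _ (ltW t0)) (wfib_wpt w W _ t0).
rewrite -S -uf0 ?S//; exact: yk.
Qed.

End filling_limit.

(** * From the inequality to the function spaces *)

Section constants.
Context {R : realType} (Z : mmdata R).
Local Open Scope ereal_scope.

(** If x or y is infinite, both sides are infinite. *)
Lemma abse_subcst (x y : \bar R) (c : R) : `|(x - c%:E) - (y - c%:E)| = `|x - y|.
Proof.
case: x => [x||]; case: y => [y||] //=; congr (`|_|%R%:E); ring.
Qed.

Lemma upper_gradient_subcst (u g : Z -> \bar R) (c : R) :
  upper_gradient Z u g -> upper_gradient Z (fun x => u x - c%:E) g.
Proof.
move=> [g0 mg ug]; split => // a b gamma ac ne; rewrite abse_subcst; exact: ug.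
Qed.

Hypothesis cara_balls : forall (x : Z) r, measurable (oball (dist Z) x r : set (cara Z)).
Hypothesis finite_balls : forall (x : Z) r, mass Z (oball (dist Z) x r) < +oo.

Lemma integrable_cst_ball x r (c : R) :
  (mmeas Z).-integrable (oball (dist Z) x r) (fun _ : cara Z => c%:E).
Proof.
apply/integrableP; split; first exact: measurable_cst.
rewrite [ltLHS](_ : _ = (`|c|%R)%:E * mmeas Z (oball (dist Z) x r)).
  by apply: lte_mul_pinfty; rewrite ?lee_fin//; exact: finite_balls.
exact: (@integral_cst _ _ _ (mmeas Z) _ (cara_balls x r)).
Qed.

Lemma D1_subcst p (u : Z -> \bar R) (c : R) : D1 Z p u -> D1 Z p (fun x => u x - c%:E).
Proof.
move=> [mu_ iu [g ug gLp]]; split.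
- by apply: emeasurable_funB => //; exact: measurable_cst.
- move=> x r r0; apply: integrableB => //; first exact: iu.
  exact: integrable_cst_ball.
- by exists g => //; exact: upper_gradient_subcst.
Qed.

Lemma D1_eq_N1_plus_cst p :
  (forall u, D1 Z p u -> exists c : R,
    \int[mmeas Z]_(x in [set: cara Z]) (`|u x - c%:E| `^ p) < +oo) ->
  D1 Z p = N1_plus_cst Z p.
Proof.
move=> H; apply/seteqP; split => [u Du|u [v [Dv _] [c ->]]].
  have [c uc] := H u Du; exists (fun x => u x - c%:E).
    by split => //; exact: D1_subcst.
  by exists c; apply/funext => x; rewrite subeK.
have := D1_subcst (- c)%R Dv.
by congr (D1 Z p _); apply/funext => x; rewrite EFinN oppeK.
Qed.

End constants.

Section filling_positive.
Context {R : realType} (N : R * R -> R) (w : R -> {nonneg R}) (Y : mmdata R)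
        (phi : @halfline R -> {nonneg R}) (Phi : R -> R) (beta : R).
Local Notation Hl := (@whalfline R w).
Local Notation H := (@warped R N Hl Y phi).
Hypothesis F : filling N w Y phi Phi beta.

Theorem filling_sobolev_poincare (p T0 : R) : 1 <= p -> weak_local_poincare Y p p ->
  (forall t, T0 <= t -> Phi t `^ p <= (w t)%:num) ->
  (forall (P : H) r, (mass H (oball (dist H) P r) < +oo)%E) ->
  sobolev_poincare H p p (p / beta) /\ D1 H p = N1_plus_cst H p.
Proof.
move=> p1 wlp PhiW ballH; have p0 : 0 < p by lra.
have C0 : 0 < p / beta by rewrite divr_gt0// (filling_beta F).
have absg (g : H -> \bar R) : (forall h, 0 <= g h)%E ->
    (\int[mmeas H]_(h in [set: cara H]) (g h `^ p) =
     \int[mmeas H]_(h in [set: cara H]) (`|g h| `^ p))%E.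
  by move=> g0; apply: eq_integral => h _; rewrite gee0_abs.
split; first split => // u g [mu_ iu _] ug gLp.
  have [c cP] := filling_sobolev F p1 mu_ iu ug gLp wlp PhiW.
  exists c; apply/(Lnorm_le_mul _ _ _ p0 (ltW C0)); apply: le_trans cP _.
  by rewrite absg//; case: ug.
apply: D1_eq_N1_plus_cst => //.
  exact: (oball_caraH F).
move=> u [mu_ iu [g ug gLp]].
have [c cP] := filling_sobolev F p1 mu_ iu ug gLp wlp PhiW.
exists c; apply: le_lt_trans cP _; rewrite lte_mul_pinfty ?lee_fin ?powR_ge0//.
exact: (energy_total_lty p1 ug gLp).
Qed.

End filling_positive.

(** * A function far from all constants, for large exponents *)

Section local_lipschitz.
Context {R : realType} (Z : mmdata R).
Local Notation mu := (@lebesgue_measure R).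
Hypothesis pd : pseudo (dist Z).

(** Along a curve, u is absolutely continuous because it is Lipschitz, and its derivative is
    at most G times the speed. *)
Lemma local_lipschitz_upper_gradient (u G : Z -> R) (L : R) : 0 <= L ->
  (forall z z', `|u z - u z'| <= L * dist Z z z') ->
  (forall z, 0 <= G z) ->
  measurable_fun [set: borelT Z] (fun z : borelT Z => (G z)%:E) ->
  (forall z, exists2 rho, 0 < rho & forall z', dist Z z' z < rho ->
    `|u z' - u z| <= G z * dist Z z' z) ->
  upper_gradient Z (fun z => (u z)%:E) (fun z => (G z)%:E).
Proof.
move=> L0 Lip G0 mG loc; split => // a b c acc _.
have ab : a <= b by case: acc => -[[]].
have [h hb hs] := ac_path_speed pd acc; have [mh h0 hf hd] := hb.
pose dR (x y : R) := `|x - y|.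
have pR : pseudo dR.
  by split => [x|x y|x y z]; rewrite /dR ?subrr ?normr0 1?distrC//; rewrite distrC ler_distD.
have sb : speed_bound dR a b (u \o c) (fun r => L * h r).
  have IE x z : (\int[mu]_(r in `[x, z]) (L * h r)%:E =
      L%:E * \int[mu]_(r in `[x, z]) (h r)%:E)%E.
    under eq_integral do rewrite EFinM.
    rewrite ge0_integralZl ?lee_fin// => [|r _]; last by rewrite lee_fin.
    by apply/measurable_EFinP; exact: measurable_funTS.
  split => [|r||x z ax xz zb].
  - by apply: measurable_funM => //; exact: measurable_cst.
  - by rewrite mulr_ge0.
  - by rewrite IE lte_mul_pinfty// lee_fin.
  rewrite IE; apply: (@le_trans _ _ (L%:E * (dist Z (c x) (c z))%:E)%E).
    by rewrite -EFinM lee_fin; exact: Lip.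
  by rewrite lee_wpmul2l ?lee_fin//; exact: hd.
have [k kb ks] := ac_path_speed pR (ac_path_of_bound pR ab sb).
have [mk k0 kf kd] := kb.
rewrite (line_integral_ae_speed (h := h))//.
apply: (@le_trans _ _ (\int[mu]_(t in `[a, b]) (k t)%:E)%E).
  have := kd a b (lexx _) ab (lexx _).
  by rewrite -EFinB /= /dR /= distrC.
have FF := ae_filter_ringOfSetsType mu.
have [M [mM M0 hM]] : exists M : set (measurableTypeR R), [/\ measurable M, mu M = 0%E &
    forall r, a <= r <= b -> ~ M r -> k r <= G (c r) * h r].
  apply: ae_open_itv.
  move: hs ks; apply: filterS2 => r hr kr arb.
  have [rho rho0 hrho] := loc (c r).
  apply: (has_speed_mono_near (G0 _) arb (hr arb) (kr arb)).
  have [dl dl0 Hdl] := hr arb 1 ltr01.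
  have v0 : 0 < h r + 1 by rewrite ltr_wpDl.
  exists (Num.min dl (rho / (h r + 1))); first by rewrite lt_min dl0 divr_gt0.
  move=> z zab; rewrite lt_min ltr_pdivlMr// => /andP[zr1 zr2]; apply: hrho.
  have := Hdl z zab zr1; rewrite ler_norml => /andP[_]; lra.
apply: (ge0_ae_le_integral_nomeas mM M0).
- by move=> r _; rewrite lee_fin.
- by move=> r _; rewrite -EFinM lee_fin mulr_ge0.
move=> r; rewrite /= in_itv/= => rab Mr.
by rewrite -EFinM lee_fin hM.
Qed.

End local_lipschitz.

Lemma lipschitz_borel {R : realType} (Z : mmdata R) (u : Z -> R) (L : R) : 0 <= L ->
  (forall z z', `|u z - u z'| <= L * dist Z z z') ->
  measurable_fun [set: borelT Z] (u : borelT Z -> R).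
Proof.
move=> L0 Lip; apply: (@measurability _ _ (borelT Z) (measurableTypeR R) setT u (@RGenOInfty.G R) (RGenOInfty.measurableE R)).
move=> _ [_ [a ->] <-]; rewrite setTI; apply: sub_sigma_algebra => z.
rewrite /= in_itv/= andbT => az; have L1 : 0 < L + 1 by lra.
exists ((u z - a) / (L + 1)); first by rewrite divr_gt0// subr_gt0.
move=> z'; rewrite /oball /= ltr_pdivlMr// in_itv/= andbT => zz'.
have := Lip z z'; rewrite ler_norml => /andP[_].
have Lz := le_trans (normr_ge0 _) (Lip z z').
by case: (leP 0 (dist Z z z')) => ? ?; nra.
Qed.

Section indicator_bounds.
Context {d} {T : measurableType d} {R : realType} (m : {measure set T -> \bar R}).
Context (B : set T) (a : R) (f : T -> \bar R).
Hypothesis mB : measurable B.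
Hypothesis a0 : 0 <= a.
Hypothesis f0 : forall x, (0 <= f x)%E.
Local Open Scope ereal_scope.

Let integral_scaled_indic : \int[m]_x (a%:E * (\1_B x)%:E) = a%:E * m B.
Proof.
rewrite ge0_integralZl//; first by rewrite integral_indic// setIT.
by apply/measurable_EFinP; exact: measurable_indic.
Qed.

Lemma integral_le_indic : (forall x, f x <= a%:E * (\1_B x)%:E) ->
  \int[m]_x f x <= a%:E * m B.
Proof.
move=> h; rewrite -integral_scaled_indic.
apply: (@ge0_ae_le_integral_nomeas _ _ _ m _ set0) => // x _.
by rewrite mule_ge0 ?lee_fin.
Qed.

Lemma integral_ge_indic : (forall x, B x -> a%:E <= f x) ->
  a%:E * m B <= \int[m]_x f x.
Proof.
move=> h; rewrite -integral_scaled_indic.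
apply: (@ge0_ae_le_integral_nomeas _ _ _ m _ set0) => // x _.
  by rewrite mule_ge0 ?lee_fin.
move=> _; rewrite indicE; have [|_] := boolP (x \in B); last by rewrite mule0.
by rewrite inE mule1 => /h.
Qed.

End indicator_bounds.

Section filling_negative.
Context {R : realType} (N : R * R -> R) (w : R -> {nonneg R}) (Y : mmdata R)
        (phi : @halfline R -> {nonneg R}) (Phi : R -> R) (beta : R).
Local Notation mu := (@lebesgue_measure R).
Local Notation Hl := (@whalfline R w).
Local Notation H := (@warped R N Hl Y phi).
Local Notation pt := (@wpt R N w Y phi).
Local Notation T := (measurableTypeR R * cara Y)%type.
Hypothesis F : filling N w Y phi Phi beta.
Let W := filling_warping F.
Local Notation wt := (weight w).
Local Notation nu := (fmeas F).
Let mmY := filling_mm F.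
Let pdY : pseudo (dist Y). Proof. exact: metric_pseudo (warping_dY W). Qed.
Let pdH : pseudo (dist H). Proof. exact: (pseudo_dist (N := N) w W). Qed.

Context (alpha p cphi : R) (y0 y1 : Y).
Hypothesis alpha0 : 0 < alpha.
Hypothesis p1 : 1 <= p.
Hypothesis cphi0 : 0 < cphi.
Hypothesis Phi_lower : forall t, 1 <= t -> cphi * expR (alpha * t) <= Phi t.
Hypothesis w_upper : forall t, 0 <= t -> (w t)%:num <= expR (beta * t).
Hypothesis large_p : beta < alpha * p.
Hypothesis y01 : y0 <> y1.
Hypothesis ballH : forall (P : H) r, (mass H (oball (dist H) P r) < +oo)%E.
Let p0 : 0 < p. Proof. by have p1' := p1; lra. Qed.

Let r : R := dist Y y0 y1 / 2.
Let r0 : 0 < r.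
Proof.
rewrite divr_gt0// lt_neqAle pseudo_ge0// andbT eq_sym; apply/eqP.
by have [d0 _ _] := warping_dY W => /d0.
Qed.

Definition bump (y : Y) : R := Num.max 0 (r - dist Y y0 y).
Definition ramp (t : R) : R := Num.max 0 (Num.min (t - 2) 1).
(** Above height 3 this is the bump on Y, at all heights; below height 2 it vanishes. *)
Definition plateau (h : H) : R := ramp (wht h) * bump (wfib h).
(* The first summand bounds the slope of the ramp, at heights below 4. The second one bounds
   that of the bump, with a loss of alpha / 2 as heights vary by 1/2 in the ball
   considered. *)
Let K : R := r * expR (4 * alpha) + expR (alpha / 2) / cphi.
(** The slope decays like exp (- alpha t), as the fibres expand at least at this rate. *)
Definition plateau_slope (h : H) : R :=
  if (1 < wht h) && (dist Y y0 (wfib h) < 2 * r) then K * expR (- alpha * wht h) else 0.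

Let bump_ge0 y : 0 <= bump y. Proof. by rewrite le_max lexx. Qed.
Let bump_le y : bump y <= r.
Proof. by rewrite ge_max (ltW r0)/= gerBl; exact: pseudo_ge0. Qed.
Let bump_far y : r <= dist Y y0 y -> bump y = 0.
Proof. by move=> h; apply/max_idPl; lra. Qed.
Let bump_lip y y' : `|bump y - bump y'| <= dist Y y y'.
Proof.
have [_ ds dt] := pdY; have h1 := dt y0 y y'; have h2 := dt y0 y' y; rewrite ds in h2.
have h3 : 0 <= dist Y y y' by exact: pseudo_ge0.
have h4 : dist Y y0 y <= dist Y y0 y' + dist Y y y' by have := dt y0 y' y; rewrite (ds y' y).
rewrite /bump !maxEle; do 2?case: ifPn; rewrite -?ltNge => ? ?;
  by rewrite ler_norml; apply/andP; split; lra.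
Qed.
Let ramp_ge0 t : 0 <= ramp t. Proof. by rewrite le_max lexx. Qed.
Let ramp_le1 t : ramp t <= 1. Proof. by rewrite ge_max ler01 ge_min lexx orbT. Qed.
Let ramp_lip s t : `|ramp s - ramp t| <= `|s - t|.
Proof.
by apply: (le_trans (clamp_lip _ _ _)); rewrite opprB addrA subrK.
Qed.
Let ramp0 t : t <= 2 -> ramp t = 0.
Proof. by move=> t2; apply/max_idPl; rewrite ge_min; apply/orP; left; lra. Qed.
Let ramp1 t : 3 <= t -> ramp t = 1.
Proof. by move=> t3; rewrite /ramp (min_idPr _) ?(max_idPr _)//; lra. Qed.

Let plateau_ge0 h : 0 <= plateau h. Proof. by rewrite mulr_ge0. Qed.
Let plateau_le h : plateau h <= r.
Proof. by rewrite -[leRHS]mul1r ler_pM. Qed.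

Let plateau_diff h h' : `|plateau h - plateau h'| <=
  `|ramp (wht h) - ramp (wht h')| * r + ramp (wht h') * dist Y (wfib h) (wfib h').
Proof.
rewrite /plateau; set a := ramp _; set b := bump _; set c := ramp _; set e := bump _.
have -> : a * b - c * e = (a - c) * b + c * (b - e) by ring.
apply: le_trans (ler_normD _ _) _; rewrite !normrM lerD//.
  by rewrite ler_wpM2l// ger0_norm ?bump_ge0// bump_le.
by rewrite (ger0_norm (ramp_ge0 _)) ler_wpM2l// bump_lip.
Qed.

Let dsH (h h' : H) : dist H h h' = dist H h' h. Proof. by case: pdH. Qed.

Let Phi1 : 0 < Phi 1. Proof. by apply: (warping_gt0 W); exact: ltr01. Qed.

Let plateau_lip h h' : `|plateau h - plateau h'| <= (r + (Phi 1)^-1) * dist H h h'.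
Proof.
have d0 : 0 <= dist H h h' by exact: pseudo_ge0.
have P10 : 0 <= (Phi 1)^-1 by rewrite invr_ge0 ltW.
have [d1|d1] := leP 1 (dist H h h').
  apply: (@le_trans _ _ (r * 1)).
    have := plateau_ge0 h; have := plateau_ge0 h'; have := plateau_le h; have := plateau_le h'.
    by move=> *; rewrite ler_norml; apply/andP; split; lra.
  by apply: ler_pM => //; [exact: ltW|lra].
apply: le_trans (plateau_diff h h') _; rewrite mulrDl lerD//.
  rewrite mulrC ler_wpM2l ?(ltW r0)//; apply: le_trans (ramp_lip _ _) _.
  exact: (dist_ht W).
have [h2|h2] := leP (wht h') 2; first by rewrite ramp0// mul0r mulr_ge0.
have := @dist_fib_ge _ _ w _ _ _ W h' h 1 (Phi 1); rewrite dsH d1 => /(_ isT (ltW Phi1)).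
have -> : dist Y (wfib h') (wfib h) = dist Y (wfib h) (wfib h') by case: pdY.
have mono t : 0 <= t -> wht h' - 1 <= t -> Phi 1 <= Phi t.
  by move=> _ ht; apply: (warping_nd W) => //; lra.
move=> /(_ mono) dY; apply: (@le_trans _ _ (dist Y (wfib h) (wfib h'))).
  by rewrite -[leRHS]mul1r ler_wpM2r// pseudo_ge0.
by rewrite mulrC ler_pdivlMr// mulrC.
Qed.

Let K0 : 0 <= K.
Proof.
by apply: addr_ge0; [apply: mulr_ge0|apply: divr_ge0]; rewrite ?expR_ge0 ?(ltW r0) ?(ltW cphi0).
Qed.

Let plateau_slope_ge0 h : 0 <= plateau_slope h.
Proof. by rewrite /plateau_slope; case: ifPn => // _; rewrite mulr_ge0 ?expR_ge0. Qed.

Let near_ht (h h' : H) rho : dist H h' h < rho -> wht h - rho < wht h' < wht h + rho.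
Proof.
move=> hr; have := le_lt_trans (dist_ht W h' h) hr.
by rewrite ltr_norml => /andP[? ?]; apply/andP; split; lra.
Qed.

Let near_fib (h h' : H) e : 1 < wht h -> dist H h' h < e -> e <= 1/2 ->
  Phi (wht h - 1/2) * dist Y (wfib h') (wfib h) <= dist H h' h.
Proof.
move=> h1 he e12; have h'e : dist H h h' < 1/2 by rewrite dsH; apply: lt_le_trans he _.
have := dist_fib W h'e; rewrite dsH; have -> : 1/2 <= wht h by lra.
have -> : dist Y (wfib h') (wfib h) = dist Y (wfib h) (wfib h') by case: pdY.
exact.
Qed.

Let plateau_local h : exists2 rho, 0 < rho & forall h', dist H h' h < rho ->
  `|plateau h' - plateau h| <= plateau_slope h * dist H h' h.
Proof.
have [h1|h1] := leP (wht h) 1.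
  exists 1 => // h' hh'; have /andP[_ ?] := near_ht hh'.
  rewrite /plateau ramp0 ?[ramp (wht h)]ramp0; [|lra|lra].
  by rewrite !mul0r subrr normr0 mulr_ge0// pseudo_ge0.
have P0 : 0 < Phi (1/2) by apply: (warping_gt0 W); lra.
have Ph : Phi (1/2) <= Phi (wht h - 1/2) by apply: (warping_nd W); lra.
have [fy|fy] := ltP (dist Y y0 (wfib h)) (2 * r); last first.
  exists (Num.min (1/2) (r * Phi (1/2))).
    by rewrite lt_min; apply/andP; split; [exact: divr_gt0|apply: mulr_gt0 => //; exact: r0].
  move=> h' hh'; have r12 : Num.min (1/2) (r * Phi (1/2)) <= 1/2 by rewrite ge_min lexx.
  have := near_fib h1 hh' r12.
  have d0 : 0 <= dist Y (wfib h') (wfib h) by exact: pseudo_ge0.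
  move=> /(le_trans (ler_wpM2r d0 Ph)) dle.
  have dr : dist Y (wfib h') (wfib h) < r.
    rewrite -(ltr_pM2l P0); apply: le_lt_trans dle _; apply: lt_le_trans hh' _.
    by rewrite [leRHS]mulrC ge_min lexx orbT.
  rewrite /plateau !bump_far; last 2 first.
  - by have := r0; lra.
  - have [_ _ dt] := pdY; have := dt y0 (wfib h') (wfib h); lra.
  by rewrite !mulr0 subrr normr0 mulr_ge0// pseudo_ge0.
exists (1/2); first by lra.
move=> h' hh'; have /andP[t1 t2] := near_ht hh'.
have hdist0 : 0 <= dist H h' h by exact: pseudo_ge0.
rewrite /plateau_slope h1 fy /=; apply: le_trans (plateau_diff _ _) _.
rewrite /K mulrDl mulrDl lerD//.
  have [t4|t4] := leP 4 (wht h).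
    rewrite ramp1 ?[ramp (wht h)]ramp1; [|lra|lra].
    rewrite subrr normr0 mul0r.
    exact: (mulr_ge0 (mulr_ge0 (mulr_ge0 (ltW r0) (expR_ge0 _)) (expR_ge0 _)) hdist0).
  apply: (@le_trans _ _ (dist H h' h * r)).
    rewrite ler_wpM2r ?(ltW r0)//; apply: le_trans (ramp_lip _ _) _; exact: (dist_ht W).
  rewrite mulrC ler_wpM2r// -[leLHS]mulr1 -mulrA ler_wpM2l ?(ltW r0)//.
  rewrite -expRD -[leLHS]expR0 ler_expR; have := ltW alpha0 => a0.
  have t4' : 0 <= 4 - wht h by lra.
  by have := mulr_ge0 a0 t4'; lra.
have [t2'|t2'] := leP (wht h) 2.
  rewrite ramp0// mul0r.
  exact: (mulr_ge0 (mulr_ge0 (divr_ge0 (expR_ge0 _) (ltW cphi0)) (expR_ge0 _)) hdist0).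
have PL := Phi_lower (t := wht h - 1/2) ltac:(lra).
have PL0 : 0 < cphi * expR (alpha * (wht h - 1/2)) by rewrite mulr_gt0 ?expR_gt0.
apply: (@le_trans _ _ (dist Y (wfib h') (wfib h))).
  by rewrite -[leRHS]mul1r ler_wpM2r// pseudo_ge0.
have := near_fib h1 hh' (lexx _).
have dY0 : 0 <= dist Y (wfib h') (wfib h) by exact: pseudo_ge0.
move=> /(le_trans (ler_wpM2r dY0 PL)); rewrite -(ler_pdivlMl _ _ PL0) => /le_trans; apply.
rewrite ler_wpM2r// invfM -expRN.
rewrite [leRHS](_ : _ = cphi^-1 * (expR (alpha / 2) * expR (- alpha * wht h))); last by ring.
by rewrite -expRD le_eqVlt; apply/orP; left; apply/eqP; congr (_ * expR _); field.
Qed.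

Let support : set H := [set h | 1 < wht h /\ dist Y y0 (wfib h) < 2 * r].

Let dopen_support : dopen (dist H) support.
Proof.
move=> h [h1 hr]; have P0 : 0 < Phi (1/2) by apply: (warping_gt0 W); lra.
have Ph : Phi (1/2) <= Phi (wht h - 1/2) by apply: (warping_nd W); lra.
pose e := Num.min (Num.min (1/2) (wht h - 1)) ((2 * r - dist Y y0 (wfib h)) * Phi (1/2)).
have e1 : e <= 1/2 by rewrite /e !ge_min lexx.
have e2 : e <= wht h - 1 by rewrite /e !ge_min lexx !orbT.
have e3 : e <= (2 * r - dist Y y0 (wfib h)) * Phi (1/2) by rewrite /e !ge_min lexx !orbT.
have e0 : 0 < e.
  rewrite !lt_min; apply/andP; split; last by apply: mulr_gt0 => //; rewrite subr_gt0.
  by apply/andP; split; [exact: divr_gt0|rewrite subr_gt0].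
exists e => //.
move=> h' hh_; have {hh_}hh' : dist H h' h < e by rewrite dsH; exact: hh_.
split; first by have /andP[? ?] := near_ht hh'; lra.
have d0 : 0 <= dist Y (wfib h') (wfib h) by exact: pseudo_ge0.
have := near_fib h1 hh' e1 => /(le_trans (ler_wpM2r d0 Ph)) dle.
have dr : dist Y (wfib h') (wfib h) < 2 * r - dist Y y0 (wfib h).
  by rewrite -(ltr_pM2r P0) mulrC; apply: le_lt_trans dle _; exact: lt_le_trans hh' e3.
have [_ ds dt] := pdY; have := dt y0 (wfib h) (wfib h'); rewrite (ds (wfib h)); lra.
Qed.

Let borel_wht : measurable_fun [set: borelT H] (@wht R N w Y phi : borelT H -> R).
Proof.
by apply: (@lipschitz_borel _ H _ 1) => // z z'; rewrite mul1r; exact: (dist_ht W z z').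
Qed.

Let borel_slope : measurable_fun [set: borelT H] (fun h : borelT H => (plateau_slope h)%:E).
Proof.
have -> : (fun h : borelT H => (plateau_slope h)%:E) =
    (fun h : borelT H => (K * expR (- alpha * wht h) * \1_support h)%:E).
  apply/funext => h; rewrite /plateau_slope indicE; congr EFin.
  case: ifPn => [/andP[h1 h2]|hn]; first by rewrite mem_set ?mulr1.
  by rewrite memNset ?mulr0// => -[h1 h2]; move: hn; rewrite h1 h2.
apply/measurable_EFinP; apply: measurable_funM.
  apply: measurable_funM => //; apply: measurableT_comp => //.
  exact: measurable_funM.
by apply: measurable_indic; apply: sub_sigma_algebra; exact: dopen_support.
Qed.

Let borel_plateau : measurable_fun [set: borelT H] (plateau : borelT H -> R).
Proof.
apply: (lipschitz_borel (L := r + (Phi 1)^-1)) plateau_lip.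
by rewrite addr_ge0 ?invr_ge0// ltW.
Qed.

Let plateau_gradient :
  upper_gradient H (fun h => (plateau h)%:E) (fun h => (plateau_slope h)%:E).
Proof.
apply: (local_lipschitz_upper_gradient pdH (L := r + (Phi 1)^-1)) => //.
by rewrite addr_ge0 ?invr_ge0// ltW.
Qed.

(** The p-energy is at most a multiple of the integral of exp ((beta - alpha p) t). *)
Let Lp_slope : in_Lp H p (fun h => (plateau_slope h)%:E).
Proof.
apply/(Lnorm_lty (mmeas H) _ p0).
pose f (z : T) : \bar R := (`|(plateau_slope (pt z.1 z.2))%:E| `^ p)%E.
have mf : measurable_fun [set: T] f.
  apply: measurableT_comp (measurable_poweR p) _; apply: measurableT_comp => //.
  exact: (borel_coordinates F borel_slope).
have f0 z : (0 <= f z)%E by exact: poweR_ge0.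
rewrite [ltLHS](_ : _ = \int[nu]_z f z)%E; last first.
  rewrite -(ge0_integral_section (filling_carried F) mf f0).
  by apply: eq_integral => h _; rewrite /f /= wptK.
rewrite (fmeas12 F mf f0).
pose B : set (cara Y) := oball (dist Y) y0 (2 * r).
have mB : measurable B by exact: (oball_cara F).
have BE : mmeas Y B = (fine (mmeas Y B))%:E by rewrite fineK// ge0_fin_numE// (oball_lty F).
pose la := alpha * p - beta; have la0 : 0 < la by rewrite subr_gt0.
pose c := K `^ p * fine (mmeas Y B) / la.
have c0 : 0 <= c by rewrite divr_ge0 ?mulr_ge0 ?powR_ge0 ?fine_ge0// ltW.
apply: (@le_lt_trans _ _ (\int[mu]_t (c%:E * (exponential_pdf la t)%:E))%E).
  apply: (@ge0_ae_le_integral_nomeas _ _ _ mu _ set0) => // t _.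
  - by rewrite mule_ge0 ?lee_fin ?weight_ge0// integral_ge0.
  - by rewrite -EFinM lee_fin mulr_ge0// exponential_pdf_ge0// ltW.
  move=> _; have [t0|t0] := ltP t 0.
    by rewrite weight_neg// mule0 -EFinM lee_fin mulr_ge0// exponential_pdf_ge0// ltW.
  have fle y : (f (t, y) <= (K `^ p * expR (- (alpha * p) * t))%:E * (\1_B y)%:E)%E.
    rewrite -EFinM; suff : `|plateau_slope (pt t y)| `^ p <= K `^ p * expR (- (alpha * p) * t) * \1_B y by [].
    rewrite ger0_norm// /plateau_slope (wht_wpt w W _ t0).
    case: ifPn => [/andP[t1]|_]; last by rewrite powR0 ?gt_eqF// !mulr_ge0 ?powR_ge0 ?expR_ge0.
    rewrite (wfib_wpt w W) => [yr|]; last by lra.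
    rewrite indicE mem_set// mulr1 powRM ?expR_ge0// -expRM.
    by rewrite (_ : - alpha * t * p = - (alpha * p) * t)//; ring.
  apply: (@le_trans _ _ ((K `^ p * expR (- (alpha * p) * t))%:E * mmeas Y B * (expR (beta * t))%:E)%E).
    apply: lee_pmul; rewrite ?lee_fin ?weight_ge0 ?integral_ge0//; last first.
      by rewrite weightE// w_upper.
    apply: integral_le_indic => //.
    by rewrite mulr_ge0 ?powR_ge0 ?expR_ge0.
  rewrite BE -!EFinM lee_fin /exponential_pdf patchE mem_set; last by rewrite /= in_itv/= andbT.
  rewrite /c (_ : - la * t = - (alpha * p) * t + beta * t); last by rewrite /la; ring.
  rewrite expRD le_eqVlt; apply/orP; left; apply/eqP.
  by field; rewrite gt_eqF.
rewrite ge0_integralZl//; last 2 first.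
- by apply/measurable_EFinP; exact: measurable_exponential_pdf.
- by move=> t _; rewrite lee_fin exponential_pdf_ge0// ltW.
by rewrite integral_exponential_pdf// mule1 ltry.
Qed.

Let D1_plateau : D1 H p (fun h => (plateau h)%:E).
Proof.
have mpl : mmeasurable H (fun h => (plateau h)%:E).
  by apply: (borel_mmeasurable F); apply/measurable_EFinP.
split => //; last by exists (fun h => (plateau_slope h)%:E).
move=> x s s0; apply: (le_integrable _ _ _ (integrable_cst_ball (oball_caraH F) ballH x s r)).
- exact: (oball_caraH F).
- exact: measurable_funTS.
by move=> h _; rewrite /= lee_fin !ger0_norm// ltW.
Qed.

(** For every c there is a ball of Y above which |plateau - c| is bounded from below at all
    heights t >= 3: a ball around y0 if c = 0, and a ball around y1, where the bump
    vanishes, otherwise. The set of these points has infinite mass. *)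
Theorem plateau_not_N1_plus_cst : D1 H p <> N1_plus_cst H p.
Proof.
move=> E; have : N1_plus_cst H p (fun h => (plateau h)%:E) by rewrite -E; exact: D1_plateau.
move=> [v [_ voo] [c vc]].
have vE h : v h = (plateau h - c)%:E.
  have := congr1 (fun k => k h) vc => /= vch.
  by case: (v h) vch => [x|//|//]; rewrite -EFinD => -[->]; congr EFin; lra.
have [z [rho [de [rho0 de0 far]]]] : exists z rho de, [/\ 0 < rho, 0 < de &
    forall y, oball (dist Y) z rho y -> de <= `|bump y - c|].
  have [->|cn0] := eqVneq c 0.
    exists y0, (r / 2), (r / 2); split; [exact: divr_gt0|exact: divr_gt0|].
    move=> y; rewrite /oball /= => yr; rewrite subr0 ger0_norm// /bump le_max.
    by apply/orP; right; have := r0; lra.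
  exists y1, r, `|c|; split; rewrite ?normr_gt0//.
  move=> y; rewrite /oball /= => yr; rewrite bump_far ?sub0r ?normrN//.
  have [_ ds dt] := pdY; have := dt y0 y y1; rewrite (ds y y1).
  have : dist Y y0 y1 = 2 * r by rewrite /r mulrC divfK.
  lra.
pose f (x : T) : \bar R := (`|(plateau (pt x.1 x.2) - c)%:E| `^ p)%E.
have mf : measurable_fun [set: T] f.
  apply: measurableT_comp (measurable_poweR p) _; apply: measurableT_comp => //.
  have := @borel_coordinates _ _ _ _ _ _ _ F (fun h => (plateau h - c)%:E).
  by apply; apply/measurable_EFinP; exact: measurable_funB.
have f0 x : (0 <= f x)%E by exact: poweR_ge0.
have total : (\int[mmeas H]_(h in [set: cara H]) (`|v h| `^ p) = \int[nu]_x f x)%E.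
  rewrite -(ge0_integral_section (filling_carried F) mf f0).
  by apply: eq_integral => h _; rewrite /f /= wptK vE.
move: voo; rewrite total (fmeas12 F mf f0) => voo.
pose B : set (cara Y) := oball (dist Y) z rho.
have mB : measurable B by exact: (oball_cara F).
have [_ _ _ /(_ z rho rho0)/andP[Bpos Blty]] := mmY.
have BE : mmeas Y B = (fine (mmeas Y B))%:E by rewrite fineK// ge0_fin_numE.
have m0 : 0 < fine (mmeas Y B) by apply: fine_gt0; rewrite Bpos.
have w3 : 0 < (w 3)%:num by exact: (filling_gt0 F).
pose q := de `^ p * fine (mmeas Y B) * (w 3)%:num.
have q0 : 0 < q by rewrite !mulr_gt0// powR_gt0.
have slice0 t : (0 <= (\int[mmeas Y]_y f (t, y)) * (wt t)%:E)%E.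
  by rewrite mule_ge0 ?lee_fin ?weight_ge0// integral_ge0.
have aeT : {ae mu, forall t : R, True} by exact: aeW.
have [t [t3 _]] := small_value 3 slice0 voo aeT (divr_gt0 q0 (ltr0n _ 2)).
rewrite leNgt => /negP; apply; apply: (@lt_le_trans _ _ q%:E).
  by rewrite lte_fin; lra.
have t0 : 0 < t by lra.
rewrite /q EFinM; apply: lee_pmul.
- by rewrite lee_fin mulr_ge0 ?powR_ge0// ltW.
- by rewrite lee_fin.
- rewrite EFinM -BE; apply: integral_ge_indic => //; first exact: powR_ge0.
  move=> y yB; suff : de `^ p <= `|plateau (pt t y) - c| `^ p by [].
  apply: ge0_ler_powR; rewrite ?nnegrE//; [exact: ltW|exact: ltW|].
  rewrite /plateau (wht_wpt w W _ (ltW t0)) (wfib_wpt w W _ t0) ramp1// mul1r.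
  exact: far.
by rewrite lee_fin weightE ?(ltW t0)// (filling_nd F).
Qed.

End filling_negative.

(** * The two fillings *)

Section finite_balls.
Context {R : realType} (N : R * R -> R) (w : R -> {nonneg R}) (Y : mmdata R)
        (phi : @halfline R -> {nonneg R}) (Phi : R -> R) (beta : R).
Local Notation Hl := (@whalfline R w).
Local Notation H := (@warped R N Hl Y phi).
Hypothesis F : filling N w Y phi Phi beta.
Let W := filling_warping F.

Lemma ball_lty (P : H) r (B : set Y) : measurable (B : set (cara Y)) ->
  (mass Y B < +oo)%E -> (forall P', oball (dist H) P r P' -> B (wfib P')) ->
  (mass H (oball (dist H) P r) < +oo)%E.
Proof.
move=> mB Boo PB; pose b := `|wht P| + `|r|.
have b0 : 0 <= b by rewrite addr_ge0.
have mI : measurable (`[- b, b]%classic : set (measurableTypeR R)) by exact: measurable_itv.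
pose X : set (measurableTypeR R * cara Y) := `[- b, b]%classic `*` B.
have mX : measurable X by exact: measurableX.
apply: (@le_lt_trans _ _ (mass H (fsec (w := w) (N := N) (Y := Y) (phi := phi) @^-1` X))).
  apply: le_outer_measure => P' PP'; split; last exact: PB.
  rewrite /= in_itv/= -ler_norml; have := le_lt_trans (dist_ht W P P') PP'.
  have := ler_norm r; have := ler_normD (wht P) (wht P' - wht P).
  by rewrite addrC subrK distrC /b; lra.
rewrite (carried_preimage (filling_carried F) mX) [ltLHS]wY_rect//.
by rewrite lte_mul_pinfty// ge0_fin_numE ?measure_ge0//; exact: (weight_lty F b0).
Qed.

End finite_balls.

Section exponential_filling.
Context {R : realType} (N : R * R -> R) (Y : mmdata R) (alpha beta p : R).
Hypothesis hN : warping_norm N.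
Hypothesis mmY : metric_measure_space Y.
Hypothesis lY : length_space (dist Y).
Hypothesis alpha0 : 0 < alpha.
Hypothesis beta0 : 0 < beta.
Hypothesis p1 : 1 <= p.
Let w : R -> {nonneg R} := fun t => NngNum (expR_ge0 (beta * t)).
Let phi : @halfline R -> {nonneg R} := fun t => NngNum (expR_ge0 (alpha * hval t)).
Let Phi (t : R) := expR (alpha * t).
Local Notation H := (exp_filling N alpha beta Y).

Lemma exp_filling_filling : filling N w Y phi Phi beta.
Proof.
split; [split; [exact: hN| |exact: lY|by []| | |]|exact: mmY|exact: beta0| | |].
- by case: mmY.
- by apply: measurableT_comp => //; exact: measurable_funM.
- by move=> s t _ st; rewrite ler_expR ler_wpM2l// ltW.
- by move=> t _; exact: expR_gt0.
- by apply: measurableT_comp => //; exact: measurable_funM.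
- by move=> s t _ _; rewrite /w /= -expRD -mulrDr.
- by move=> t _; exact: expR_gt0.
Qed.
Let F := exp_filling_filling.

(** Since Phi >= 1, the fibre coordinate does not increase distances. *)
Lemma exp_filling_ball (P : H) r : (mass H (oball (dist H) P r) < +oo)%E.
Proof.
apply: (@ball_lty _ _ _ _ _ _ _ F P r (oball (dist Y) (wfib P) r)).
- exact: (oball_cara F).
- exact: (oball_lty F).
move=> P' PP'; apply: le_lt_trans PP'; rewrite -[leLHS]mul1r.
apply: (@dist_fib_ge _ _ _ _ _ _ (filling_warping F) P P' (dist H P P' + 1)) => //.
  by rewrite ltrDl ltr01.
by move=> t t0 _; rewrite -[leLHS]expR0 ler_expR mulr_ge0// ltW.
Qed.

Lemma exp_filling_positive : weak_local_poincare Y p p -> p <= beta / alpha ->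
  sobolev_poincare H p p (p / beta) /\ D1 H p = N1_plus_cst H p.
Proof.
move=> wlp pba; apply: (@filling_sobolev_poincare _ _ _ _ _ _ _ F p 0 p1 wlp) => [t t0|].
  rewrite /Phi -expRM ler_expR mulrAC ler_wpM2r// mulrC -ler_pdivlMr//.
exact: exp_filling_ball.
Qed.

Lemma exp_filling_negative (y0 y1 : Y) : y0 <> y1 -> beta / alpha < p ->
  D1 H p <> N1_plus_cst H p.
Proof.
move=> y01 pba; apply: (@plateau_not_N1_plus_cst _ _ _ _ _ _ _ F alpha p 1 y0 y1) => //.
- by move=> t _; rewrite mul1r.
- by rewrite mulrC -ltr_pdivrMr.
- exact: exp_filling_ball.
Qed.

End exponential_filling.

Section sinh_bounds.
Context {R : realType}.
Implicit Types s t : R.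

Lemma sinh_growth s t : 0 <= s -> 0 <= t -> sinh t * expR s <= sinh (t + s).
Proof.
move=> s0 t0; rewrite /sinh mulrAC ler_pM2r ?invr_gt0// mulrBl -!expRD lerD2l lerN2 ler_expR.
lra.
Qed.

Lemma sinh_gt0 t : 0 < t -> 0 < sinh t.
Proof. by move=> t0; rewrite divr_gt0// subr_gt0 ltr_expR; lra. Qed.

Lemma sinh_ge0 t : 0 <= t -> 0 <= sinh t.
Proof. by move=> t0; rewrite divr_ge0// subr_ge0 ler_expR; lra. Qed.

Lemma sinh_nd s t : 0 <= s -> s <= t -> sinh s <= sinh t.
Proof.
move=> s0 st; rewrite ler_pM2r ?invr_gt0// lerB ?ler_expR ?lerN2//.
Qed.

Lemma sinh_le t : 0 <= t -> sinh t <= expR t.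
Proof. by move=> t0; rewrite /sinh ler_pdivrMr//; have := expR_gt0 t; have := expR_gt0 (- t); lra. Qed.

Lemma sinh_ge1 t : 2 <= t -> 1 <= sinh t.
Proof.
move=> t2; have := expR_ge1Dx t; have : expR (- t) <= 1.
  by rewrite -[leRHS]expR0 ler_expR; lra.
by rewrite /sinh; lra.
Qed.

Lemma sinh_ge t : 1 <= t -> expR t / 4 <= sinh t.
Proof.
move=> t1; have := expR_ge1Dx t; have : expR (- t) <= 1.
  by rewrite -[leRHS]expR0 ler_expR; lra.
by rewrite /sinh; lra.
Qed.

Lemma measurable_sinh : measurable_fun [set: R] (@sinh R).
Proof.
apply: measurable_funM => //; apply: measurable_funB => //.
by apply: measurableT_comp.
Qed.

End sinh_bounds.

Section hyperbolic_filling.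
Context {R : realType} (N : R * R -> R) (Y : mmdata R) (alpha beta p : R).
Hypothesis hN : warping_norm N.
Hypothesis mmY : metric_measure_space Y.
Hypothesis lY : length_space (dist Y).
Hypothesis alpha0 : 0 < alpha.
Hypothesis beta0 : 0 < beta.
Hypothesis p1 : 1 <= p.
Hypothesis finY : (mass Y [set: Y] < +oo)%E.
Let w : R -> {nonneg R} := fun t => NngNum (powR_ge0 (sinh t) beta).
Let phi : @halfline R -> {nonneg R} := fun t => NngNum (powR_ge0 (sinh (hval t)) alpha).
Let Phi (t : R) := sinh t `^ alpha.
Local Notation H := (sinh_filling N alpha beta Y).

Lemma sinh_filling_filling : filling N w Y phi Phi beta.
Proof.
split; [split; [exact: hN| |exact: lY|by []| | |]|exact: mmY|exact: beta0| | |].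
- by case: mmY.
- exact: measurableT_comp (measurable_powR alpha) measurable_sinh.
- move=> s t s0 st; apply: ge0_ler_powR; rewrite ?nnegrE ?sinh_ge0 ?(ltW alpha0)//.
    exact: le_trans st.
  exact: sinh_nd.
- by move=> t t0; rewrite powR_gt0// sinh_gt0.
- exact: measurableT_comp (measurable_powR beta) measurable_sinh.
- move=> s t s0 t0; have st0 := sinh_ge0 t0; have sst0 := sinh_ge0 (addr_ge0 t0 s0).
  rewrite /w /= [beta * s]mulrC expRM -powRM ?expR_ge0//.
  apply: ge0_ler_powR; rewrite ?nnegrE//; first exact: ltW.
    exact: mulr_ge0 st0 (expR_ge0 s).
  exact: sinh_growth.
- by move=> t t0; rewrite powR_gt0// sinh_gt0.
Qed.
Let F := sinh_filling_filling.

Lemma sinh_filling_ball (P : H) r : (mass H (oball (dist H) P r) < +oo)%E.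
Proof. by apply: (@ball_lty _ _ _ _ _ _ _ F P r setT). Qed.

Lemma sinh_filling_positive : weak_local_poincare Y p p -> p <= beta / alpha ->
  sobolev_poincare H p p (p / beta) /\ D1 H p = N1_plus_cst H p.
Proof.
move=> wlp pba; apply: (@filling_sobolev_poincare _ _ _ _ _ _ _ F p 2 p1 wlp) => [t t2|].
  rewrite /Phi -powRrM; apply: ler_powR; first exact: sinh_ge1.
  by rewrite mulrC -ler_pdivlMr.
exact: sinh_filling_ball.
Qed.

Lemma sinh_filling_negative (y0 y1 : Y) : y0 <> y1 -> beta / alpha < p ->
  D1 H p <> N1_plus_cst H p.
Proof.
move=> y01 pba.
apply: (@plateau_not_N1_plus_cst _ _ _ _ _ _ _ F alpha p (4^-1 `^ alpha) y0 y1) => //.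
- move=> t t1; have st0 : 0 <= sinh t by apply: sinh_ge0; lra.
  rewrite mulrC [alpha * t]mulrC expRM -powRM ?expR_ge0 ?invr_ge0//.
  apply: ge0_ler_powR; rewrite ?nnegrE//; first exact: ltW.
  exact: sinh_ge.
- move=> t t0; have st0 := sinh_ge0 t0; rewrite /w /= [beta * t]mulrC expRM.
  apply: ge0_ler_powR; rewrite ?nnegrE ?expR_ge0//; first exact: ltW.
  exact: sinh_le.
- by rewrite mulrC -ltr_pdivrMr.
- exact: sinh_filling_ball.
Qed.

End hyperbolic_filling.

Theorem theorem6p1 (R : realType) :
  exists Ca Cb : R -> R -> R,
  forall (N : R * R -> R) (Y : mmdata R) (alpha beta p : R),
    warping_norm N ->
    metric_measure_space Y -> length_space (dist Y) ->
    0 < alpha -> 0 < beta ->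
    1 <= p -> weak_local_poincare Y p p ->
    let Hexp := exp_filling N alpha beta Y in
    let Hsinh := sinh_filling N alpha beta Y in
    [/\ p <= beta / alpha ->
          sobolev_poincare Hexp p p (Ca beta p) /\
          D1 Hexp p = N1_plus_cst Hexp p,
        p <= beta / alpha -> (mass Y [set: Y] < +oo)%E ->
          sobolev_poincare Hsinh p p (Cb beta p) /\
          D1 Hsinh p = N1_plus_cst Hsinh p &
        (beta / alpha < p -> (exists y y' : Y, y <> y') ->
          D1 Hexp p <> N1_plus_cst Hexp p) /\
        (beta / alpha < p -> (exists y y' : Y, y <> y') ->
          (mass Y [set: Y] < +oo)%E ->
          D1 Hsinh p <> N1_plus_cst Hsinh p)].
Proof.
exists (fun beta p => p / beta), (fun beta p => p / beta).
move=> N Y alpha beta p hN mmY lY a0 b0 p1 wlp Hexp Hsinh; split.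
- exact: exp_filling_positive.
- by move=> pba finY; exact: sinh_filling_positive.
split => [pba [y [y' yy']]|pba [y [y' yy']] finY].
- exact: (exp_filling_negative hN mmY lY a0 b0 p1 yy').
- exact: (sinh_filling_negative hN mmY lY a0 b0 p1 finY yy').
Qed.
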